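(* Let $L$ be a finitely generated field extension of $k$, and let $M$ be an étale $\tau$-module over $L(t)$ that is pure of weight $0$. Then the natural map \[M^\tau\otimes_{k(t)}k(\!(t^{-1})\!)\longrightarrow\Big(\big(L^{\mathrm{sep}}(\!(t^{-1})\!)\otimes_{L(t)}M\big)^\tau\Big)^{\mathrm{Gal}_L}\] is an isomorphism of finite-dimensional $k(\!(t^{-1})\!)$-vector spaces.
   Context: $k$ is a finite field with $q$ elements and $t$ an indeterminate. For a field $L\supseteq k$, $L^{\mathrm{sep}}$ is a separable closure, $\mathrm{Gal}_L=\mathrm{Gal}(L^{\mathrm{sep}}/L)$; $L(\!(t^{-1})\!)$ is the ring of Laurent series in $t^{-1}$ and $\sigma(\sum c_it^{-i})=\sum c_i^qt^{-i}$. For a $\sigma$-stable subring $R\subseteq L(\!(t^{-1})\!)$, a $\tau$-module over $R$ is an $R$-module $M$ with an additive map $\tau_M$ satisfying $\tau_M(fm)=\sigma(f)\tau_M(m)$; it is étale if $M$ is free of finite rank and $R\otimes_{\sigma,R}M\to M$, $f\otimes m\mapsto f\tau_M(m)$, is an isomorphism. Base change $R'\otimes_RM$ carries $\tau(f\otimes m)=\sigma(f)\otimes\tau_M(m)$. $M^\tau=\{m:\tau_M(m)=m\}$, a module over $\{r\in R:\sigma(r)=r\}$ (which is $k(t)$ for $R=L(t)$ and $k(\!(t^{-1})\!)$ for $R=L^{\mathrm{sep}}(\!(t^{-1})\!)$). $\mathrm{Gal}_L$ acts on $L^{\mathrm{sep}}(\!(t^{-1})\!)\otimes_{L(t)}M$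 through the coefficients, commuting with $\tau$. Weights: for $K\supseteq k$ separably closed and $\lambda=s/r$ in lowest terms ($r\ge1$), $N_\lambda$ is the free $K(\!(t^{-1})\!)$-module with basis $e_1,\dots,e_r$ and $\sigma$-semilinear $\tau$ with $\tau(e_i)=e_{i+1}$ ($i<r$), $\tau(e_r)=t^se_1$; every étale $\tau$-module over $K(\!(t^{-1})\!)$ is isomorphic to $\bigoplus N_{\lambda_i}$ for a unique multiset $\{\lambda_i\}$ (its weights). The weights of an étale $\tau$-module $M$ over $L(t)$ are those of $K(\!(t^{-1})\!)\otimes_{L(t)}M$ for any separably closed $K\supseteq L$; $M$ is pure of weight $\lambda$ if all weights equal $\lambda$. *)

(* Defs.v *)
From HB Require Import structures.
From mathcomp Require Import all_boot all_order all_algebra all_field.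
From mathcomp Require Import fraction generic_quotient.
From mathcomp Require Import boolp classical_sets fsbigop.
From mathcomp Require Import zify.

Set Implicit Arguments.
Unset Strict Implicit.
Unset Printing Implicit Defensive.

Import Order.TTheory GRing.Theory Num.Theory.
Local Open Scope ring_scope.

Section LaurentDef.
Variable K : fieldType.
Implicit Types f g h : int -> K.

Definition bounded_below f := exists N : int, forall i, i < N -> f i = 0.

(* [laurent K] is K((t^-1)); [lcoef f i] is the coefficient of t^(-i). *)
Record laurent := Laurent {
  lcoef : int -> K;
  lcoefP : bounded_below lcoef
}.

Lemma laurentP (x y : laurent) : lcoef x =1 lcoef y -> x = y.
Proof.
case: x y => [f bf] [g bg] /= /funext fg.
by rewrite fg in bf *; rewrite (Prop_irrelevance bf bg).
Qed.

HB.instance Definition _ := gen_eqMixin laurent.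
HB.instance Definition _ := gen_choiceMixin laurent.

Fact lzero_subproof : bounded_below (fun=> 0). Proof. by exists 0. Qed.
Definition lzero := Laurent lzero_subproof.

Fact lopp_subproof (x : laurent) : bounded_below (fun i => - lcoef x i).
Proof. by case: x => f [N fN] /=; exists N => i /fN->; rewrite oppr0. Qed.
Definition lopp x := Laurent (lopp_subproof x).

Fact ladd_subproof (x y : laurent) :
  bounded_below (fun i => lcoef x i + lcoef y i).
Proof.
case: x y => [f [N fN]] [g [M gM]] /=; exists (Num.min N M) => i.
by rewrite lt_min => /andP[/fN-> /gM->]; rewrite addr0.
Qed.
Definition ladd x y := Laurent (ladd_subproof x y).

Fact laddA : associative ladd.
Proof. by move=> x y z; apply: laurentP => i /=; rewrite addrA. Qed.
Fact laddC : commutative ladd.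
Proof. by move=> x y; apply: laurentP => i /=; rewrite addrC. Qed.
Fact ladd0r : left_id lzero ladd.
Proof. by move=> x; apply: laurentP => i /=; rewrite add0r. Qed.
Fact laddNr : left_inverse lzero lopp ladd.
Proof. by move=> x; apply: laurentP => i /=; rewrite addNr. Qed.
HB.instance Definition _ :=
  GRing.isZmodule.Build laurent laddA laddC ladd0r laddNr.

(* \sum_(i \in A) is the sum over the finite support of its summand, which is
   finite here as soon as f and g are bounded below. *)
Definition conv f g : int -> K :=
  fun n => \sum_(i \in [set: int]) f i * g (n - i).

Definition vanish (a : int) f := forall i, i < a -> f i = 0.

(* [trunc a N f] : the coefficients of f at a, ..., a + N - 1, as a polynomial. *)
Definition trunc (a : int) (N : nat) f : {poly K} := \poly_(i < N) f (a + i%:Z).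

Lemma int_ge_nat (a m : int) : ~~ (m < a) -> exists n : nat, m = a + n%:Z.
Proof.
by move=> am; exists `|m - a|%N; lia.
Qed.

Lemma conv_lt a b f g : vanish a f -> vanish b g -> vanish (a + b) (conv f g).
Proof.
move=> fa gb m mab; rewrite /conv fsbig1// => i _.
have [/fa->|ai] := ltP i a; first by rewrite mul0r.
by rewrite gb ?mulr0//; lia.
Qed.

Lemma conv_nat a b f g (n N : nat) : vanish a f -> vanish b g -> (n < N)%N ->
  conv f g (a + b + n%:Z) = (trunc a N f * trunc b N g)`_n.
Proof.
move=> fa gb nN; rewrite /conv coefM.
pose r := [seq a + (j : nat)%:Z | j <- index_iota 0 n.+1].
rewrite -(fsbig_widen [set` r]%classic)//; last first.
  move=> i [_ /= ir]; have [/fa->|] := boolP (i < a); first by rewrite mul0r.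
  case/int_ge_nat => j ij; rewrite gb ?mulr0//.
  have nj : (n < j)%N.
    rewrite ltnNge; apply/negP => jn; apply: ir; apply/mapP; exists j => //.
    by rewrite mem_index_iota ltnS.
  by lia.
rewrite -fsbig_seq; last first.
  by rewrite map_inj_uniq ?iota_uniq// => i j /addrI [].
rewrite big_map big_mkord; apply: eq_bigr => -[j /= jn] _.
rewrite !coef_poly (leq_ltn_trans _ nN)// (leq_ltn_trans (leq_subr _ _) nN).
by congr (_ * g _); lia.
Qed.

Lemma conv_bounded (x y : laurent) : bounded_below (conv (lcoef x) (lcoef y)).
Proof.
by case: x y => [f [a fa]] [g [b gb]] /=; exists (a + b); apply: conv_lt.
Qed.


Definition lmul x y := Laurent (conv_bounded x y).

Lemma coef_take_mul (p p' r r' : {poly K}) (n : nat) :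
  (forall i, (i <= n)%N -> p`_i = p'`_i) ->
  (forall i, (i <= n)%N -> r`_i = r'`_i) ->
  (p * r)`_n = (p' * r')`_n.
Proof.
move=> pp rr; rewrite !coefM; apply: eq_bigr => -[i /= ilt] _.
by rewrite pp ?rr ?leq_subr// -ltnS.
Qed.

Lemma coef_trunc a N f (i : nat) : (i < N)%N -> (trunc a N f)`_i = f (a + i%:Z).
Proof. by move=> iN; rewrite coef_poly iN. Qed.

Fact lmulC : commutative lmul.
Proof.
move=> [f bf] [g bg]; apply: laurentP => m /=.
have [[a fa] [b gb]] := (bf, bg).
have [mab|/int_ge_nat[n ->]] := boolP (m < a + b).
  by rewrite (conv_lt fa gb)// (conv_lt gb fa) 1?addrC.
by rewrite (conv_nat fa gb (ltnSn n)) [a + b]addrC (conv_nat gb fa (ltnSn n)) mulrC.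
Qed.

Fact lmulA : associative lmul.
Proof.
move=> [f bf] [g bg] [h bh]; apply: laurentP => m /=.
have [[[a fa] [b gb]] [c hc]] := (bf, bg, bh).
have fg := conv_lt fa gb; have gh := conv_lt gb hc.
have [mab|] := boolP (m < a + b + c).
  have -> : conv (conv f g) h m = 0 by apply: (conv_lt fg hc).
  by apply: (conv_lt fa gh); rewrite addrA.
case/int_ge_nat => n ->.
rewrite (conv_nat fg hc (ltnSn n)) -[a + b + c]addrA (conv_nat fa gh (ltnSn n)).
transitivity (trunc a n.+1 f * (trunc b n.+1 g * trunc c n.+1 h))`_n.
  apply: coef_take_mul => // i ile.
  by rewrite coef_trunc// (conv_nat gb hc (ile : (i < n.+1)%N)).
rewrite mulrA; apply: coef_take_mul => // i ile.
by rewrite coef_trunc// (conv_nat fa gb (ile : (i < n.+1)%N)).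
Qed.

Fact lmulDl : left_distributive lmul ladd.
Proof.
move=> [f [a0 fa0]] [g [b0 gb0]] [h [c hc]]; apply: laurentP => m /=.
pose a := Num.min a0 b0.
have fa : vanish a f by move=> i; rewrite lt_min => /andP[/fa0].
have ga : vanish a g by move=> i; rewrite lt_min => /andP[_ /gb0].
have fga : vanish a (fun i => f i + g i).
  by move=> i ia; rewrite fa ?ga ?addr0.
have [mac|/int_ge_nat[n ->]] := boolP (m < a + c).
  by rewrite (conv_lt fa hc)// (conv_lt ga hc)// (conv_lt fga hc)// addr0.
rewrite (conv_nat fa hc (ltnSn n)) (conv_nat ga hc (ltnSn n)).
rewrite (conv_nat fga hc (ltnSn n)) -coefD -mulrDl.
by apply: coef_take_mul => // i ile; rewrite coefD !coef_trunc.
Qed.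

(* [lmono c n] is the monomial c * t^(-n). *)
Fact lmono_subproof (c : K) (n : int) :
  bounded_below (fun i => if i == n then c else 0).
Proof. by exists n => i; rewrite lt_neqAle => /andP[/negPf->]. Qed.
Definition lmono c n := Laurent (lmono_subproof c n).

Lemma lcoef_monoM c n x i : lcoef (lmul (lmono c n) x) i = c * lcoef x (i - n).
Proof.
rewrite /= /conv -(fsbig_widen [set n]%classic)//.
  by rewrite fsbig_set1 eqxx.
by move=> j [_ /= /eqP/negPf ->]; rewrite mul0r.
Qed.

Fact lmul1r : left_id (lmono 1 0) lmul.
Proof. by move=> x; apply: laurentP => i; rewrite lcoef_monoM mul1r subr0. Qed.

Fact lone_neq0 : lmono 1 0 != 0 :> laurent.
Proof.
apply/eqP => /(congr1 (fun x : laurent => lcoef x 0))/= /eqP.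
by rewrite oner_eq0.
Qed.
HB.instance Definition _ :=
  GRing.Zmodule_isComNzRing.Build laurent lmulA lmulC lmul1r lmulDl lone_neq0.

Lemma vanish_first a (x : laurent) : vanish a (lcoef x) -> x != 0 ->
  exists2 b, vanish b (lcoef x) & lcoef x b != 0.
Proof.
move=> xa x0.
have /existsNP[i xi] : ~ forall i, lcoef x i = 0.
  by move=> xz; case/eqP: x0; apply: laurentP => i; rewrite xz.
have ex : exists n : nat, lcoef x (a + n%:Z) != 0.
  have [/xa//|/int_ge_nat[n def_i]] := boolP (i < a).
  by exists n; rewrite -def_i; apply/eqP.
case: (ex_minnP ex) => n xn nmin; exists (a + n%:Z) => // j.
have [/xa//|/int_ge_nat[k ->]] := boolP (j < a) => kn.
apply/eqP; apply: contraT => /nmin; lia.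
Qed.

Lemma laurent_inv_exists (x : laurent) : x != 0 -> exists y, y * x = 1.
Proof.
move=> x0; have [a0 xa0] := lcoefP x.
have [a xa xa_n0] := vanish_first xa0 x0; move: xa xa_n0.
set f := lcoef x; set c := f a => xa c0.
pose F n := trunc a n.+1 f.
pose p := fix p n : {poly K} := match n with
  | 0 => (c^-1)%:P
  | n'.+1 => p n' - (c^-1 * (p n' * F n'.+1)`_n'.+1) *: 'X^(n'.+1)
  end.
have pS n i : (i <= n)%N -> (p n.+1)`_i = (p n)`_i.
  by move=> i_n; rewrite /= coefB coefZ coefXn ltn_eqF// mulr0 subr0.
have pst n i : (i <= n)%N -> (p n)`_i = (p i)`_i.
  elim: n => [|n IHn]; first by rewrite leqn0 => /eqP->.
  rewrite leq_eqVlt => /predU1P[->//|i_n]; by rewrite pS ?IHn.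
have pF n : (p n * F n)`_n = (n == 0)%:R.
  case: n => [|n] /=.
    by rewrite coefCM coef_trunc// addr0 mulVf.
  rewrite mulrBl coefB -scalerAl coefZ coefXnM ltnn subnn coef_trunc// addr0.
  by rewrite mulrAC mulVf// mul1r subrr.
pose u (i : int) : K := if i is Posz n then (p n)`_n else 0.
pose g i := u (i + a).
have ga : vanish (- a) g.
  by move=> i ia; rewrite /g; case def_i : (i + a) => [n|n]//=; lia.
have bg : bounded_below g by exists (- a).
exists (Laurent bg); apply: laurentP => m /=.
have [m0|] := boolP (m < - a + a).
  by rewrite (conv_lt ga xa)//; case: eqP => // m_0; lia.
case/int_ge_nat => n ->; rewrite (conv_nat ga xa (ltnSn n)).
rewrite addNr add0r; transitivity (p n * F n)`_n; last by rewrite pF; case: n.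
apply: coef_take_mul => // i i_n; rewrite coef_trunc// /g addrAC addNr add0r /=.
by rewrite (pst n).
Qed.

Definition linv (x : laurent) : laurent :=
  if pselect (exists y, y * x = 1) is left ex then projT1 (cid ex) else 0.

Fact lmulVf (x : laurent) : x != 0 -> linv x * x = 1.
Proof.
move=> x0; have x_inv := laurent_inv_exists x0; rewrite /linv.
by case: pselect => // ex; case: cid.
Qed.

Fact linv0 : linv 0 = 0 :> laurent.
Proof.
rewrite /linv; case: pselect => // ex; have [y /eqP] := ex.
by rewrite mulr0 eq_sym oner_eq0.
Qed.
HB.instance Definition _ := GRing.ComNzRing_isField.Build laurent lmulVf linv0.

Definition laurent_t : laurent := lmono 1 (-1).

End LaurentDef.

Section LaurentMap.
Variables (K K' : fieldType) (f : {rmorphism K -> K'}).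

Fact lmap_subproof (x : laurent K) : bounded_below (fun i => f (lcoef x i)).
Proof. by case: x => [c [N cN]] /=; exists N => i /cN->; rewrite rmorph0. Qed.
Definition lmap (x : laurent K) : laurent K' := Laurent (lmap_subproof x).

Fact lmap_is_zmod_morphism : zmod_morphism lmap.
Proof. by move=> x y; apply: laurentP => i /=; rewrite rmorphB. Qed.
HB.instance Definition _ :=
  GRing.isZmodMorphism.Build (laurent K) (laurent K') lmap
    lmap_is_zmod_morphism.

Fact lmap_is_monoid_morphism : monoid_morphism lmap.
Proof.
split; first by apply: laurentP => i /=; case: eqP; rewrite (rmorph0, rmorph1).
move=> [x [a xa]] [y [b yb]]; apply: laurentP => m /=.
have fxa : vanish a (fun i => f (x i)) by move=> i /xa->; rewrite rmorph0.
have fyb : vanish b (fun i => f (y i)) by move=> i /yb->; rewrite rmorph0.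
have [mab|/int_ge_nat[n ->]] := boolP (m < a + b).
  by rewrite (conv_lt xa yb)// (conv_lt fxa fyb)// rmorph0.
rewrite (conv_nat xa yb (ltnSn n)) (conv_nat fxa fyb (ltnSn n)).
rewrite -coef_map rmorphM /=; apply: coef_take_mul => i i_n.
  by rewrite coef_map !coef_trunc.
by rewrite coef_map !coef_trunc.
Qed.
HB.instance Definition _ :=
  GRing.isMonoidMorphism.Build (laurent K) (laurent K') lmap
    lmap_is_monoid_morphism.

End LaurentMap.

Section FracExt.
Variables (A : idomainType) (F : fieldType) (f : {rmorphism A -> F}).
Hypothesis f_inj : injective f.

(* The value does not depend on the representative when g is an injective
   morphism; see [frac_extE]. *)
Definition frac_ext (g : A -> F) (x : {fraction A}) : F :=
  g (\n_(repr x)) / g (\d_(repr x)).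

Lemma fraction_repr (x : {fraction A}) :
  x = tofrac (\n_(repr x)) / tofrac (\d_(repr x)).
Proof.
suff pi_frac (r : {ratio A}) :
    \pi_({fraction A})%qT r = tofrac (\n_r) / tofrac (\d_r).
  by rewrite -pi_frac reprK.
have d0 := denom_ratioP r.
apply: (canRL (mulfK _)); first by rewrite tofrac_eq0.
unlock FracField.tofrac; rewrite -[_ * _]FracField.pi_mul.
apply/eqmodP; rewrite /= FracField.equivfE /FracField.mulf.
by rewrite !numden_Ratio ?mulr1 ?oner_neq0// mulrC.
Qed.

Lemma frac_extE n d : d != 0 -> frac_ext f (tofrac n / tofrac d) = f n / f d.
Proof.
move=> d0; set x := _ / _; rewrite /frac_ext.
have r0 := denom_ratioP (repr x); have /eqP := fraction_repr x.
rewrite {1}/x eqr_div ?tofrac_eq0// -!tofracM tofrac_eq => /eqP.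
move=> /(congr1 f); rewrite !rmorphM => e.
have nz z : z != 0 -> f z != 0 by rewrite -(rmorph0 f) (inj_eq f_inj).
by apply/eqP; rewrite eqr_div ?nz// -e.
Qed.

Lemma frac_ext_tofrac n : frac_ext f (tofrac n) = f n.
Proof.
rewrite -[tofrac n]divr1 -(tofrac1 A) frac_extE ?oner_neq0//.
by rewrite rmorph1 divr1.
Qed.

Lemma frac_ext_zmod_morphism : zmod_morphism (frac_ext f).
Proof.
move=> x y; rewrite (fraction_repr x) (fraction_repr y).
move: (denom_ratioP (repr x)) (denom_ratioP (repr y)).
move: (\n_(repr x)) (\d_(repr x)) (\n_(repr y)) (\d_(repr y)) => a b c d b0 d0.
have nz z : z != 0 -> f z != 0 by rewrite -(rmorph0 f) (inj_eq f_inj).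
rewrite -mulNr -tofracN addf_div ?tofrac_eq0// -!tofracM -tofracD.
rewrite !frac_extE ?mulf_neq0// rmorphD !rmorphM rmorphN.
by rewrite -[in RHS]mulNr addf_div ?nz.
Qed.

Lemma frac_ext_monoid_morphism : monoid_morphism (frac_ext f).
Proof.
split; first by rewrite -(tofrac1 A) frac_ext_tofrac rmorph1.
move=> x y; rewrite (fraction_repr x) (fraction_repr y).
move: (denom_ratioP (repr x)) (denom_ratioP (repr y)).
move: (\n_(repr x)) (\d_(repr x)) (\n_(repr y)) (\d_(repr y)) => a b c d b0 d0.
by rewrite mulf_div -!tofracM !frac_extE ?mulf_neq0// !rmorphM mulf_div.
Qed.

End FracExt.

Notation ratfun K := {fraction {poly K}}.

Section RatMap.
Variables (K K' : fieldType) (f : {rmorphism K -> K'}).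

Definition tofrac_map (p : {poly K}) : ratfun K' := tofrac (map_poly f p).
HB.instance Definition _ :=
  GRing.RMorphism.copy tofrac_map (@tofrac _ \o map_poly f).

Lemma tofrac_map_inj : injective tofrac_map.
Proof.
move=> p q /eqP; rewrite /tofrac_map tofrac_eq => /eqP.
exact: (map_poly_inj f).
Qed.

Definition ratmap : ratfun K -> ratfun K' := frac_ext tofrac_map.
HB.instance Definition _ :=
  GRing.isZmodMorphism.Build (ratfun K) (ratfun K') ratmap
    (frac_ext_zmod_morphism tofrac_map_inj).
HB.instance Definition _ :=
  GRing.isMonoidMorphism.Build (ratfun K) (ratfun K') ratmap
    (frac_ext_monoid_morphism tofrac_map_inj).

Lemma ratmap_tofrac p : ratmap (tofrac p) = tofrac (map_poly f p).
Proof. exact: frac_ext_tofrac tofrac_map_inj p. Qed.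

Lemma ratmap_div n d : ratmap (tofrac n / tofrac d) =
  tofrac (map_poly f n) / tofrac (map_poly f d).
Proof. by rewrite -!ratmap_tofrac; apply: (fmorph_div ratmap). Qed.

End RatMap.

Section RatLaurent.
Variable K : fieldType.

Definition lconst (c : K) : laurent K := lmono c 0.

Fact lconst_zmod_morphism : zmod_morphism lconst.
Proof.
move=> x y; apply: laurentP => i /=.
by case: eqP; rewrite ?subr0.
Qed.
HB.instance Definition _ :=
  GRing.isZmodMorphism.Build K (laurent K) lconst lconst_zmod_morphism.
Fact lconst_monoid_morphism : monoid_morphism lconst.
Proof.
split=> // x y; apply: laurentP => i.
by rewrite (lcoef_monoM x 0) /= subr0; case: eqP; rewrite ?mulr0.
Qed.
HB.instance Definition _ :=
  GRing.isMonoidMorphism.Build K (laurent K) lconst lconst_monoid_morphism.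

Definition poly_laurent (p : {poly K}) : laurent K := (map_poly lconst p).[laurent_t K].
HB.instance Definition _ :=
  GRing.RMorphism.copy poly_laurent (horner_eval (laurent_t K) \o map_poly lconst).

Lemma lt_exp n : laurent_t K ^+ n = lmono 1 (- n%:Z).
Proof.
elim: n => [|n IHn]; first by rewrite expr0.
rewrite exprS IHn; apply: laurentP => i.
rewrite (lcoef_monoM 1 (-1)) /= mul1r.
by have -> : (i - -1 == - n%:Z) = (i == - n.+1%:Z) by apply/eqP/eqP; lia.
Qed.

Lemma lcoef_sum I (r : seq I) (F : I -> laurent K) j :
  lcoef (\sum_(i <- r) F i) j = \sum_(i <- r) lcoef (F i) j.
Proof. by elim/big_rec2: _ => //= i _ x _ <-. Qed.

Lemma lcoef_poly p (n : nat) : lcoef (poly_laurent p) (- n%:Z) = p`_n.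
Proof.
rewrite /poly_laurent horner_coef lcoef_sum.
rewrite size_map_poly.
transitivity (\sum_(i < size p) (if i == n :> nat then p`_i else 0)).
  apply: eq_bigr => i _; rewrite coef_map lt_exp.
  rewrite (lcoef_monoM _ 0) /= subr0 eqr_opp eqz_nat eq_sym.
  by case: eqP; rewrite ?mulr0 ?mulr1.
rewrite -big_mkcond /=; have [np|np] := ltnP n (size p).
  by rewrite (big_pred1 (Ordinal np)).
rewrite nth_default// big_pred0// => i; apply/eqP => ein.
by move: (ltn_ord i); rewrite ein ltnNge np.
Qed.

Lemma poly_laurent_inj : injective poly_laurent.
Proof. by move=> p q pq; apply/polyP => i; rewrite -!lcoef_poly pq. Qed.

Definition rat_laurent : ratfun K -> laurent K := frac_ext poly_laurent.
HB.instance Definition _ :=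
  GRing.isZmodMorphism.Build (ratfun K) (laurent K) rat_laurent
    (frac_ext_zmod_morphism poly_laurent_inj).
HB.instance Definition _ :=
  GRing.isMonoidMorphism.Build (ratfun K) (laurent K) rat_laurent
    (frac_ext_monoid_morphism poly_laurent_inj).

Lemma rat_laurent_tofrac p : rat_laurent (tofrac p) = poly_laurent p.
Proof. exact: frac_ext_tofrac poly_laurent_inj p. Qed.

Lemma rat_laurent_div n d :
  rat_laurent (tofrac n / tofrac d) = poly_laurent n / poly_laurent d.
Proof. by rewrite -!rat_laurent_tofrac; apply: (fmorph_div rat_laurent). Qed.

End RatLaurent.

Section MapLemmas.

Lemma lmap_poly (K K' : fieldType) (f : {rmorphism K -> K'}) (p : {poly K}) :
  lmap f (poly_laurent p) = poly_laurent (map_poly f p).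
Proof.
have lmap_mono c n : lmap f (lmono c n) = lmono (f c) n.
  by apply: laurentP => i /=; case: eqP; rewrite ?rmorph0.
rewrite /poly_laurent -horner_map /= /laurent_t lmap_mono rmorph1.
congr _.[_]; rewrite -!map_poly_comp; apply: eq_map_poly => c /=.
exact: lmap_mono.
Qed.

Lemma lmap_rat (K K' : fieldType) (f : {rmorphism K -> K'}) x :
  lmap f (rat_laurent x) = rat_laurent (ratmap f x).
Proof.
rewrite (fraction_repr x); set n := \n_(repr x); set d := \d_(repr x).
by rewrite ratmap_div !rat_laurent_div (fmorph_div (lmap f)) /= !lmap_poly.
Qed.

Lemma lmap_comp (K K' K'' : fieldType) (f : {rmorphism K -> K'})
  (g : {rmorphism K' -> K''}) x : lmap g (lmap f x) = lmap (g \o f) x.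
Proof. exact: laurentP. Qed.

Lemma eq_lmap (K K' : fieldType) (f g : {rmorphism K -> K'}) :
  f =1 g -> lmap f =1 lmap g.
Proof. by move=> fg x; apply: laurentP => i /=. Qed.

Lemma ratmap_comp (K K' K'' : fieldType) (f : {rmorphism K -> K'})
  (g : {rmorphism K' -> K''}) x : ratmap g (ratmap f x) = ratmap (g \o f) x.
Proof.
rewrite (fraction_repr x); set n := \n_(repr x); set d := \d_(repr x).
by rewrite !ratmap_div -!map_poly_comp.
Qed.

Lemma eq_ratmap (K K' : fieldType) (f g : {rmorphism K -> K'}) :
  f =1 g -> ratmap f =1 ratmap g.
Proof.
by move=> fg x; rewrite /ratmap /frac_ext /tofrac_map !(eq_map_poly fg).
Qed.

End MapLemmas.

Section Frobenius.
Variables (k : finFieldType) (L : fieldType) (iota : {rmorphism k -> L}).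

Definition frob of {rmorphism k -> L} := fun x : L => x ^+ #|k|.

Lemma frobD x y : frob iota (x + y) = frob iota x + frob iota y.
Proof.
apply: exprDn_pchar; have [p p_pr pk] := finPcharP k.
have pL : p \in [pchar L] by rewrite (fmorph_pchar iota).
rewrite (eq_pnat _ (pcharf_eq pL)).
by rewrite (card_pprimeChar pk) pnatX pnat_id.
Qed.

Lemma frob_zmod_morphism : zmod_morphism (frob iota).
Proof.
by move=> x y; apply: (addIr (frob iota y)); rewrite -frobD !subrK.
Qed.
HB.instance Definition _ :=
  GRing.isZmodMorphism.Build L L (frob iota) frob_zmod_morphism.

Lemma frob_monoid_morphism : monoid_morphism (frob iota).
Proof. by split=> [|x y]; rewrite /frob (expr1n, exprMn). Qed.
HB.instance Definition _ :=
  GRing.isMonoidMorphism.Build L L (frob iota) frob_monoid_morphism.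

Lemma frob_fixed (a : k) : frob iota (iota a) = iota a.
Proof. by rewrite /frob -rmorphXn expf_card. Qed.

End Frobenius.

Section Tensor.
Variables (R R' : comNzRingType) (phi : {rmorphism R -> R'}) (M : lmodType R).

(* A sequence of pairs (a_i, m_i) stands for the sum of the a_i (x) m_i. *)
Inductive tensor_eq : seq (R' * M) -> seq (R' * M) -> Prop :=
| TensorRefl s : tensor_eq s s
| TensorSym s t : tensor_eq s t -> tensor_eq t s
| TensorTrans s t u : tensor_eq s t -> tensor_eq t u -> tensor_eq s u
| TensorCat s s' t t' :
    tensor_eq s s' -> tensor_eq t t' -> tensor_eq (s ++ t) (s' ++ t')
| TensorCatC s t : tensor_eq (s ++ t) (t ++ s)
| Tensor0l m : tensor_eq [:: (0, m)] [::]
| TensorDl a b m : tensor_eq [:: (a + b, m)] [:: (a, m); (b, m)]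
| TensorDr a m n : tensor_eq [:: (a, m + n)] [:: (a, m); (a, n)]
| TensorBalanced a r m : tensor_eq [:: (a * phi r, m)] [:: (a, r *: m)].

Definition tensor_rel (s t : seq (R' * M)) : bool := `[< tensor_eq s t >].

Fact tensor_rel_refl : reflexive tensor_rel.
Proof. by move=> s; apply/asboolP/TensorRefl. Qed.
Fact tensor_rel_sym : symmetric tensor_rel.
Proof. by move=> s t; apply/asboolP/asboolP => /TensorSym. Qed.
Fact tensor_rel_trans : transitive tensor_rel.
Proof.
move=> t s u /asboolP st /asboolP tu; apply/asboolP.
exact: TensorTrans st tu.
Qed.
Canonical tensor_equiv :=
  EquivRel tensor_rel tensor_rel_refl tensor_rel_sym tensor_rel_trans.

(* R' (x)_R M, where R' is an R-algebra through phi: formal sums of pairs modulo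
   the congruence generated by the bilinearity relations. Opposites exist in the
   quotient because (-a) (x) m + a (x) m = 0 (x) m = 0. *)
Definition tensor := {eq_quot tensor_equiv}%qT.
HB.instance Definition _ := Choice.on tensor.
HB.instance Definition _ : EqQuotient _ tensor_equiv tensor :=
  EqQuotient.on tensor.

Definition to_tensor (s : seq (R' * M)) : tensor := (\pi_(tensor) s)%qT.

Lemma to_tensorP s t : to_tensor s = to_tensor t <-> tensor_eq s t.
Proof.
split=> [/eqmodP /asboolP//|st]; apply/eqmodP; exact/asboolP.
Qed.

Lemma to_tensorK x : to_tensor (repr x) = x.
Proof. exact: reprK. Qed.

Lemma repr_to_tensor s : tensor_eq (repr (to_tensor s)) s.
Proof. by apply/to_tensorP; rewrite to_tensorK. Qed.

Definition tensor_scale_seq (a : R') (s : seq (R' * M)) :=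
  [seq (a * p.1, p.2) | p <- s].

Lemma tensor_scale_seqP a s t :
  tensor_eq s t -> tensor_eq (tensor_scale_seq a s) (tensor_scale_seq a t).
Proof.
elim=> {s t} /=.
- by move=> s; apply: TensorRefl.
- by move=> s t _; apply: TensorSym.
- by move=> s t u _ st _; apply: TensorTrans.
- move=> s s' t t' _ ss _ tt; rewrite /tensor_scale_seq !map_cat.
  exact: TensorCat.
- by move=> s t; rewrite /tensor_scale_seq !map_cat; apply: TensorCatC.
- by move=> m; rewrite mulr0; apply: Tensor0l.
- by move=> b c m; rewrite mulrDr; apply: TensorDl.
- by move=> b m n; apply: TensorDr.
- by move=> b r m; rewrite mulrA; apply: TensorBalanced.
Qed.

Definition tensor_zero := to_tensor [::].
Definition tensor_add (x y : tensor) := to_tensor (repr x ++ repr y).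
Definition tensor_scale a (x : tensor) := to_tensor (tensor_scale_seq a (repr x)).
Definition tensor_opp := tensor_scale (-1).

Lemma tensor_addE s t :
  tensor_add (to_tensor s) (to_tensor t) = to_tensor (s ++ t).
Proof. by apply/to_tensorP; apply: TensorCat; apply: repr_to_tensor. Qed.

Lemma tensor_scaleE a s :
  tensor_scale a (to_tensor s) = to_tensor (tensor_scale_seq a s).
Proof.
by apply/to_tensorP; apply: tensor_scale_seqP; apply: repr_to_tensor.
Qed.

Lemma tensor_scale_seqDl a b s :
  tensor_eq (tensor_scale_seq (a + b) s)
            (tensor_scale_seq a s ++ tensor_scale_seq b s).
Proof.
elim: s => [|[c m] s IHs]; first exact: TensorRefl.
apply: (@TensorTrans _ ([:: (a * c, m); (b * c, m)] ++
    (tensor_scale_seq a s ++ tensor_scale_seq b s))).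
  apply: (@TensorCat [:: ((a + b) * c, m)] [:: (a * c, m); (b * c, m)]) => //.
  by rewrite mulrDl; apply: TensorDl.
apply: (@TensorCat [:: (a * c, m)] [:: (a * c, m)]
  ([:: (b * c, m)] ++ (tensor_scale_seq a s ++ tensor_scale_seq b s))
  (tensor_scale_seq a s ++ ([:: (b * c, m)] ++ tensor_scale_seq b s))).
  exact: TensorRefl.
by rewrite !catA; apply: TensorCat; [exact: TensorCatC | exact: TensorRefl].
Qed.

Fact tensor_addA : associative tensor_add.
Proof.
move=> x y z; rewrite -(to_tensorK x) -(to_tensorK y) -(to_tensorK z).
by rewrite !tensor_addE catA.
Qed.
Fact tensor_addC : commutative tensor_add.
Proof. by move=> x y; apply/to_tensorP/TensorCatC. Qed.
Fact tensor_add0 : left_id tensor_zero tensor_add.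
Proof. by move=> x; rewrite -(to_tensorK x) tensor_addE. Qed.
Fact tensor_scale0 s : tensor_eq (tensor_scale_seq 0 s) [::].
Proof.
elim: s => [|[c m] s IHs]; first exact: TensorRefl.
apply: (@TensorCat [:: (0 * c, m)] [::] _ [::]) => //.
by rewrite mul0r; apply: Tensor0l.
Qed.
Fact tensor_scale1 : left_id 1 tensor_scale.
Proof.
move=> x; rewrite -(to_tensorK x) tensor_scaleE /tensor_scale_seq.
by congr to_tensor; rewrite -[RHS]map_id; apply: eq_map => -[c m] /=; rewrite mul1r.
Qed.
Fact tensor_scaleDl x :
  {morph tensor_scale^~ x : a b / a + b >-> tensor_add a b}.
Proof.
move=> a b; rewrite -(to_tensorK x) !tensor_scaleE tensor_addE.
exact/to_tensorP/tensor_scale_seqDl.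
Qed.
Fact tensor_addN : left_inverse tensor_zero tensor_opp tensor_add.
Proof.
move=> x; rewrite -[X in tensor_add _ X]tensor_scale1 /tensor_opp.
rewrite -tensor_scaleDl addNr -(to_tensorK x) tensor_scaleE.
exact/to_tensorP/tensor_scale0.
Qed.
HB.instance Definition _ := GRing.isZmodule.Build tensor
  tensor_addA tensor_addC tensor_add0 tensor_addN.

Fact tensor_scaleA a b x :
  tensor_scale a (tensor_scale b x) = tensor_scale (a * b) x.
Proof.
rewrite -(to_tensorK x) !tensor_scaleE /tensor_scale_seq -map_comp.
by congr to_tensor; apply: eq_map => -[c m] /=; rewrite mulrA.
Qed.
Fact tensor_scaleDr : right_distributive tensor_scale +%R.
Proof.
move=> a x y; rewrite -(to_tensorK x) -(to_tensorK y).
rewrite -[_ + _]/(tensor_add _ _) -[RHS]/(tensor_add _ _).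
by rewrite !(tensor_addE, tensor_scaleE) /tensor_scale_seq map_cat.
Qed.
HB.instance Definition _ := GRing.Zmodule_isLmodule.Build R' tensor
  tensor_scaleA tensor_scale1 tensor_scaleDr tensor_scaleDl.

Definition tens (a : R') (m : M) : tensor := to_tensor [:: (a, m)].

Lemma to_tensor_cat s t : to_tensor (s ++ t) = to_tensor s + to_tensor t.
Proof. by rewrite -[RHS]/(tensor_add _ _) tensor_addE. Qed.

Lemma to_tensorE s : to_tensor s = \sum_(p <- s) tens p.1 p.2.
Proof.
elim: s => [|[a m] s IHs]; first by rewrite big_nil.
by rewrite big_cons -IHs -cat1s to_tensor_cat.
Qed.

Lemma tensDl a b m : tens (a + b) m = tens a m + tens b m.
Proof. by rewrite -to_tensor_cat; apply/to_tensorP/TensorDl. Qed.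
Lemma tensDr a m n : tens a (m + n) = tens a m + tens a n.
Proof. by rewrite -to_tensor_cat; apply/to_tensorP/TensorDr. Qed.
Lemma tens_balanced a r m : tens (a * phi r) m = tens a (r *: m).
Proof. exact/to_tensorP/TensorBalanced. Qed.
Lemma scale_tens a b m : a *: tens b m = tens (a * b) m.
Proof. exact: tensor_scaleE. Qed.
Lemma tens0l m : tens 0 m = 0.
Proof. exact/to_tensorP/Tensor0l. Qed.

Lemma tensor_ind (P : tensor -> Prop) :
  P 0 -> (forall x y, P x -> P y -> P (x + y)) -> (forall a m, P (tens a m)) ->
  forall x, P x.
Proof.
move=> P0 PD Pt x; rewrite -(to_tensorK x) to_tensorE.
by elim/big_ind: _ => // p _; apply: Pt.
Qed.

Section Lift.
Variables (V : zmodType) (f : R' -> M -> V).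

(* Well defined (see [tensor_liftE]) when f is biadditive and balanced. *)
Definition tensor_lift (x : tensor) : V := \sum_(p <- repr x) f p.1 p.2.

Hypothesis fDl : forall a b m, f (a + b) m = f a m + f b m.
Hypothesis fDr : forall a m n, f a (m + n) = f a m + f a n.
Hypothesis f_balanced : forall a r m, f (a * phi r) m = f a (r *: m).

Lemma tensor_liftE s : tensor_lift (to_tensor s) = \sum_(p <- s) f p.1 p.2.
Proof.
rewrite /tensor_lift; have := repr_to_tensor s; move: (repr _) => s'.
elim=> {s s'} //=.
- by move=> s t u _ -> _ ->.
- by move=> s s' t t' _ ss _ tt; rewrite !big_cat /= ss tt.
- by move=> s t; rewrite !big_cat /= addrC.
- move=> m; rewrite big_seq1 big_nil /=.
  by apply: (addrI (f 0 m)); rewrite -fDl !addr0.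
- by move=> a b m; rewrite big_seq1 big_cons big_seq1 /= fDl.
- by move=> a m n; rewrite big_seq1 big_cons big_seq1 /= fDr.
- by move=> a r m; rewrite !big_seq1 /=.
Qed.

Lemma tensor_lift_tens a m : tensor_lift (tens a m) = f a m.
Proof. by rewrite tensor_liftE big_seq1. Qed.

Lemma tensor_liftD x y : tensor_lift (x + y) = tensor_lift x + tensor_lift y.
Proof.
rewrite -(to_tensorK x) -(to_tensorK y) -to_tensor_cat !tensor_liftE.
by rewrite big_cat.
Qed.

End Lift.
End Tensor.

Section TensorMap.
Variables (R R' S S' : comNzRingType).
Variables (phi : {rmorphism R -> R'}) (psi : {rmorphism S -> S'}).
Variables (M : lmodType R) (N : lmodType S).

(* The map a (x) m |-> h a (x) u m. *)
Definition tensor_map (h : R' -> S') (u : M -> N) :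
    tensor phi M -> tensor psi N :=
  tensor_lift (fun a m => tens psi (h a) (u m)).

Variables (h : {rmorphism R' -> S'}) (c : R -> S).
Variable u : {additive M -> N}.
Hypothesis h_phi : forall r, h (phi r) = psi (c r).
Hypothesis u_scale : forall r m, u (r *: m) = c r *: u m.

Lemma tensor_map_tens a m :
  tensor_map h u (tens phi a m) = tens psi (h a) (u m).
Proof.
apply: tensor_lift_tens => [x y n|x n n'|x r n].
- by rewrite rmorphD tensDl.
- by rewrite raddfD tensDr.
- by rewrite rmorphM h_phi tens_balanced u_scale.
Qed.

Lemma tensor_mapD x y :
  tensor_map h u (x + y) = tensor_map h u x + tensor_map h u y.
Proof.
apply: tensor_liftD => [{}x {}y n|{}x n n'|{}x r n].
- by rewrite rmorphD tensDl.
- by rewrite raddfD tensDr.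
- by rewrite rmorphM h_phi tens_balanced u_scale.
Qed.

Lemma tensor_map_scale a x : tensor_map h u (a *: x) = h a *: tensor_map h u x.
Proof.
elim/tensor_ind: x => [|x y IHx IHy|b m].
- have -> : tensor_map h u 0 = 0.
    by apply: (addrI (tensor_map h u 0)); rewrite -tensor_mapD !addr0.
  rewrite !scaler0.
  by apply: (addrI (tensor_map h u 0)); rewrite -tensor_mapD !addr0.
- by rewrite scalerDr !tensor_mapD IHx IHy scalerDr.
- by rewrite scale_tens !tensor_map_tens scale_tens rmorphM.
Qed.

End TensorMap.
Arguments tensor_map {R R' S S'} phi psi {M N} h u x.

Section Restriction.
Variables (R0 R : comNzRingType) (phi : {rmorphism R0 -> R}) (M : lmodType R).

(* M seen as an R0-module through phi. *)
Definition restr of {rmorphism R0 -> R} := fun M : lmodType R => M : Type.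
Local Notation M0 := (restr phi M).
HB.instance Definition _ := GRing.Zmodule.copy M0 M.

Definition restr_scale (a : R0) (m : M0) : M0 := phi a *: (m : M).

Fact restr_scaleA a b m :
  restr_scale a (restr_scale b m) = restr_scale (a * b) m.
Proof. by rewrite /restr_scale scalerA rmorphM. Qed.
Fact restr_scale1 : left_id 1 restr_scale.
Proof. by move=> m; rewrite /restr_scale rmorph1 scale1r. Qed.
Fact restr_scaleDr : right_distributive restr_scale +%R.
Proof. by move=> a m n; rewrite /restr_scale; apply: scalerDr. Qed.
Fact restr_scaleDl m : {morph restr_scale^~ m : a b / a + b}.
Proof. by move=> a b; rewrite /restr_scale rmorphD; apply: scalerDl. Qed.
HB.instance Definition _ := GRing.Zmodule_isLmodule.Build R0 M0
  restr_scaleA restr_scale1 restr_scaleDr restr_scaleDl.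

Lemma restr_scaleE a (m : M0) : a *: m = phi a *: (m : M).
Proof. by []. Qed.

End Restriction.

Section Fixed.
Variables (R : comNzRingType) (W : lmodType R).
Variables (I : Type) (act : I -> {linear W -> W}).

Definition fixed_pred : {pred W} := fun w => `[< forall i, act i w = w >].

Record fixed := Fixed { fixed_val : W; _ : fixed_val \in fixed_pred }.
HB.instance Definition _ := [isSub for fixed_val].
HB.instance Definition _ := [Choice of fixed by <:].

Fact fixed_pred_closed : submod_closed fixed_pred.
Proof.
split=> [|a x y /asboolP xf /asboolP yf]; apply/asboolP => i.
  by rewrite linear0.
by rewrite linearP xf yf.
Qed.
HB.instance Definition _ :=
  GRing.isSubmodClosed.Build R W fixed_pred fixed_pred_closed.
HB.instance Definition _ := [SubChoice_isSubLmodule of fixed by <:].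

Lemma fixedP (x : fixed) i : act i (val x) = val x.
Proof. by case: x => x /= /asboolP. Qed.

Lemma mem_fixed w : (forall i, act i w = w) -> w \in fixed_pred.
Proof. by move=> wf; apply/asboolP. Qed.

End Fixed.

Definition free_of_finite_rank (R : comNzRingType) (M : lmodType R) : Prop :=
  exists (n : nat) (e : 'I_n -> M),
    forall m, exists! c : 'rV[R]_n, m = \sum_i c 0 i *: e i.

Record tauModule (R : comNzRingType) (sigma : {rmorphism R -> R}) := TauModule {
  tau_carrier :> lmodType R;
  tau : {linear tau_carrier -> tau_carrier | sigma \; *:%R}
}.
Arguments tau {R sigma} t.

Section TauModules.
Variables (R : comNzRingType) (sigma : {rmorphism R -> R}).
Implicit Types M N : tauModule sigma.

Lemma tauD M (x y : M) : tau M (x + y) = tau M x + tau M y.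
Proof. exact: raddfD. Qed.

Lemma tauZ M f (m : M) : tau M (f *: m) = sigma f *: tau M m.
Proof. exact: linearZ. Qed.

(* The map R (x)_(sigma, R) M -> M sending f (x) m to f tau(m). *)
Definition tau_linearization M : tensor sigma M -> M :=
  tensor_lift (fun f m => f *: tau M m).

Lemma tau_linearization_tens M f m :
  tau_linearization (tens sigma f m) = f *: tau M m.
Proof.
apply: tensor_lift_tens => [a b n|a n n'|a r n].
- by rewrite scalerDl.
- by rewrite raddfD scalerDr.
- by rewrite linearZ /= scalerA.
Qed.

Definition etale M : Prop :=
  free_of_finite_rank M /\ bijective (@tau_linearization M).

Definition tau_iso M N : Prop :=
  exists f : {linear M -> N},
    bijective f /\ forall m, f (tau M m) = tau N (f m).

Definition tau_zero_fun (x : 'rV[R]_0) : 'rV[R]_0 := 0.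
Fact tau_zero_linear : linear_for (sigma \; *:%R) tau_zero_fun.
Proof. by move=> a x y; rewrite !thinmx0. Qed.
HB.instance Definition _ :=
  GRing.isLinear.Build R 'rV[R]_0 'rV[R]_0 (sigma \; *:%R) tau_zero_fun
    tau_zero_linear.
Definition tau_zero : tauModule sigma := TauModule tau_zero_fun.

Definition tau_sum_fun M N (x : M * N) : M * N := (tau M x.1, tau N x.2).
Fact tau_sum_linear M N : linear_for (sigma \; *:%R) (@tau_sum_fun M N).
Proof.
by move=> a [x1 x2] [y1 y2]; rewrite /tau_sum_fun /= !linearP.
Qed.
HB.instance Definition _ M N :=
  GRing.isLinear.Build R (M * N)%type (M * N)%type (sigma \; *:%R)
    (@tau_sum_fun M N) (@tau_sum_linear M N).
Definition tau_sum M N : tauModule sigma := TauModule (@tau_sum_fun M N).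

End TauModules.

Section BaseChange.
Variables (R R' : comNzRingType).
Variables (sigma : {rmorphism R -> R}) (sigma' : {rmorphism R' -> R'}).
Variables (phi : {rmorphism R -> R'}).
Hypothesis phi_sigma : forall r, sigma' (phi r) = phi (sigma r).
Variable M : tauModule sigma.

(* The map f (x) m |-> sigma'(f) (x) tau(m). *)
Definition base_change_fun of (forall r, sigma' (phi r) = phi (sigma r)) :
    tensor phi M -> tensor phi M :=
  tensor_map phi phi sigma' (tau M).

Fact base_change_linear :
  linear_for (sigma' \; *:%R) (base_change_fun phi_sigma).
Proof.
have tauZ r m : tau M (r *: m) = sigma r *: tau M m by rewrite linearZ.
move=> a x y; rewrite /base_change_fun (tensor_mapD phi_sigma tauZ).
by rewrite (tensor_map_scale phi_sigma tauZ).
Qed.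
HB.instance Definition _ :=
  GRing.isLinear.Build R' (tensor phi M) (tensor phi M) (sigma' \; *:%R)
    (base_change_fun phi_sigma) base_change_linear.

(* R' (x)_R M as a tau-module over R'. *)
Definition base_change : tauModule sigma' :=
  TauModule (base_change_fun phi_sigma).

Lemma base_change_tens f m :
  tau base_change (tens phi f m) = tens phi (sigma' f) (tau M m).
Proof.
have tauZ r n : tau M (r *: n) = sigma r *: tau M n by rewrite linearZ.
exact: (tensor_map_tens phi_sigma tauZ).
Qed.

End BaseChange.

Section Invariants.
Variables (R0 R : comNzRingType) (sigma : {rmorphism R -> R}).
Variables (phi : {rmorphism R0 -> R}).
Hypothesis sigma_phi : forall r, sigma (phi r) = phi r.
Variable M : tauModule sigma.

Definition tau_restr of (forall r, sigma (phi r) = phi r) :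
  restr phi M -> restr phi M := tau M.
Fact tau_restr_linear : linear (tau_restr sigma_phi).
Proof.
move=> a x y; rewrite /tau_restr !restr_scaleE.
by rewrite [LHS](linearP (tau M)) /= sigma_phi.
Qed.
HB.instance Definition _ :=
  GRing.isLinear.Build R0 (restr phi M) (restr phi M) *:%R
    (tau_restr sigma_phi) tau_restr_linear.

(* M^tau as an R0-module, where phi maps R0 to the elements fixed by sigma. *)
Definition tau_inv : lmodType R0 :=
  fixed (fun _ : unit => tau_restr sigma_phi).

Definition tau_inv_val (x : tau_inv) : M := fixed_val x.

Lemma tau_inv_valP x : tau M (tau_inv_val x) = tau_inv_val x.
Proof. exact: (fixedP x tt). Qed.

Lemma tau_inv_val_inj : injective tau_inv_val.
Proof. exact: val_inj. Qed.

Fact tau_inv_val_zmod_morphism : zmod_morphism tau_inv_val.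
Proof. by []. Qed.
HB.instance Definition _ :=
  GRing.isZmodMorphism.Build tau_inv M tau_inv_val tau_inv_val_zmod_morphism.

Lemma tau_inv_valZ r x : tau_inv_val (r *: x) = phi r *: tau_inv_val x.
Proof. by []. Qed.

Definition to_tau_inv (m : M) (tau_m : tau M m = m) : tau_inv :=
  Fixed (@mem_fixed _ (restr phi M) unit (fun _ => tau_restr sigma_phi) m
    (fun=> tau_m)).

Lemma to_tau_invK m (tau_m : tau M m = m) : tau_inv_val (to_tau_inv tau_m) = m.
Proof. by []. Qed.

End Invariants.

Section SeparableClosure.
Variables (K : fieldType).

Definition separably_closed : Prop :=
  forall p : {poly K}, separable_poly p -> (1 < size p)%N -> exists x, root p x.

End SeparableClosure.

(* Every x in E is algebraic over L, and its minimal polynomial (p, up to a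
   scalar) is separable. *)
Definition separable_closure (L E : fieldType) (j : {rmorphism L -> E}) : Prop :=
  separably_closed E /\
  forall x : E, exists p : {poly L},
    [/\ irreducible_poly p, separable_poly p & root (map_poly j p) x].

Section GaloisGroup.
Variables (L E : fieldType) (j : {rmorphism L -> E}).

Record galois_aut := GaloisAut {
  gal_fun :> {rmorphism E -> E};
  gal_bij : bijective gal_fun;
  gal_fix : forall x, gal_fun (j x) = j x
}.

End GaloisGroup.

(* L is the smallest subfield containing the image of k and a finite set. *)
Definition finitely_generated_field (k L : fieldType) (iota : {rmorphism k -> L})
    : Prop :=
  exists s : seq L, forall S : {pred L},
    GRing.divring_closed S -> (forall a, iota a \in S) -> {subset s <= S} ->
    forall x, x \in S.

Section Sigma.
Variables (k : finFieldType) (L : fieldType) (iota : {rmorphism k -> L}).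

Definition sigma_rat : {rmorphism ratfun L -> ratfun L} := ratmap (frob iota).
Definition sigma_laurent : {rmorphism laurent L -> laurent L} :=
  lmap (frob iota).

Lemma sigma_rat_laurent x :
  sigma_laurent (rat_laurent x) = rat_laurent (sigma_rat x).
Proof. exact: lmap_rat. Qed.

Definition rat_base : {rmorphism ratfun k -> ratfun L} := ratmap iota.
Definition laurent_base : {rmorphism laurent k -> laurent L} := lmap iota.

Lemma sigma_rat_base x : sigma_rat (rat_base x) = rat_base x.
Proof.
rewrite /sigma_rat /rat_base /= ratmap_comp.
by apply: eq_ratmap => a /=; rewrite frob_fixed.
Qed.

Lemma sigma_laurent_base x : sigma_laurent (laurent_base x) = laurent_base x.
Proof. by apply: laurentP => i /=; rewrite frob_fixed. Qed.

End Sigma.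

Section Weights.
Variables (k : finFieldType) (K : fieldType) (iota : {rmorphism k -> K}).
Local Notation sigma := (sigma_laurent iota).

(* The matrix whose i-th row is the image tau(e_i) of the i-th basis vector of
   N_lambda, for lambda = s / r. *)
Definition weight_mx (s : int) (r : nat) : 'M[laurent K]_r :=
  \matrix_(i < r, j < r)
    if i.+1 == j then 1
    else if (i.+1 == r) && (j == 0 :> nat) then laurent_t K ^ s else 0.

Definition weight_fun of {rmorphism k -> K} := fun (s : int) (r : nat)
  (x : 'rV[laurent K]_r) => map_mx sigma x *m weight_mx s r.

Fact weight_linear s r : linear_for (sigma \; *:%R) (@weight_fun iota s r).
Proof.
by move=> a x y; rewrite /weight_fun map_mxD map_mxZ mulmxDl -scalemxAl.
Qed.
HB.instance Definition _ s r :=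
  GRing.isLinear.Build (laurent K) 'rV[laurent K]_r 'rV[laurent K]_r
    (sigma \; *:%R) (@weight_fun iota s r) (@weight_linear s r).

Definition weight_module (lambda : rat) : tauModule sigma :=
  TauModule (@weight_fun iota (numq lambda) `|denq lambda|%N).

(* N is isomorphic to the direct sum of the N_lambda for lambda in w; the
   multiset of weights is represented by the sequence w. *)
Definition has_weights (N : tauModule sigma) (w : seq rat) : Prop :=
  tau_iso N
    (foldr (fun lambda => tau_sum (weight_module lambda)) (tau_zero sigma) w).

End Weights.

Section Pure.
Variables (k : finFieldType) (L : fieldType) (iota : {rmorphism k -> L}).
Variable M : tauModule (sigma_rat iota).

Section LaurentBaseChange.
Variables (K : fieldType) (j : {rmorphism L -> K}).

Definition rat_to_laurent : {rmorphism ratfun L -> laurent K} :=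
  lmap j \o @rat_laurent L.

Lemma sigma_rat_to_laurent x :
  sigma_laurent (j \o iota) (rat_to_laurent x) =
  rat_to_laurent (sigma_rat iota x).
Proof.
rewrite /= -lmap_rat; apply: laurentP => i /=.
by rewrite /frob rmorphXn.
Qed.

(* K((t^-1)) (x)_(L(t)) M. *)
Definition laurent_base_change : tauModule (sigma_laurent (j \o iota)) :=
  base_change sigma_rat_to_laurent M.

End LaurentBaseChange.

(* The multiset w of weights exists, is unique, and does not depend on the
   separably closed extension K of L used to compute it, so that quantifying K
   existentially gives the weakest form of this condition. *)
Definition pure_of_weight (lambda : rat) : Prop :=
  exists (K : fieldType) (j : {rmorphism L -> K}) (w : seq rat),
    [/\ separably_closed K, has_weights (laurent_base_change j) w
      & forall mu, mu \in w -> mu = lambda].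

End Pure.


Section NaturalMap.
Variables (k : finFieldType) (L : fieldType) (iota : {rmorphism k -> L}).
Variables (E : fieldType) (j : {rmorphism L -> E}).
Variable M : tauModule (sigma_rat iota).

Local Notation ME := (laurent_base_change M j).
Local Notation base := (laurent_base (j \o iota)).

(* M^tau as a k(t)-vector space. *)
Definition rat_tau_inv : lmodType (ratfun k) :=
  tau_inv (@sigma_rat_base _ _ iota) M.

(* (E((t^-1)) (x)_(L(t)) M)^tau as a k((t^-1))-vector space. *)
Definition laurent_tau_inv : lmodType (laurent k) :=
  tau_inv (@sigma_laurent_base _ _ (j \o iota)) ME.

(* Gal(E / L) acts on E((t^-1)) (x)_(L(t)) M by g (f (x) m) = g(f) (x) m. *)
Definition gal_act (g : galois_aut j) : ME -> ME := tensor_map _ _ (lmap g) idfun.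

Fact gal_rat_to_laurent (g : galois_aut j) x :
  lmap g (rat_to_laurent j x) = rat_to_laurent j (id x).
Proof. by apply: laurentP => i /=; rewrite gal_fix. Qed.

Lemma gal_act_tens g f m :
  gal_act g (tens (rat_to_laurent j) f m) =
  tens (rat_to_laurent j) (lmap g f) m.
Proof. exact: (tensor_map_tens (gal_rat_to_laurent g)). Qed.

Lemma gal_actD g x y : gal_act g (x + y) = gal_act g x + gal_act g y.
Proof. exact: (tensor_mapD (gal_rat_to_laurent g)). Qed.

Lemma gal_act_scale g (a : laurent k) x :
  gal_act g (base a *: x) = base a *: gal_act g x.
Proof.
rewrite [LHS](tensor_map_scale (gal_rat_to_laurent g))//.
by congr (_ *: _); apply: laurentP => i /=; rewrite gal_fix.
Qed.

Lemma gal_act0 g : gal_act g 0 = 0.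
Proof. by apply: (addrI (gal_act g 0)); rewrite -gal_actD !addr0. Qed.

Lemma gal_act_tau g x : gal_act g (tau ME x) = tau ME (gal_act g x).
Proof.
elim/tensor_ind: x => [|x y IHx IHy|f m].
- by rewrite raddf0 gal_act0 raddf0.
- by rewrite gal_actD !raddfD gal_actD IHx IHy.
- rewrite base_change_tens !gal_act_tens base_change_tens.
  congr tens; apply: laurentP => i /=; by rewrite /frob rmorphXn.
Qed.

Fact gal_inv_subproof g (x : laurent_tau_inv) :
  tau ME (gal_act g (tau_inv_val x)) = gal_act g (tau_inv_val x).
Proof. by rewrite -gal_act_tau tau_inv_valP. Qed.
Definition gal_inv g (x : laurent_tau_inv) : laurent_tau_inv :=
  to_tau_inv _ (gal_inv_subproof g x).

Fact gal_inv_linear g : linear (gal_inv g).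
Proof.
move=> a x y; apply: tau_inv_val_inj.
pose z := base a *: tau_inv_val x + tau_inv_val y.
have z_eq : tau_inv_val (gal_inv g (a *: x + y)) = gal_act g z by [].
by rewrite z_eq /z gal_actD gal_act_scale.
Qed.
HB.instance Definition _ g :=
  GRing.isLinear.Build (laurent k) laurent_tau_inv laurent_tau_inv *:%R
    (gal_inv g) (gal_inv_linear g).

(* ((E((t^-1)) (x)_(L(t)) M)^tau)^Gal(E / L) *)
Definition laurent_gal_inv : lmodType (laurent k) := fixed gal_inv.

(* M^tau (x)_(k(t)) k((t^-1)) *)
Definition tensor_tau_inv : lmodType (laurent k) :=
  tensor (@rat_laurent k) rat_tau_inv.

(* The map f (x) m |-> f (x) m. *)
Definition natural_map_val : tensor_tau_inv -> ME :=
  tensor_map _ _ base (fun m : rat_tau_inv => tau_inv_val m).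

Fact base_rat_laurent r :
  base (rat_laurent r) = rat_to_laurent j (rat_base iota r).
Proof. by rewrite /= lmap_rat lmap_rat ratmap_comp. Qed.

Let base_rat := base_rat_laurent.
Let val_scale (r : ratfun k) (m : rat_tau_inv) := tau_inv_valZ r m.

Lemma natural_map_val_tens f m : natural_map_val (tens _ f m) =
  tens (rat_to_laurent j) (base f) (tau_inv_val m).
Proof. exact: (tensor_map_tens base_rat val_scale). Qed.

Lemma natural_map_valD x y :
  natural_map_val (x + y) = natural_map_val x + natural_map_val y.
Proof. exact: (tensor_mapD base_rat val_scale). Qed.

Lemma natural_map_val_scale a x :
  natural_map_val (a *: x) = base a *: natural_map_val x.
Proof. exact: (tensor_map_scale base_rat val_scale). Qed.

Lemma natural_map_val0 : natural_map_val 0 = 0.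
Proof.
by apply: (addrI (natural_map_val 0)); rewrite -natural_map_valD !addr0.
Qed.

Fact natural_map_tau x : tau ME (natural_map_val x) = natural_map_val x.
Proof.
elim/tensor_ind: x => [|x y IHx IHy|f m].
- by rewrite natural_map_val0 raddf0.
- by rewrite natural_map_valD tauD IHx IHy.
- rewrite natural_map_val_tens base_change_tens sigma_laurent_base.
  by rewrite tau_inv_valP.
Qed.

Definition natural_map_tau_inv (x : tensor_tau_inv) : laurent_tau_inv :=
  to_tau_inv _ (natural_map_tau x).

Fact natural_map_gal x : natural_map_tau_inv x \in fixed_pred gal_inv.
Proof.
apply: mem_fixed => g; apply: tau_inv_val_inj; rewrite !to_tau_invK.
elim/tensor_ind: x => [|x y IHx IHy|f m].
- by rewrite natural_map_val0 gal_act0.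
- by rewrite natural_map_valD gal_actD IHx IHy.
- rewrite natural_map_val_tens gal_act_tens.
  by congr tens; apply: laurentP => i /=; rewrite gal_fix.
Qed.

Definition natural_map_fun (x : tensor_tau_inv) : laurent_gal_inv :=
  Fixed (natural_map_gal x).

Fact natural_map_linear : linear natural_map_fun.
Proof.
move=> a x y; apply: val_inj; apply: tau_inv_val_inj => /=.
pose z : ME := base a *: natural_map_val x + natural_map_val y.
have z_eq : natural_map_val (a *: x + y) = z.
  by rewrite natural_map_valD natural_map_val_scale.
exact: z_eq.
Qed.
HB.instance Definition _ :=
  GRing.isLinear.Build (laurent k) tensor_tau_inv laurent_gal_inv *:%R
    natural_map_fun natural_map_linear.

Definition natural_map : {linear tensor_tau_inv -> laurent_gal_inv} :=
  natural_map_fun.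

Lemma natural_map_tens f m :
  tau_inv_val (fixed_val (natural_map (tens _ f m))) =
  tens (rat_to_laurent j) (lmap (j \o iota) f) (tau_inv_val m).
Proof. exact: natural_map_val_tens. Qed.

End NaturalMap.

(* Main.v *)
(* Let s = 1/t. Purity of weight 0 gives a basis of M in which the invariants with
   coordinates in L((s)), which by Galois descent are the right-hand side, are the
   solutions x of d sigma(x) = P x, where d and P have polynomial coefficients in s
   and d(0) = 1. The point is to find h in L[s] such that h x has finitely many
   distinct coefficients: then x is a k((s))-combination of vectors of M, and by
   Artin's independence argument these vectors can be taken tau-invariant.

   The field L is reached from k by simple extensions, and an algebraic step is
   an easy restriction of scalars. For L = F(u) one shows that, at each place v of
   F(u)/F, some multiple h x has v-bounded coefficients. The coefficients of x grow
   at most geometrically at v. From d_m sigma^m(x) = P_m x, where deg d_m is linear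
   in m while the coefficients of sigma^m(x) have valuations divisible by q^m, a
   combinatorial argument on record lows of the valuations shows that the poles of
   x which come from d_m cancel for large m. Hence h x has coefficients in
   (1/g) F[u] of bounded degree, and its coordinates satisfy a system of the same
   kind over F. *)

From HB Require Import structures.
Require Import Defs.
From mathcomp Require Import all_boot all_order all_algebra all_field.
From mathcomp Require Import fraction.
From mathcomp Require Import boolp classical_sets.
From mathcomp Require Import zify ring.

Set Implicit Arguments.
Unset Strict Implicit.
Unset Printing Implicit Defensive.

Import Order.TTheory GRing.Theory Num.Theory.
Local Open Scope ring_scope.

(** The multiplier [h] cannot be avoided: x = 1/(1 - u s) satisfies (1 - u^q s) sigma(x) = (1 - u s)
    x, and its coefficients u^n are infinitely many, with unbounded poles at the infinite place of
    F(u); multiplying by 1 - u s leaves 1. What is available is that the left side of d sigma(x) = P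
    x carries q-th powers: comparing coefficients sets q v(x_n) against v(x_n), and this limits
    every pole except those fed by the terms d_j x_(n-j)^q with j > 0. These terms are q-th powers
    as well, so a pole may grow by a bounded amount per index, and removing this linear growth is
    the real difficulty.

    Where d and P are integral, x is integral without any multiplier, so only finitely many places
    need one. In coordinates over F, x is expanded in vectors e_l and hence sigma(x) in their powers
    e_l^q; the functionals that extract coordinates are therefore dual to the e_l^q, and both
    extension steps are arranged to provide them. *)

(** * Polynomials in s = 1/t acting on Laurent series *)

Section SPoly.
Variable K : fieldType.
Implicit Types (p : {poly K}) (x y : laurent K).

(* [laurent_s] is 1/t, and [spoly p] is p(1/t). *)
Definition laurent_s : laurent K := lmono 1 1.

Definition spoly p : laurent K := (map_poly (@lconst K) p).[laurent_s].
HB.instance Definition _ :=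
  GRing.RMorphism.copy spoly (horner_eval laurent_s \o map_poly (@lconst K)).

Lemma laurent_sX n : laurent_s ^+ n = lmono 1 n%:Z.
Proof.
elim: n => [|n IHn]; first by rewrite expr0.
rewrite exprS IHn; apply: laurentP => i.
rewrite (lcoef_monoM 1 1) /= mul1r.
by have -> : (i - 1 == n%:Z) = (i == n.+1%:Z) by apply/eqP/eqP; lia.
Qed.

Lemma lcoef_lconstM c x n : lcoef (lconst c * x) n = c * lcoef x n.
Proof. by rewrite (lcoef_monoM c 0) subr0. Qed.

Lemma lcoef_sXM m x n : lcoef (laurent_s ^+ m * x) n = lcoef x (n - m%:Z).
Proof. by rewrite laurent_sX (lcoef_monoM 1 m%:Z) mul1r. Qed.

Lemma spolyE p : spoly p = \sum_(j < size p) lconst p`_j * laurent_s ^+ j.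
Proof.
rewrite /spoly horner_coef size_map_poly.
by apply: eq_bigr => j _; rewrite coef_map.
Qed.

Lemma lcoef_spolyM p x n :
  lcoef (spoly p * x) n = \sum_(j < size p) p`_j * lcoef x (n - j%:Z).
Proof.
rewrite spolyE mulr_suml lcoef_sum; apply: eq_bigr => j _.
by rewrite -mulrA lcoef_lconstM lcoef_sXM.
Qed.

Lemma spolyC c : spoly c%:P = lconst c.
Proof. by rewrite /spoly map_polyC hornerC. Qed.

Lemma spolyX : spoly 'X = laurent_s.
Proof. by rewrite /spoly map_polyX hornerX. Qed.

Lemma lcoef_spoly p (n : nat) : lcoef (spoly p) n = p`_n.
Proof.
rewrite -[spoly p]mulr1 lcoef_spolyM.
have [np|np] := ltnP n (size p).
  rewrite (bigD1 (Ordinal np))//= subrr mulr1 big1 ?addr0// => -[i /= ip] /eqP.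
  move=> /= nein; case: eqP => [e|]; last by rewrite mulr0.
  by case: nein; apply: val_inj => /=; lia.
rewrite nth_default// big1// => -[i /= ip] _; case: eqP => [e|_]; first by
  move: (leq_trans ip np); lia.
by rewrite mulr0.
Qed.

Lemma spoly_vanish p : vanish 0 (lcoef (spoly p)).
Proof.
move=> i i0; rewrite -[spoly p]mulr1 lcoef_spolyM big1// => -[k /= kp] _.
by case: eqP => [e|_]; [exfalso; lia|rewrite mulr0].
Qed.

Lemma spoly_inj : injective spoly.
Proof. by move=> p q pq; apply/polyP => i; rewrite -!lcoef_spoly pq. Qed.

End SPoly.

Lemma lmap_spoly (K K' : fieldType) (f : {rmorphism K -> K'}) (p : {poly K}) :
  lmap f (spoly p) = spoly (map_poly f p).
Proof.
have lmap_mono c n : lmap f (lmono c n) = lmono (f c) n.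
  by apply: laurentP => i /=; case: eqP; rewrite ?rmorph0.
rewrite /spoly -horner_map /= /laurent_s lmap_mono rmorph1.
congr _.[_]; rewrite -!map_poly_comp; apply: eq_map_poly => c /=.
exact: lmap_mono.
Qed.

Lemma lmapM (K K' : fieldType) (f : {rmorphism K -> K'}) x y :
  lmap f (x * y) = lmap f x * lmap f y.
Proof. exact: rmorphM. Qed.

Lemma lmap_sum (K K' : fieldType) (f : {rmorphism K -> K'}) I (r : seq I) F :
  lmap f (\sum_(i <- r) F i) = \sum_(i <- r) lmap f (F i).
Proof. exact: rmorph_sum. Qed.

(** * Valuations and the growth of coefficients *)

Section Valuation.
Variables (L : fieldType) (v : L -> int).
Hypothesis vM : forall x y : L, x != 0 -> y != 0 -> v (x * y) = v x + v y.
Hypothesis vD : forall (x y : L) (n : int), x != 0 -> y != 0 -> x + y != 0 ->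
  n <= v x -> n <= v y -> n <= v (x + y).

(* Valuations take an unspecified value at 0, hence the guard. *)
Definition vge (n : int) x := (x != 0) ==> (n <= v x).

Lemma vgeP n x : reflect (x != 0 -> n <= v x) (vge n x).
Proof. exact: implyP. Qed.

Lemma vge0 n : vge n 0. Proof. by rewrite /vge eqxx. Qed.

Lemma vge_le n m x : m <= n -> vge n x -> vge m x.
Proof. by move=> mn /vgeP nx; apply/vgeP => /nx; lia. Qed.

Lemma vgeD n x y : vge n x -> vge n y -> vge n (x + y).
Proof.
move=> /vgeP nx /vgeP ny; apply/vgeP => xy0.
have [x0|x0] := eqVneq x 0; first by move: xy0; rewrite x0 add0r.
have [y0|y0] := eqVneq y 0; first by move: xy0; rewrite y0 addr0; apply: nx.
by apply: vD => //; [apply: nx | apply: ny].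
Qed.

Lemma vge_sum I (r : seq I) (P : pred I) (F : I -> L) n :
  (forall i, P i -> vge n (F i)) -> vge n (\sum_(i <- r | P i) F i).
Proof.
by move=> nF; apply: (big_ind (fun x => vge n x)) => //; [exact: vge0 | move=> *; exact: vgeD].
Qed.

Lemma vgeM m n x y : vge m x -> vge n y -> vge (m + n) (x * y).
Proof.
move=> /vgeP mx /vgeP ny; apply/vgeP; rewrite mulf_eq0 negb_or => /andP[x0 y0].
by rewrite vM// lerD// ?mx ?ny.
Qed.

Lemma v1 : v 1 = 0.
Proof. by apply: (addrI (v 1)); rewrite addr0 -vM ?oner_neq0// mulr1. Qed.

Lemma vN1 : v (-1) = 0.
Proof.
have n1 : (-1 : L) != 0 by rewrite oppr_eq0 oner_eq0.
by have := vM n1 n1; rewrite mulrNN mulr1 v1; lia.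
Qed.

Lemma vgeN n x : vge n (- x) = vge n x.
Proof.
have [->|x0] := eqVneq x 0; first by rewrite oppr0.
by rewrite /vge oppr_eq0 -mulN1r vM ?oppr_eq0 ?oner_eq0// vN1 add0r.
Qed.

Lemma vgeB n x y : vge n x -> vge n y -> vge n (x - y).
Proof. by move=> nx ny; apply: vgeD; rewrite ?vgeN. Qed.

Lemma vX x n : x != 0 -> v (x ^+ n) = n%:Z * v x.
Proof.
move=> x0; elim: n => [|n IHn]; first by rewrite expr0 v1 mul0r.
by rewrite exprS vM ?expf_neq0// IHn; lia.
Qed.

Lemma v_dominant x y : x != 0 -> vge (v x + 1) y -> (x + y != 0) /\ v (x + y) = v x.
Proof.
move=> x0 /vgeP vy; have [->|y0] := eqVneq y 0; first by rewrite addr0.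
have {}vy := vy y0.
have xy0 : x + y != 0.
  apply: contraL vy => /eqP /(canRL (addrK _)); rewrite sub0r => xy.
  have : v y = v x by rewrite xy -[- y]mulN1r vM ?oppr_eq0 ?oner_eq0// vN1 add0r.
  by lia.
split=> //; apply/eqP; rewrite eq_le; apply/andP; split; last first.
  by apply: vD => //; lia.
rewrite leNgt; apply/negP => lt.
have : vge (v x + 1) (x + y - y).
  by apply: vgeB; apply/vgeP => _ //; lia.
by rewrite addrK /vge x0 /=; lia.
Qed.

Lemma vge_poly (p : {poly L}) : exists b : nat, forall i, vge (- b%:Z) p`_i.
Proof.
have [B hB] : exists B : nat, forall i : 'I_(size p), vge (- B%:Z) p`_i.
  exists (\max_(i < size p) `|v p`_i|)%N => i.
  have := @leq_bigmax 'I_(size p) (fun i => `|v p`_i|%N) i => /= le.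
  by apply/vgeP => _; move: le; set M := \max_(_ < _) _; lia.
exists B => i; have [ip|ip] := ltnP i (size p); first exact: (hB (Ordinal ip)).
by rewrite nth_default// vge0.
Qed.

Lemma vge_polys (I : finType) (P : I -> {poly L}) :
  exists b : nat, forall i k, vge (- b%:Z) (P i)`_k.
Proof.
have /choice[b hb] := fun i => vge_poly (P i).
exists (\max_i b i)%N => i k; apply: vge_le (hb i k).
have := @leq_bigmax I b i; move: (\max_i _)%N => M; lia.
Qed.

Section Growth.
Variable rho : nat.

(** The slope [rho] is what matters. Multiplication by a polynomial in s changes only the intercept
    [c], because it brings in coefficients of smaller index, whose bounds are better. *)
Definition growth (x : laurent L) :=
  exists c : int, forall n : int, vge (- c - rho%:Z * n) (lcoef x n).

Lemma growth0 : growth 0.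
Proof. by exists 0 => n; rewrite vge0. Qed.

Lemma growthD x y : growth x -> growth y -> growth (x + y).
Proof.
move=> [c cx] [d dy]; exists (Num.max c d) => n /=.
by apply: vgeD; [apply: vge_le (cx n) | apply: vge_le (dy n)]; lia.
Qed.

Lemma growth_sum I (r : seq I) (F : I -> laurent L) :
  (forall i, growth (F i)) -> growth (\sum_(i <- r) F i).
Proof.
move=> gF; apply: (big_ind growth) => //; [exact: growth0|].
by move=> *; exact: growthD.
Qed.

Lemma growthM p x : growth x -> growth (spoly p * x).
Proof.
move=> [c cx]; have [b bp] := vge_poly p; exists (b%:Z + c) => n.
rewrite lcoef_spolyM; apply: vge_sum => j _.
apply: vge_le (vgeM (bp j) (cx (n - j%:Z))); nia.
Qed.

Lemma growth_fin (I : finType) (F : I -> laurent L) :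
  (forall i, growth (F i)) ->
  exists c : nat, forall i (n : int), vge (- c%:Z - rho%:Z * n) (lcoef (F i) n).
Proof.
move=> /choice[c cF]; exists (\max_i `|c i|%N)%N => i n.
apply: vge_le (cF i n).
have := @leq_bigmax I (fun i => `|c i|%N) i; move: (\max_i _)%N => M; lia.
Qed.

End Growth.
End Valuation.

Lemma ex_least_int (P : int -> Prop) (a : int) :
  (forall i, P i -> a <= i) -> (exists i, P i) ->
  exists i, P i /\ forall j, P j -> i <= j.
Proof.
move=> aP [i Pi].
have ex : exists n : nat, `[< P (a + n%:Z) >].
  exists `|i - a|%N; apply/asboolP; have -> // : a + `|i - a|%:Z = i.
  by have := aP _ Pi; lia.
case: (ex_minnP ex) => n /asboolP Pn minn; exists (a + n%:Z); split=> // j Pj.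
have aj := aP _ Pj.
have : (n <= `|j - a|)%N by apply: minn; apply/asboolP; have -> : a + `|j - a|%:Z = j by lia.
by lia.
Qed.

Lemma ex_min_fin (I : finType) (P : pred I) (f : I -> int) (i0 : I) : P i0 ->
  exists i, P i /\ forall j, P j -> f i <= f j.
Proof. by move=> Pi0; case: (@arg_minP _ _ I i0 P f Pi0) => i Pi min; exists i. Qed.

Lemma laurents_vanish (K : fieldType) (I : finType) (x : I -> laurent K) :
  exists a : int, forall i, vanish a (lcoef (x i)).
Proof.
have /choice[b hb] := fun i => lcoefP (x i).
exists (- (\max_i `|b i|)%N%:Z) => i n na; apply: hb.
have := @leq_bigmax I (fun i => `|b i|%N) i; move: (\max_i _)%N na => M; lia.
Qed.

Lemma linear_lt_exp (A q : nat) : (1 < q)%N ->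
  exists e, forall m, (e <= m)%N -> (A * m.+1 < q ^ m)%N.
Proof.
(* At the threshold m = 4 A the power q^m is the square of q^(2 A), which exceeds 2 A; this already
   beats A (4 A + 1). *)
move=> q1; exists (A.*2).*2 => m; elim: m => [|m IHm].
  by rewrite leqn0 => /eqP; case: A => //=; rewrite mul0n expn0.
rewrite leq_eqVlt => /predU1P[em|/IHm lt]; last first.
  rewrite expnS; apply: (@leq_trans (q * (A * m.+1).+1)); last by rewrite leq_mul2l lt orbT.
  by nia.
rewrite -em -[in (q ^ _)%N]addnn expnD.
have : (A.*2 < q ^ A.*2)%N by apply: ltn_expl.
by move: (q ^ _)%N => B; rewrite -!muln2; nia.
Qed.

(** * Record lows of the valuations *)

Section Local.
Variables (L : fieldType) (v : L -> int).
Hypothesis vM : forall x y : L, x != 0 -> y != 0 -> v (x * y) = v x + v y.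
Hypothesis vD : forall (x y : L) (n : int), x != 0 -> y != 0 -> x + y != 0 ->
  n <= v x -> n <= v y -> n <= v (x + y).

Local Notation vge := (vge v).
Local Notation growth := (growth v).

(** A vertex of the Newton polygon of [g] for the slope [rho]: the smallest of the indices that
    minimise v(g_k) + rho k, whence the strict inequality on its left. *)
Lemma leading_index (g : {poly L}) (rho : nat) : g != 0 ->
  exists j : nat, [/\ g`_j != 0,
    forall k, (k < j)%N -> g`_k != 0 -> v g`_j + (rho * j)%:Z < v g`_k + (rho * k)%:Z
    & forall k, g`_k != 0 -> v g`_j + (rho * j)%:Z <= v g`_k + (rho * k)%:Z].
Proof.
move=> g0; have [b bg] := vge_poly v g.
pose w k := v g`_k + (rho * k)%:Z.
have [] := @ex_least_int (fun a => exists k, g`_k != 0 /\ a = w k) (- b%:Z).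
- by move=> _ [k [gk ->]]; have /implyP/(_ gk) := bg k; rewrite /w; lia.
- by exists (w (size g).-1), (size g).-1; rewrite -lead_coefE lead_coef_eq0.
move=> a [[k [gk aw]] amin].
have ex : exists j, (g`_j != 0) && (w j == a) by exists k; rewrite gk aw eqxx.
case: (ex_minnP ex) => j /andP[gj /eqP wj] jmin; exists j.
have le k' : g`_k' != 0 -> w j <= w k' by move=> g'; rewrite wj; apply: amin; exists k'.
split=> // k' kj gk'; rewrite lt_neqAle; apply/andP; split; last exact: le.
apply/eqP => e; have wk : w k' = a by rewrite -wj; apply: esym e.
by have := jmin k'; rewrite gk' wk eqxx leqNgt kj => /(_ isT).
Qed.

(** As in Gauss's lemma, g_j y_n with j the leading index of [g] is the unique dominant term of the
    coefficient n + j. For k < j strictness comes from the choice of j, for k > j from the record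
    low at n. The shift [gamma] depends on [g] and [rho] only. *)
Lemma dominant_coef (g : {poly L}) (rho : nat) : g != 0 ->
  exists gamma : int, forall (y : laurent L) (n : int), lcoef y n != 0 ->
  (forall m : int, m < n -> lcoef y m != 0 ->
     v (lcoef y n) + rho%:Z * n < v (lcoef y m) + rho%:Z * m) ->
  (forall m : int, m < n + (size g)%:Z -> lcoef y m != 0 ->
     v (lcoef y n) + rho%:Z * n <= v (lcoef y m) + rho%:Z * m) ->
  exists m : int, [/\ n <= m, m < n + (size g)%:Z, lcoef (spoly g * y) m != 0 &
    v (lcoef (spoly g * y) m) + rho%:Z * m = gamma + v (lcoef y n) + rho%:Z * n].
Proof.
move=> /(leading_index rho)[j [gj jlt jle]].
have js : (j < size g)%N by rewrite ltnNge; apply: contra gj => /(nth_default 0)->.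
exists (v g`_j + (rho * j)%:Z) => y n yn lt le.
exists (n + j%:Z); rewrite lcoef_spolyM (bigD1 (Ordinal js))//= addrK.
set r := \sum_(i < _ | _) _.
have gy0 : g`_j * lcoef y n != 0 by rewrite mulf_neq0.
have [|-> ->] := @v_dominant _ v vM vD _ r gy0.
  apply: vge_sum => // -[k /= ks]; rewrite -val_eqE /= => kj; apply/implyP.
  rewrite mulf_eq0 negb_or => /andP[gk yk]; rewrite !vM//.
  have := jle k gk; have kj' : (k < j)%N \/ (j < k)%N by apply/orP; rewrite -neq_ltn.
  case: kj' => kj'.
    have /le/(_ yk) : n + j%:Z - k%:Z < n + (size g)%:Z by lia.
    have := jlt k kj' gk; rewrite mulrBr mulrDr !PoszM.
    by move: (v _) (v _) (v _) (v _) (rho%:Z * n) (rho%:Z * j%:Z) (rho%:Z * k%:Z); lia.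
  have /lt/(_ yk) : n + j%:Z - k%:Z < n by lia.
  rewrite mulrBr mulrDr !PoszM.
  by move: (v _) (v _) (v _) (v _) (rho%:Z * n) (rho%:Z * j%:Z) (rho%:Z * k%:Z); lia.
by rewrite vM// ltrD2l ltz_nat js lerDl; split=> //; rewrite mulrDr PoszM; ring.
Qed.

Section Window.
Variables (I : finType) (Y : I -> laurent L) (rho N Q R : nat) (C : int).
Let w i n := v (lcoef (Y i) n) + rho%:Z * n.
Let nz i n := lcoef (Y i) n != 0.

(** The earliest index with a weight below [w0] exists because the series vanish below a common
    index; at this index the series of least weight is chosen. *)
Lemma first_below (w0 : int) : (exists i n, nz i n /\ w i n < w0) ->
  exists i n, [/\ nz i n, w i n < w0,
    forall i' n', nz i' n' -> n' < n -> w0 <= w i' n'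
    & forall i', nz i' n -> w i n <= w i' n].
Proof.
move=> [i0 [n0 low]]; have [a va] := laurents_vanish Y.
have [] := @ex_least_int (fun n => exists i, nz i n /\ w i n < w0) a.
- move=> n [i [ni _]]; rewrite leNgt; apply/negP => na.
  by move: ni; rewrite /nz va// eqxx.
- by exists n0, i0.
move=> n [[i1 [nz1 low1]] nmin].
have [i [/andP[nzi lowi] imin]] :=
  @ex_min_fin I (fun i => nz i n && (w i n < w0)) (fun i => w i n) i1 (introT andP (conj nz1 low1)).
exists i, n; split=> //.
  move=> i' n' nz' n'n; rewrite leNgt; apply/negP => low'.
  by have := nmin n' (ex_intro _ i' (conj nz' low')); lia.
move=> i' nz'; have [w'|w'] := ltP (w i' n) w0; last by lia.
by apply: imin; rewrite nz' w'.
Qed.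

Hypothesis RN : (R * N < Q)%N.
Hypothesis dvdY : forall i n, nz i n -> (Q %| v (lcoef (Y i) n))%Z.
Hypothesis growthY : forall i, growth R (Y i).
Hypothesis window : forall i n, nz i n -> w i n < - C ->
  (forall i' (n' : int), n' < n -> nz i' n' -> w i n < w i' n') ->
  (forall i' (n' : int), n' < n + N%:Z -> nz i' n' -> w i n <= w i' n') -> False.

(* A coefficient of weight below [- C] starts an infinite chain of record lows
   at distance less than [N] from one another; along it [v] drops by at least
   [Q] at each step, faster than the growth [R] allows. *)
Lemma window_bound i n : nz i n -> - C <= w i n.
Proof.
move=> nzi; rewrite leNgt; apply/negP => low.
pose S n a := exists i, [/\ nz i n, v (lcoef (Y i) n) = a, w i n < - C,
  forall i' (n' : int), n' < n -> nz i' n' -> w i n < w i' n'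
  & forall i', nz i' n -> w i n <= w i' n].
have [n0 [a0 S0]] : exists n a, S n a.
  have [|i1 [n1 [nz1 low1 lt1 le1]]] := @first_below (- C); first by exists i, n.
  exists n1, (v (lcoef (Y i1) n1)), i1; split=> // i' n' n'n nz'.
  by have := lt1 _ _ nz' n'n; lia.
have Sstep n1 a1 : S n1 a1 -> exists n2 a2,
    [/\ S n2 a2, n2 <= n1 + N%:Z & a2 <= a1 - Q%:Z].
  move=> [i1 [nz1 v1 low1 lt1 le1]].
  have [i' [n' [nz' n'n w']]] : exists i' n', [/\ nz i' n', n' < n1 + N%:Z & w i' n' < w i1 n1].
    apply: contrapT => nex; apply: (window nz1 low1 lt1) => i' n' n'n nz'.
    rewrite leNgt; apply/negP => w'; apply: nex; by exists i', n'.
  have [|i2 [n2 [nz2 low2 lt2 le2]]] := @first_below (w i1 n1); first by exists i', n'.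
  have n12 : n1 < n2.
    rewrite ltNge le_eqVlt; apply/negP => /predU1P[e|n21].
      by move: low2; rewrite ltNge e le1// -e.
    by have := lt1 _ _ n21 nz2; lia.
  exists n2, (v (lcoef (Y i2) n2)); split.
  - exists i2; split=> //; first by lia.
    by move=> i3 n3 n32 nz3; have := lt2 _ _ nz3 n32; lia.
  - rewrite leNgt; apply/negP => n2n.
    by have := lt2 _ _ nz' (lt_trans n'n n2n); lia.
  (* The weight drops while the index increases, so v itself drops, and being a multiple of Q at
     both ends it drops by at least Q. *)
  - have := dvdY nz1; have := dvdY nz2; rewrite v1.
    move=> /dvdzP[k2 e2] /dvdzP[k1 e1]; move: low2; rewrite /w v1 e2 e1 => low2.
    have : k2 < k1 by nia.
    by nia.
have Siter k : exists n a, [/\ S n a, n <= n0 + (k * N)%:Z & a <= a0 - (k * Q)%:Z].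
  elim: k => [|k [n1 [a1 [S1 n1n a1a]]]]; first by exists n0, a0; split=> //; lia.
  have [n2 [a2 [S2 n21 a21]]] := Sstep _ _ S1.
  by exists n2, a2; split=> //; rewrite !mulSn; lia.
have [c gc] := growth_fin growthY.
(* After k steps the growth bound gives v >= - c - R (n0 + k N) while v <= a0 - k Q. As Q >= R N + 1
   this forces k <= B, so [|B| + 1] steps are too many. *)
pose B : int := c%:Z + a0 + R%:Z * n0.
have [n1 [a1 [[i1 [nz1 v1 _ _ _]] n1n a1a]]] := Siter `|B|.+1.
have /implyP/(_ nz1) := gc i1 n1; rewrite v1 => g1.
have : R%:Z * n1 <= R%:Z * (n0 + (`|B|.+1 * N)%N%:Z) by apply: ler_wpM2l.
have : (`|B|.+1 * (R * N).+1 <= `|B|.+1 * Q)%N by rewrite leq_mul2l RN orbT.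
have : B < `|B|.+1%:Z by lia.
move: `|B|.+1 a1a => k a1a Bk; rewrite -lez_nat !PoszM mulrDr => kQ Rn1.
have e : (k%:Z * (R * N).+1%:Z = R%:Z * (k%:Z * N%:Z) + k%:Z) by rewrite -addn1 PoszD PoszM; ring.
move: kQ Rn1 a1a g1 Bk; rewrite e /B PoszM.
move: (R%:Z * (k%:Z * N%:Z)) (k%:Z * Q%:Z) (R%:Z * n0) (R%:Z * n1); lia.
Qed.

End Window.

(* When the valuations of the coefficients are multiples of [Q], each step of a
   chain of record lows costs at least [Q] within distance [size g], so a pole
   coming from [g] would be incompatible with the a priori growth [R]. This is
   applied to Q-th powers. *)
Lemma absorb_denominator (y : laurent L) (g : {poly L}) (rho Q R : nat) :
  g != 0 -> (R * size g < Q)%N ->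
  (forall n, lcoef y n != 0 -> (Q %| v (lcoef y n))%Z) ->
  growth R y -> growth rho (spoly g * y) -> growth rho y.
Proof.
move=> g0 RN dy gy [c gz]; have [gamma dom] := dominant_coef rho g0.
(* A record low of [y] of weight below - C would give [g * y] a coefficient of weight below gamma -
   C <= - c. *)
pose C := `|c|%N%:Z + `|gamma|%N%:Z.
exists C => n; apply/implyP => yn.
have := @window_bound unit (fun=> y) rho (size g) Q R C RN.
have /[swap]/[apply] : forall (i : unit) n, lcoef y n != 0 -> (Q %| v (lcoef y n))%Z by [].
have /[swap]/[apply] : unit -> growth R y by [].
move/(_ _ tt n yn) => H; suff : - C <= v (lcoef y n) + rho%:Z * n by lia.
apply: H => _ m ym low lt le.
have [||m' [_ _ z0 ez]] := dom y m ym.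
- by move=> m' m'm ym'; apply: (lt tt).
- by move=> m' m'm ym'; apply: (le tt).
by have /implyP/(_ z0) := gz m'; move: low; rewrite /C; lia.
Qed.

End Local.

(** * Iterates of Frobenius *)

Section Pchar.
Variables (R : comNzRingType) (p q : nat).
Hypothesis pR : p \in [pchar R].
Hypothesis pq : p.-nat q.

Lemma exprDn_pnat (x y : R) : (x + y) ^+ q = x ^+ q + y ^+ q.
Proof. by apply: exprDn_pchar; rewrite (eq_pnat _ (pcharf_eq pR)). Qed.

Lemma expr_sum_pnat I (r : seq I) (F : I -> R) :
  (0 < q)%N -> (\sum_(i <- r) F i) ^+ q = \sum_(i <- r) F i ^+ q.
Proof.
move=> q0; elim: r => [|i r IHr]; first by rewrite !big_nil expr0n gtn_eqF.
by rewrite !big_cons exprDn_pnat IHr.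
Qed.

End Pchar.

Section FrobeniusIterates.
Variables (L : fieldType) (q : nat) (Fq : {rmorphism L -> L}).
Hypothesis FqE : forall z, Fq z = z ^+ q.

Fixpoint frit m : {rmorphism L -> L} := if m is m'.+1 then Fq \o frit m' else idfun.

Lemma fritE m z : frit m z = z ^+ (q ^ m).
Proof.
by elim: m => [|m IHm] /=; rewrite ?expr1// FqE IHm -exprM expnSr.
Qed.

Lemma lmap_fritS m x : lmap (frit m) (lmap Fq x) = lmap (frit m.+1) x.
Proof.
apply: laurentP => i; rewrite -[LHS]/(frit m (Fq (lcoef x i))) -[RHS]/(Fq (frit m (lcoef x i))).
by rewrite !fritE !FqE -!exprM mulnC.
Qed.

(** The q^m-th power is additive, so it raises coefficients and s separately; sigma^m does the
    former and the substitution of s^(q^m) the latter. This exhibits a power of a denominator as a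
    sigma^m-image. *)
Lemma lmap_frit_comp_polyX (p m : nat) (d : {poly L}) :
  p \in [pchar L] -> p.-nat q -> (0 < q)%N ->
  lmap (frit m) (spoly (d \Po 'X^(q ^ m))) = spoly d ^+ (q ^ m).
Proof.
move=> pL pq q0.
have pK : p \in [pchar (laurent L)] by rewrite (fmorph_pchar (@lconst L)).
have pqm : p.-nat (q ^ m)%N by rewrite pnatX pq.
have qm0 : (0 < q ^ m)%N by rewrite expn_gt0 q0.
rewrite comp_polyE 2!rmorph_sum spolyE (expr_sum_pnat pK pqm)//.
apply: eq_bigr => i _; rewrite [LHS](lmap_spoly (frit m) (d`_i *: 'X^(q ^ m) ^+ i)).
rewrite -mul_polyC rmorphM rmorphXn /=.
rewrite map_polyC map_polyXn rmorphM !rmorphXn /= spolyC spolyX fritE exprMn.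
by rewrite rmorphXn -!exprM mulnC.
Qed.

Section Iterate.
Variables (I : finType) (d : {poly L}) (P : I -> I -> {poly L}) (x : I -> laurent L).
Hypothesis d0 : d`_0 = 1.
Hypothesis eqx : forall i,
  spoly d * lmap Fq (x i) = \sum_j spoly (P i j) * x j.

Lemma iterate_system m : exists (dm : {poly L}) (Pm : I -> I -> {poly L}),
  [/\ dm`_0 = 1, (size dm <= (m * (size d).-1).+1)%N &
  forall i, spoly dm * lmap (frit m) (x i) = \sum_j spoly (Pm i j) * x j].
Proof.
elim: m => [|m [dm [Pm [dm0 sm eqm]]]].
  exists 1, (fun i j => (i == j)%:R); rewrite coefC size_poly1; split=> // i.
  rewrite rmorph1 mul1r (bigD1 i)//= eqxx rmorph1 mul1r big1 ?addr0; last first.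
    by move=> j /negPf; rewrite eq_sym => ->; rewrite rmorph0 mul0r.
  exact: laurentP.
exists (dm * map_poly (frit m) d).
exists (fun i j => \sum_l map_poly (frit m) (P i l) * Pm l j); split.
- by rewrite coefM big_ord1 coef_map /= dm0 d0 rmorph1 mulr1.
- apply: leq_trans (size_polyMleq _ _) _; rewrite size_map_poly.
  have : (0 < size d)%N.
    by rewrite lt0n size_poly_eq0; apply: contra_eq_neq d0 => ->; rewrite coef0 eq_sym oner_neq0.
  by move: sm; case: (size d) => //= s; lia.
- move=> i.
  have e : spoly (map_poly (frit m) d) * lmap (frit m.+1) (x i) =
      \sum_l spoly (map_poly (frit m) (P i l)) * lmap (frit m) (x l).
    rewrite -lmap_fritS -lmap_spoly -lmapM eqx lmap_sum.
    by apply: eq_bigr => l _; rewrite lmapM lmap_spoly.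
  rewrite rmorphM -mulrA e mulr_sumr.
  under [RHS]eq_bigr do rewrite rmorph_sum mulr_suml.
  rewrite exchange_big /=; apply: eq_bigr => l _.
  rewrite mulrCA eqm mulr_sumr.
  by apply: eq_bigr => j _; rewrite rmorphM mulrA.
Qed.

End Iterate.
End FrobeniusIterates.

(** * Boundedness at one place *)

Section LocalBound.
Variables (L : fieldType) (v : L -> int).
Hypothesis vM : forall x y : L, x != 0 -> y != 0 -> v (x * y) = v x + v y.
Hypothesis vD : forall (x y : L) (n : int), x != 0 -> y != 0 -> x + y != 0 ->
  n <= v x -> n <= v y -> n <= v (x + y).
Local Notation vge := (vge v).
Local Notation growth := (growth v).
Variables (q : nat) (Fq : {rmorphism L -> L}).
Hypothesis q1 : (1 < q)%N.
Hypothesis FqE : forall z, Fq z = z ^+ q.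
Variables (I : finType) (d : {poly L}) (P : I -> I -> {poly L}) (x : I -> laurent L).
Hypothesis d0 : d`_0 = 1.
Hypothesis eqx : forall i,
  spoly d * lmap Fq (x i) = \sum_j spoly (P i j) * x j.

Let size_d : (0 < size d)%N.
Proof.
by rewrite lt0n size_poly_eq0; apply: contra_eq_neq d0 => ->; rewrite coef0 eq_sym oner_neq0.
Qed.

(** The constant term of [d] is 1, so the equation expresses x_m^q through earlier q-th powers and
    through coefficients of index at most m without the power. A valuation a < - b (m + 1) is
    impossible: q a would be smaller than each term allows. For b = 0 this says that integrality of
    the system passes to x. *)
Lemma initial_growth (b : nat) (n0 : int) :
  (forall k, vge (- b%:Z) d`_k) -> (forall i j k, vge (- b%:Z) (P i j)`_k) ->
  (forall i, vanish n0 (lcoef (x i))) ->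
  forall i (m : nat), vge (- (b * m.+1)%N%:Z) (lcoef (x i) (n0 + m%:Z)).
Proof.
move=> db Pb xn0 i m; elim/ltn_ind: m i => m IHm i.
have prev (r : nat) j : (0 < r)%N -> vge (- (b * m)%N%:Z) (lcoef (x j) (n0 + m%:Z - r%:Z)).
  move=> r0; have [rm|mr] := leqP r m; last by rewrite xn0 ?vge0//; lia.
  have -> : n0 + m%:Z - r%:Z = n0 + (m - r)%N%:Z by lia.
  have lt : (m - r < m)%N by lia.
  by apply: vge_le (IHm _ lt j); nia.
apply/implyP; rewrite leNgt => xi0; apply/negP => low.
(* The right side involves all the x_j at the current index, so the contradiction has to be drawn
   from the lowest of them. *)
pose low_at i := (lcoef (x i) (n0 + m%:Z) != 0) &&
  (v (lcoef (x i) (n0 + m%:Z)) < - (b * m.+1)%N%:Z).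
have low_i : low_at i by rewrite /low_at xi0.
have [i1 [/andP[nz1 low1] min1]] := ex_min_fin (fun i => v (lcoef (x i) (n0 + m%:Z))) low_i.
set a := v _ in low1 min1.
have cur j : vge a (lcoef (x j) (n0 + m%:Z)).
  apply/implyP => xj0; rewrite /a; have [lj|] := boolP (low_at j); first exact: min1.
  by rewrite /low_at xj0 /= -leNgt; apply: le_trans; apply: ltW.
have /(congr1 (fun y => lcoef y (n0 + m%:Z))) := eqx i1.
rewrite lcoef_spolyM lcoef_sum (bigD1 (Ordinal size_d))//= d0 mul1r subr0 FqE.
set rest := \sum_(_ < _ | _) _; set rhs := \sum_(_ <- _) _ => e.
have vrest : vge (- b%:Z - q%:Z * (b * m)%N%:Z) rest.
  apply: vge_sum => // -[k /= ks]; rewrite -val_eqE /= => k0.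
  apply: vgeM => //; rewrite FqE; apply/implyP; rewrite expf_eq0 negb_and => /orP[|nz].
    by rewrite -leqNgt leqn0 => /eqP q0; move: q1; rewrite q0.
  rewrite (vX vM)//; have := prev k i1; rewrite lt0n k0 => /(_ isT) /implyP/(_ nz).
  by move: (v _) (b * m)%N => u c; nia.
have vrhs : vge (Num.min (- b%:Z + a) (- b%:Z - (b * m)%N%:Z)) rhs.
  apply: vge_sum => // j _; rewrite -[conv _ _ _]/(lcoef (spoly (P i1 j) * x j) _).
  rewrite lcoef_spolyM; apply: vge_sum => // -[[|k] /= ks] _.
    rewrite subr0; apply: vge_le (vgeM vM (Pb i1 j 0%N) (cur j)); lia.
  by apply: vge_le (vgeM vM (Pb i1 j k.+1) (prev k.+1 j isT)); lia.
have : vge (Num.min (- b%:Z - q%:Z * (b * m)%N%:Z) (Num.min (- b%:Z + a) (- b%:Z - (b * m)%N%:Z)))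
    (lcoef (x i1) (n0 + m%:Z) ^+ q).
  rewrite -[_ ^+ q](addrK rest) e.
  by apply: vgeB => //; [apply: vge_le vrhs | apply: vge_le vrest]; lia.
move=> /implyP; rewrite expf_eq0 (negPf nz1) andbF => /(_ isT); rewrite (vX vM)// -/a.
move: low1; rewrite mulnS !PoszD; move: (b * m)%N => B low1.
by rewrite !ge_min => /orP[|/orP[]]; nia.
Qed.

Lemma growth_lmap m rho y : growth rho y -> growth (q ^ m * rho) (lmap (frit Fq m) y).
Proof.
move=> [c gy]; exists ((q ^ m)%N%:Z * c) => n /=; rewrite (fritE FqE).
apply/implyP; rewrite expf_eq0 negb_and => /orP[|nz].
  by rewrite -leqNgt leqn0 expn_eq0 => /andP[/eqP q0]; move: q1; rewrite q0.
rewrite (vX vM)//; have /implyP/(_ nz) := gy n; rewrite PoszM -mulrA.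
move: (v _) (rho%:Z * n) (q ^ m)%N => u r Q; nia.
Qed.

Variable p : nat.
Hypothesis pL : p \in [pchar L].
Hypothesis pq : p.-nat q.

Let q0 : (0 < q)%N. Proof. exact: ltnW. Qed.

(* With [de * sigma^e x = Pe * x], the multiplier is h(s) = [de] with its
   coefficients kept and s replaced by s^(q^e), since sigma^e h = de^(q^e).
   Afterwards each application of [absorb_denominator] divides the growth of
   [h * x] by q: the degree of the denominator [dm] is linear in m, whereas the
   valuations of the coefficients of sigma^m(h * x) are multiples of q^m. *)
Lemma local_growth : exists (rho : nat) (h : {poly L}), h`_0 = 1 /\
  exists e, forall m, (e <= m)%N ->
    forall i, growth rho (lmap (frit Fq m) (spoly h * x i)).
Proof.
have [bd hbd] := vge_poly v d.
have [bP hbP] := vge_polys v (fun ij : I * I => P ij.1 ij.2).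
pose b := maxn bd bP.
have [n0 xn0] := laurents_vanish x.
have gx i : growth b (x i).
  exists (b%:Z * (1 - n0)) => n; have [nn0|] := boolP (n < n0); first by rewrite xn0 ?vge0.
  case/int_ge_nat => m ->.
  apply: vge_le (@initial_growth b n0 _ _ xn0 i m).
  - by rewrite -addn1 PoszM PoszD; lia.
  - by move=> k; apply: vge_le (hbd k); lia.
  - by move=> i' j k; apply: vge_le (hbP (i', j) k); lia.
have grhs (Q : I -> I -> {poly L}) i : growth b (\sum_j spoly (Q i j) * x j).
  by apply: growth_sum => // j; apply: growthM.
(* For m >= e, the slope q b reached after one more Frobenius, times the size of the denominator at
   level m + 1, stays below q^(m+1). *)
have [e he] := linear_lt_exp (q * b * size d) q1.
have [de [Pe [de0 _ eqe]]] := iterate_system FqE d0 eqx e.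
pose h := de \Po 'X^(q ^ e).
exists b, h; split.
  by rewrite -horner_coef0 horner_comp hornerXn expr0n gtn_eqF ?expn_gt0 ?q0// horner_coef0.
have base i : growth b (lmap (frit Fq e) (spoly h * x i)).
  (* One of the q^e factors [de] is spent on turning sigma^e(x) into [Pe * x], whose slope is b. *)
  have -> : lmap (frit Fq e) (spoly h * x i) =
      spoly (de ^+ (q ^ e).-1) * (\sum_j spoly (Pe i j) * x j).
    rewrite -eqe rmorphXn mulrA -exprSr prednK ?expn_gt0 ?q0//.
    rewrite -(lmap_frit_comp_polyX FqE e de pL pq q0).
    exact: lmapM.
  exact: growthM.
exists e => m /subnKC <-; elim: (m - e)%N => [|r IHr] i; first by rewrite addn0.
rewrite addnS; have em := leq_addr r e.
move: (e + r)%N em IHr => {}m em IHm.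
have [dm [Pm [dm0 sm eqm]]] := iterate_system FqE d0 eqx m.+1.
apply: (absorb_denominator vM vD (g := dm) (Q := q ^ m.+1) (R := q * b)).
- by apply: contra_eq_neq dm0 => ->; rewrite coef0 eq_sym oner_neq0.
- apply: leq_ltn_trans (_ : q * b * size d * m.+1 < _)%N.
    rewrite -[leqRHS]mulnA leq_mul2l; apply/orP; right; apply: leq_trans sm _.
    by move: size_d; case: (size d) => //= s _; nia.
  by rewrite expnS; have := he m em; nia.
- move=> n /=; rewrite FqE (fritE FqE) -exprM -expnSr => nz.
  rewrite (vX vM); first exact: dvdz_mulr.
  by apply: contraNneq nz => ->; rewrite expr0n gtn_eqF// expn_gt0 q0.
- have /(growth_lmap 1) := IHm i; rewrite expn1.
  by congr growth; apply: laurentP => n /=.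
- have -> : spoly dm * lmap (frit Fq m.+1) (spoly h * x i) =
      spoly (map_poly (frit Fq m.+1) h) * (\sum_j spoly (Pm i j) * x j).
    by rewrite -eqm mulrCA -lmap_spoly lmapM.
  exact: growthM.
Qed.

(** The slope is brought down to 0 by using the equation for Y = sigma^m(h x). A deep record low u
    of Y gives [g * sigma(Y)] a coefficient of valuation gamma + q u, while the other side,
    involving only indices below n + N, has valuation at least u - b. *)
Theorem local_bound : exists h : {poly L}, h`_0 = 1 /\
  exists c : nat, forall i (n : int), vge (- c%:Z) (lcoef (spoly h * x i) n).
Proof.
have [rho [h [h0 [e ge]]]] := local_growth.
exists h; split=> //; pose y i := spoly h * x i.
(* [N] is also the size of the denominator [g] of the system for Y whatever m is, so m can be chosen
   afterwards with rho N < q^m. *)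
pose N := size (d * h).
have [e' he'] := linear_lt_exp (rho * N) q1.
pose m := maxn e e'.
have {ge}gm i : growth rho (lmap (frit Fq m) (y i)) by apply: ge; rewrite leq_maxl.
have lt : (rho * N < q ^ m)%N.
  by apply: leq_ltn_trans (he' m (leq_maxr _ _)); rewrite leq_pmulr.
pose Y i := lmap (frit Fq m) (y i).
pose g := map_poly (frit Fq m) (d * h).
have g0 : g`_0 = 1 by rewrite coef_map /= coefM big_ord1 d0 h0 mulr1 rmorph1.
have gn0 : g != 0 by apply: contra_eq_neq g0 => ->; rewrite coef0 eq_sym oner_neq0.
pose P' i j := map_poly (frit Fq m) (map_poly Fq h * P i j).
have eqY i : spoly g * lmap Fq (Y i) = \sum_j spoly (P' i j) * Y j.
  have -> : lmap Fq (Y i) = lmap (frit Fq m) (lmap Fq (y i)).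
    by apply: laurentP => n /=; rewrite !(fritE FqE) !FqE -!exprM mulnC.
  have ey : lmap Fq (y i) = spoly (map_poly Fq h) * lmap Fq (x i).
    by rewrite lmapM lmap_spoly.
  have -> : spoly g * lmap (frit Fq m) (lmap Fq (y i)) =
      lmap (frit Fq m) (spoly (d * h) * lmap Fq (y i)).
    by rewrite lmapM lmap_spoly.
  have -> : spoly (d * h) * lmap Fq (y i) = \sum_j spoly (map_poly Fq h * P i j) * y j.
    have -> : spoly (d * h) * lmap Fq (y i) =
        spoly h * spoly (map_poly Fq h) * (spoly d * lmap Fq (x i)).
      by rewrite ey rmorphM; ring.
    rewrite eqx mulr_sumr; apply: eq_bigr => j _.
    by rewrite /y rmorphM; ring.
  rewrite lmap_sum; apply: eq_bigr => j _.
  by rewrite lmapM lmap_spoly.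
have [gamma dom] := dominant_coef vM vD 0 gn0.
have [b hb] := vge_polys v (fun ij : I * I => P' ij.1 ij.2).
(* From gamma + q u >= u - b one gets (q - 1) u >= - b - gamma, which fails for u < - C. *)
pose C := (b + `|gamma|)%N.+1.
have bound i n : lcoef (Y i) n != 0 -> - C%:Z <= v (lcoef (Y i) n) + 0%:Z * n.
  apply: (@window_bound _ _ _ Y 0 N (q ^ m) rho) => // {}i {}n.
    rewrite /= (fritE FqE) => nz; rewrite (vX vM); first exact: dvdz_mulr.
    by apply: contraNneq nz => ->; rewrite expr0n gtn_eqF// expn_gt0 q0.
  move=> nz; rewrite mul0r addr0 => low prev next.
  have nzq j k : (lcoef (lmap Fq (Y j)) k != 0) = (lcoef (Y j) k != 0).
    by rewrite [lcoef (lmap _ _) _]/= fmorph_eq0.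
  have vq j k : lcoef (Y j) k != 0 -> v (lcoef (lmap Fq (Y j)) k) = q%:Z * v (lcoef (Y j) k).
    by move=> nzj; rewrite [lcoef (lmap _ _) _]/= FqE (vX vM).
  have sg : size g = N by rewrite size_map_poly.
  have [|k k_n|k k_n|k [nk kn z0 ez]] := dom (lmap Fq (Y i)) n; rewrite ?nzq//.
  - by move=> nzk; have := prev i k k_n nzk; rewrite !vq//; nia.
  - move=> nzk; rewrite sg in k_n; have := next i k k_n nzk; rewrite !vq//; nia.
  have : vge (- b%:Z + v (lcoef (Y i) n)) (lcoef (spoly g * lmap Fq (Y i)) k).
    rewrite eqY lcoef_sum; apply: vge_sum => // j _; rewrite lcoef_spolyM.
    apply: vge_sum => // r _; apply: vgeM => //; first exact: (hb (i, j)).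
    apply/implyP => nzj; have := next j _ _ nzj; rewrite !mul0r !addr0; apply.
    by move: kn; rewrite sg; lia.
  move=> /implyP/(_ z0); move: ez; rewrite vq// !mul0r !addr0 => ->.
  by move: low; rewrite /C; nia.
exists C => i n; apply/implyP => nz.
have nzY : lcoef (Y i) n != 0 by rewrite /= fmorph_eq0.
have := bound _ _ nzY; rewrite mul0r addr0 [lcoef (Y i) n]/= (fritE FqE) (vX vM)//.
have : (0 < q ^ m)%N by rewrite expn_gt0 q0.
move: (v _) (q ^ m)%N => u Q; nia.
Qed.

End LocalBound.

(* As [k] is finite, "finitely many values" stands for "spanning a
   finite-dimensional [k]-space". *)
Definition finitely_valued_solutions (k : finFieldType) (F : fieldType)
    (iota : {rmorphism k -> F}) : Prop :=
  forall (I : finType) (d : {poly F}) (P : I -> I -> {poly F}) (x : I -> laurent F),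
    d`_0 = 1 ->
    (forall i, spoly d * lmap (frob iota) (x i) = \sum_j spoly (P i j) * x j) ->
    exists h : {poly F}, h`_0 = 1 /\
    exists W : seq F, forall i (n : int), lcoef (spoly h * x i) n \in W.

Lemma lcoef_spolyM_wide (K : fieldType) (p : {poly K}) x (n : int) M :
  (size p <= M)%N ->
  lcoef (spoly p * x) n = \sum_(j < M) p`_j * lcoef x (n - j%:Z).
Proof.
move=> pM; rewrite lcoef_spolyM (big_ord_widen M (fun j => p`_j * lcoef x (n - j%:Z)))//.
rewrite big_mkcond; apply: eq_bigr => j _; case: ltnP => // pj.
by rewrite nth_default// mul0r.
Qed.

(** * Passing to coordinates over a subfield *)

Section Descent.
Variables (k : finFieldType) (F E : fieldType).
Variables (iF : {rmorphism k -> F}) (phi : {rmorphism F -> E}).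
Local Notation q := #|k|.
Variables (n : nat) (e : 'I_n -> E) (lambda : 'I_n -> E -> F).
Hypothesis lambdaD : forall m x y, lambda m (x + y) = lambda m x + lambda m y.
Hypothesis lambdaZ : forall m a x, lambda m (phi a * x) = a * lambda m x.
Hypothesis lambda_dual : forall m l, lambda m (e l ^+ q) = (m == l)%:R.

Let lambda0 m : lambda m 0 = 0.
Proof. by rewrite -(mulr0 (phi 0)) lambdaZ mul0r. Qed.

Let lambda_sum m I (r : seq I) (G : I -> E) :
  lambda m (\sum_(i <- r) G i) = \sum_(i <- r) lambda m (G i).
Proof. by elim: r => [|i r IHr]; rewrite ?big_nil// !big_cons lambdaD IHr. Qed.

Definition coord_poly m (p : {poly E}) : {poly F} := \poly_(j < size p) lambda m p`_j.

Lemma coef_coord_poly m p j : (coord_poly m p)`_j = lambda m p`_j.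
Proof. by rewrite coef_poly; case: ltnP => // pj; rewrite nth_default// lambda0. Qed.

(** [lambda m] is F-linear and [c] has its coefficients in F, so the functional passes through the
    convolution and acts on the coefficients of [p * a] alone. *)
Lemma coord_lcoef m p a c (N : int) :
  lambda m (lcoef (spoly p * (lconst a * lmap phi c)) N) =
  lcoef (spoly (coord_poly m (p * a%:P)) * c) N.
Proof.
rewrite lcoef_spolyM lambda_sum (@lcoef_spolyM_wide _ _ _ _ (size p)); last first.
  apply: leq_trans (size_poly _ _) _; rewrite mulrC mul_polyC; exact: size_scale_leq.
apply: eq_bigr => j _; rewrite coef_coord_poly coefMC lcoef_lconstM.
by rewrite mulrA mulrC lambdaZ mulrC.
Qed.

(* Duality of [lambda] with the [e l ^+ q] makes the matrix of the system
   satisfied by the coordinates [c] reduce to the identity at s = 0. *)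
Lemma descend_system : finitely_valued_solutions iF ->
  forall (I : finType) (d : {poly E}) (P : I -> I -> {poly E}) (x : I -> laurent E)
    (c : I -> 'I_n -> laurent F),
  d`_0 = 1 ->
  (forall i, spoly d * lmap (frob (phi \o iF)) (x i) = \sum_j spoly (P i j) * x j) ->
  (forall i, x i = \sum_l lconst (e l) * lmap phi (c i l)) ->
  exists h : {poly E}, h`_0 = 1 /\
  exists W : seq E, forall i (N : int), lcoef (spoly h * x i) N \in W.
Proof.
move=> fvF I d P x c d0 eqx xc.
pose T : 'M[{poly F}]_n := \matrix_(m, l) coord_poly m (d * (e l ^+ q)%:P).
pose S m i j l := coord_poly m (P i j * (e l)%:P).
have frob_x i : lmap (frob (phi \o iF)) (x i) =
    \sum_l lconst (e l ^+ q) * lmap phi (lmap (frob iF) (c i l)).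
  rewrite xc lmap_sum; apply: eq_bigr => l _; rewrite lmapM; congr (_ * _).
    by rewrite -spolyC lmap_spoly map_polyC spolyC.
  by apply: laurentP => N /=; rewrite /frob rmorphXn.
have eqc m i : \sum_l spoly (T m l) * lmap (frob iF) (c i l) =
    \sum_j \sum_l spoly (S m i j l) * c j l.
  apply: laurentP => N; have /(congr1 (fun y => lambda m (lcoef y N))) := eqx i.
  rewrite frob_x mulr_sumr !lcoef_sum !lambda_sum.
  under eq_bigr do rewrite coord_lcoef.
  under [in RHS]eq_bigr do rewrite xc mulr_sumr lcoef_sum lambda_sum.
  under [in RHS]eq_bigr do under eq_bigr do rewrite coord_lcoef.
  move=> e1; under eq_bigr do rewrite mxE.
  by rewrite e1; apply: eq_bigr => j _; rewrite lcoef_sum.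
have detT : (\det T)`_0 = 1.
  rewrite -horner_coef0 -[_.[0]]/(horner_eval 0 (\det T)) -det_map_mx.
  rewrite [map_mx _ _](_ : _ = 1%:M) ?det1//; apply/matrixP => m l.
  rewrite !mxE [LHS]horner_coef0 coef_coord_poly coefMC d0 mul1r.
  exact: lambda_dual.
pose P' (il jl : I * 'I_n) := \sum_m \adj T il.2 m * S m il.1 jl.1 jl.2.
(* Multiplying by the adjugate of [T] isolates each sigma(c i l), with \det T as common denominator;
   its constant term is 1. *)
have [|h0 [h00 [W0 hW0]]] :=
    fvF (I * 'I_n)%type (\det T) P' (fun il => c il.1 il.2) detT.
  move=> [i l] /=.
  have : \sum_m spoly (\adj T l m) * (\sum_l spoly (T m l) * lmap (frob iF) (c i l)) =
      spoly (\det T) * lmap (frob iF) (c i l).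
    under eq_bigr do rewrite mulr_sumr.
    rewrite exchange_big /= (bigD1 l)//= [X in _ + X]big1 ?addr0.
      under eq_bigr do rewrite mulrA -rmorphM.
      rewrite -mulr_suml; congr (_ * _); rewrite -rmorph_sum; congr spoly.
      have /matrixP/(_ l l) := mul_adj_mx T; rewrite !mxE eqxx mulr1n => <-.
      by apply: eq_bigr => m _.
    move=> l' l'l; under eq_bigr do rewrite mulrA -rmorphM.
    rewrite -mulr_suml -rmorph_sum; have /matrixP/(_ l l') := mul_adj_mx T.
    rewrite !mxE eq_sym (negPf l'l) mulr0n => ->; by rewrite rmorph0 mul0r.
  move=> <-.
  transitivity (\sum_j \sum_m spoly (\adj T l m) * \sum_l0 spoly (S m i j l0) * c j l0).
    rewrite exchange_big /=; apply: eq_bigr => m _.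
    apply: etrans (mulr_sumr _ _ _ _); congr (_ * _); exact: eqc.
  rewrite -(pair_bigA _ (fun j l' => spoly (P' (i, l) (j, l')) * c j l')) /=.
  apply: eq_bigr => j _.
  transitivity (\sum_l0 \sum_m spoly (\adj T l m) * (spoly (S m i j l0) * c j l0)).
    rewrite exchange_big /=; apply: eq_bigr => m _; by rewrite mulr_sumr.
  apply: eq_bigr => l' _.
  rewrite /P' /= rmorph_sum mulr_suml; apply: eq_bigr => m _.
  by rewrite rmorphM mulrA.
exists (map_poly phi h0); split; first by rewrite coef_map /= h00 rmorph1.
(* All combinations of the vectors [e l] with coordinates taken from the finite list [W0]. *)
exists [seq \sum_l e l * phi (val (t l)) | t : {ffun 'I_n -> seq_sub W0}] => i N.
have -> : lcoef (spoly (map_poly phi h0) * x i) N =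
    \sum_l e l * phi (lcoef (spoly h0 * c i l) N).
  rewrite xc mulr_sumr lcoef_sum; apply: eq_bigr => l _.
  by rewrite mulrCA lcoef_lconstM -lmap_spoly -lmapM.
apply/mapP; exists [ffun l => SeqSub (hW0 (i, l) N)]; first by rewrite mem_enum.
by apply: eq_bigr => l _; rewrite ffunE.
Qed.

End Descent.

(** * Places of a rational function field *)

Section FractionValuation.
Variables (A : idomainType) (mu : A -> int).
Hypothesis muM : forall a b, a != 0 -> b != 0 -> mu (a * b) = mu a + mu b.
Hypothesis muD : forall a b (n : int), a != 0 -> b != 0 -> a + b != 0 ->
  n <= mu a -> n <= mu b -> n <= mu (a + b).

Definition fracval (z : {fraction A}) : int := mu (\n_(repr z)) - mu (\d_(repr z)).

Lemma fracval_div a b : a != 0 -> b != 0 ->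
  fracval (tofrac a / tofrac b) = mu a - mu b.
Proof.
move=> a0 b0; set z := _ / _; rewrite /fracval; have /eqP := fraction_repr z.
have d0 := denom_ratioP (repr z).
rewrite {1}/z eqr_div ?tofrac_eq0// -!tofracM tofrac_eq => /eqP e.
have n0 : \n_(repr z) != 0.
  by apply: contraNneq (mulf_neq0 a0 d0) => n0; rewrite e n0 mul0r.
by have := congr1 mu e; rewrite !muM//; lia.
Qed.

Lemma fracval_tofrac a : a != 0 -> fracval (tofrac a) = mu a.
Proof.
move=> a0; rewrite -[tofrac a]divr1 -(tofrac1 A) fracval_div ?oner_neq0//.
suff -> : mu 1 = 0 by rewrite subr0.
by apply: (addrI (mu 1)); rewrite addr0 -muM ?oner_neq0// mulr1.
Qed.

Lemma fraction_div (z : {fraction A}) : z != 0 ->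
  exists a b, [/\ a != 0, b != 0 & z = tofrac a / tofrac b].
Proof.
move=> z0; exists (\n_(repr z)), (\d_(repr z)); split; last exact: fraction_repr.
  by apply: contraNneq z0 => n0; rewrite [z]fraction_repr n0 tofrac0 mul0r.
exact: denom_ratioP.
Qed.

Lemma fracvalM x y : x != 0 -> y != 0 -> fracval (x * y) = fracval x + fracval y.
Proof.
move=> /fraction_div[a [b [a0 b0 ->]]] /fraction_div[c [d [c0 d0 ->]]].
by rewrite mulf_div -!tofracM !fracval_div ?mulf_neq0// !muM//; lia.
Qed.

Lemma fracvalD x y (n : int) : x != 0 -> y != 0 -> x + y != 0 ->
  n <= fracval x -> n <= fracval y -> n <= fracval (x + y).
Proof.
move=> /fraction_div[a [b [a0 b0 ->]]] /fraction_div[c [d [c0 d0 ->]]].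
rewrite addf_div ?tofrac_eq0// -!tofracM -tofracD => xy0.
have ab0 : a * d + c * b != 0.
  by apply: contraNneq xy0 => ->; rewrite tofrac0 mul0r.
rewrite !fracval_div ?mulf_neq0// => nab ncd.
rewrite lerBrDr; apply: muD; rewrite ?mulf_neq0// !muM//; lia.
Qed.

End FractionValuation.

Section PolyValuations.
Variable F : fieldType.
Implicit Types (a b g pi : {poly F}).

Definition prime_poly pi := pi \is monic /\ irreducible_poly pi.

(** The range n < size a loses nothing for prime [pi] and nonzero [a], since [pi ^+ n] has size
    greater than n. *)
Definition poly_mult pi a : nat := \max_(n < size a | pi ^+ n %| a) n.

Lemma prime_poly_exp_size pi n : prime_poly pi -> (n < size (pi ^+ n))%N.
Proof.
move=> [mpi [spi _]]; elim: n => [|n IHn]; first by rewrite expr0 size_poly1.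
have pi0 : pi != 0 by rewrite monic_neq0.
rewrite exprS size_mul ?expf_neq0//.
by move: spi IHn; case: (size pi) => [|[|s]]//=; case: (size _) => //= r; lia.
Qed.

Lemma poly_multP pi a n : prime_poly pi -> a != 0 ->
  (pi ^+ n %| a) = (n <= poly_mult pi a)%N.
Proof.
move=> ppi a0; apply/idP/idP => [pina|nm].
  have na : (n < size a)%N.
    by apply: leq_trans (prime_poly_exp_size n ppi) _; apply: dvdp_leq.
  exact: (@leq_bigmax_cond _ _ _ (Ordinal na)).
apply: dvdp_trans (dvdp_exp2l _ nm) _; rewrite /poly_mult.
elim/big_rec: _ => [|i m pi_i IHm]; first by rewrite expr0 dvd1p.
by rewrite /maxn; case: ltnP.
Qed.

Lemma poly_mult_decomp pi a : prime_poly pi -> a != 0 ->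
  exists b, [/\ b != 0, ~~ (pi %| b) & a = b * pi ^+ poly_mult pi a].
Proof.
move=> ppi a0; have : pi ^+ poly_mult pi a %| a by rewrite poly_multP.
move=> /dvdpP[b e]; exists b; split=> //.
  by apply: contraNneq a0 => b0; rewrite e b0 mul0r.
apply/negP => /dvdpP[c bc].
have : pi ^+ (poly_mult pi a).+1 %| a.
  by apply/dvdpP; exists c; rewrite exprS mulrA -bc.
by rewrite poly_multP// ltnn.
Qed.

Lemma poly_multM pi a b : prime_poly pi -> a != 0 -> b != 0 ->
  poly_mult pi (a * b) = (poly_mult pi a + poly_mult pi b)%N.
Proof.
move=> ppi a0 b0; have ab0 := mulf_neq0 a0 b0.
have [a' [a'0 pia' ea]] := poly_mult_decomp ppi a0.
have [b' [b'0 pib' eb]] := poly_mult_decomp ppi b0.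
have e : a * b = a' * b' * pi ^+ (poly_mult pi a + poly_mult pi b).
  by rewrite {1}ea {1}eb exprD mulrACA.
apply/eqP; rewrite eqn_leq -(poly_multP _ ppi ab0) [in X in _ && X]e dvdp_mulIr andbT.
rewrite leqNgt -(poly_multP _ ppi ab0) e exprS dvdp_mul2r; last first.
  by case: ppi => /monic_neq0 pi0 _; rewrite expf_neq0.
case: (ppi) => _ irr; rewrite Gauss_dvdpr ?pib'//.
by rewrite irreducible_poly_coprime.
Qed.

Lemma poly_multD pi a b (n : nat) : prime_poly pi ->
  a != 0 -> b != 0 -> a + b != 0 ->
  (n <= poly_mult pi a)%N -> (n <= poly_mult pi b)%N -> (n <= poly_mult pi (a + b))%N.
Proof.
by move=> ppi a0 b0 ab0; rewrite -!poly_multP//; apply: dvdp_add.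
Qed.

Definition pival pi : ratfun F -> int := fracval (fun a => (poly_mult pi a)%:Z).
(** On nonzero polynomials 1 - size is minus the degree, so this is the valuation at infinity. *)
Definition degval : ratfun F -> int := fracval (fun a : {poly F} => 1 - (size a)%:Z).

Let pimuM pi (ppi : prime_poly pi) a b : a != 0 -> b != 0 ->
  (poly_mult pi (a * b))%:Z = (poly_mult pi a)%:Z + (poly_mult pi b)%:Z.
Proof. by move=> a0 b0; rewrite poly_multM. Qed.

Let degmuM a b : a != 0 -> b != 0 ->
  1 - (size (a * b))%:Z = 1 - (size a)%:Z + (1 - (size b)%:Z).
Proof.
move=> a0 b0; rewrite size_mul//; move: a0 b0; rewrite -!size_poly_gt0.
by case: (size a) => // m; case: (size b) => // n; lia.
Qed.

Lemma pivalM pi : prime_poly pi -> forall x y : ratfun F, x != 0 -> y != 0 ->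
  pival pi (x * y) = pival pi x + pival pi y.
Proof. by move=> ppi; apply: fracvalM; apply: pimuM. Qed.

Lemma pivalD pi : prime_poly pi -> forall (x y : ratfun F) (n : int),
  x != 0 -> y != 0 -> x + y != 0 ->
  n <= pival pi x -> n <= pival pi y -> n <= pival pi (x + y).
Proof.
move=> ppi; apply: fracvalD; first exact: pimuM.
move=> a b n a0 b0 ab0; case: n => [n|n]; last by [].
by rewrite !lez_nat; apply: poly_multD.
Qed.

Lemma degvalM (x y : ratfun F) : x != 0 -> y != 0 -> degval (x * y) = degval x + degval y.
Proof. exact: fracvalM. Qed.

Lemma degvalD (x y : ratfun F) (n : int) : x != 0 -> y != 0 -> x + y != 0 ->
  n <= degval x -> n <= degval y -> n <= degval (x + y).
Proof.
apply: fracvalD => // a b m _ _ _.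
rewrite !lerBrDr -!lerBrDl => ma mb.
apply: (@le_trans _ _ (maxn (size a) (size b))%:Z); first by rewrite lez_nat size_polyD.
by rewrite /maxn; case: ifP.
Qed.

Lemma pival_tofrac pi a : prime_poly pi -> a != 0 -> pival pi (tofrac a) = poly_mult pi a.
Proof. by move=> ppi a0; rewrite /pival fracval_tofrac//; apply: pimuM. Qed.

Lemma degval_tofrac a : a != 0 -> degval (tofrac a) = 1 - (size a)%:Z.
Proof. by move=> a0; rewrite /degval fracval_tofrac. Qed.

Lemma pival_tofrac_ge0 pi a : prime_poly pi -> vge (pival pi) 0 (tofrac a).
Proof.
by move=> ppi; apply/implyP; rewrite tofrac_eq0 => a0; rewrite pival_tofrac.
Qed.

Lemma prime_factor a : (1 < size a)%N -> exists2 pi, prime_poly pi & pi %| a.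
Proof.
move=> sa; have a0 : a != 0 by rewrite -size_poly_gt0 ltnW.
pose P n := `[< exists b, [/\ size b = n, (1 < size b)%N & b %| a] >].
have exP : exists n, P n by exists (size a); apply/asboolP; exists a.
case: (ex_minnP exP) => n /asboolP[b [bn sb ba]] nmin.
have b0 : b != 0 by rewrite -size_poly_gt0 ltnW.
have lb0 : (lead_coef b)^-1 != 0 by rewrite invr_eq0 lead_coef_eq0.
exists ((lead_coef b)^-1 *: b); last by rewrite dvdpZl.
split; first by rewrite monicE lead_coefZ mulVf ?lead_coef_eq0.
split=> [|c sc]; first by rewrite size_scale.
rewrite dvdpZr// => cb; apply: (@eqp_trans _ b); last by rewrite eqp_sym eqp_scale.
have c0 : c != 0 by apply: contraNneq b0 => c0; move: cb; rewrite c0 dvd0p.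
rewrite -(dvdp_size_eqp cb) eqn_leq dvdp_leq//= bn; apply: nmin.
apply/asboolP; exists c; split=> //; last exact: dvdp_trans ba.
by move: c0 sc; rewrite -size_poly_gt0; case: (size c) => [|[]].
Qed.

Lemma prime_factor_ind (Q : {poly F} -> Prop) :
  (forall a, size a = 1%N -> Q a) ->
  (forall pi a, prime_poly pi -> a != 0 -> Q a -> Q (pi * a)) ->
  forall a, a != 0 -> Q a.
Proof.
move=> Q1 QM a; have [n] := ubnP (size a); elim: n a => // n IHn a sn a0.
have [s1|s1] := leqP (size a) 1.
  by apply: Q1; apply/eqP; rewrite eqn_leq s1 size_poly_gt0.
have [pi ppi /dvdpP[b e]] := prime_factor s1.
have b0 : b != 0 by apply: contraNneq a0 => b0; rewrite e b0 mul0r.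
rewrite e mulrC; apply: QM => //; apply: IHn => //.
case: ppi => mpi [spi _]; rewrite -ltnS; apply: leq_trans sn.
rewrite e size_mul ?(monic_neq0 mpi)//; move: spi b0; rewrite -size_poly_gt0.
by case: (size b) => // r; case: (size pi) => [|[|s]]//=; lia.
Qed.

Lemma prime_dvdM pi pi' a : prime_poly pi -> prime_poly pi' ->
  pi %| pi' * a -> pi = pi' \/ pi %| a.
Proof.
move=> [mpi irr] [mpi' [_ irr']]; have [pipi'|npi] := boolP (pi %| pi').
  left; apply/eqP; rewrite -eqp_monic//; apply: irr' => //.
  by case: irr => s _; rewrite gtn_eqF.
by rewrite Gauss_dvdpr ?irreducible_poly_coprime//; right.
Qed.

(** A prime factor of the denominator in lowest terms would make the valuation at that prime
    negative. *)
Lemma integral_ratfun (z : ratfun F) :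
  (forall pi, prime_poly pi -> vge (pival pi) 0 z) -> exists a, z = tofrac a.
Proof.
have [->|z0] := eqVneq z 0; first by exists 0; rewrite tofrac0.
have [n [d [n0 d0 e]]] := fraction_div z0.
pose c := gcdp n d; have c0 : c != 0 by rewrite gcdp_eq0 negb_and n0.
have [/dvdpP[n' en] /dvdpP[d' ed]] : c %| n /\ c %| d by rewrite dvdp_gcdl dvdp_gcdr.
have n'0 : n' != 0 by apply: contraNneq n0 => n'0; rewrite en n'0 mul0r.
have d'0 : d' != 0 by apply: contraNneq d0 => d'0; rewrite ed d'0 mul0r.
have {}e : z = tofrac n' / tofrac d'.
  have cf0 : tofrac c != 0 by rewrite tofrac_eq0.
  by rewrite e en ed !tofracM -(mulf_div _ (tofrac d')) (divff cf0) mulr1.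
move=> zge; have [s1|s1] := leqP (size d') 1.
  have [r er] : exists r, d' = r%:P by exists d'`_0; apply: size1_polyC.
  have r0 : r != 0 by move: d'0; rewrite er polyC_eq0.
  exists (r^-1 *: n'); rewrite e er; apply: (canLR (mulfK _)).
    by rewrite tofrac_eq0 polyC_eq0.
  by rewrite -tofracM -mul_polyC mulrAC -polyCM mulVf// mul1r.
have [pi ppi pid] := prime_factor s1.
have npin : ~~ (pi %| n').
  apply/negP => pin; case: (ppi) => _ [spi _].
  have : pi * c %| c.
    by rewrite dvdp_gcd {1}en ed !dvdp_mul2r ?pin.
  move/(dvdp_leq c0); rewrite size_mul ?(monic_neq0 ppi.1)//.
  move: spi c0; rewrite -size_poly_gt0.
  by case: (size c) => // s; case: (size pi) => [|[|t]]//=; lia.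
have /implyP/(_ z0) := zge pi ppi; rewrite e /pival fracval_div//; last exact: pimuM.
move: npin pid; rewrite -[pi]expr1 !poly_multP//.
by rewrite expr1; lia.
Qed.

(** An F-linear retraction of F(u) onto F[u], independent of the chosen fraction. It makes
    coefficient functionals available on the whole of F(u). *)
Definition polypart (z : ratfun F) : {poly F} := \n_(repr z) %/ \d_(repr z).

Lemma polypart_div a b : b != 0 -> polypart (tofrac a / tofrac b) = a %/ b.
Proof.
move=> b0; set z := _ / _; rewrite /polypart; have /eqP := fraction_repr z.
have d0 := denom_ratioP (repr z).
rewrite {1}/z eqr_div ?tofrac_eq0// -!tofracM tofrac_eq => /eqP e.
by rewrite -(divp_pmul2r _ b0 d0) -e mulrC divp_pmul2l.
Qed.

Lemma polypart_tofrac a : polypart (tofrac a) = a.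
Proof. by rewrite -[tofrac a]divr1 -tofrac1 polypart_div ?oner_neq0// divp1. Qed.

Lemma polypartD x y : polypart (x + y) = polypart x + polypart y.
Proof.
rewrite (fraction_repr x) (fraction_repr y).
move: (denom_ratioP (repr x)) (denom_ratioP (repr y)).
move: (\n_(repr x)) (\d_(repr x)) (\n_(repr y)) (\d_(repr y)) => a b c d b0 d0.
rewrite addf_div ?tofrac_eq0// -!tofracM -tofracD !polypart_div ?mulf_neq0//.
by rewrite divpD divp_pmul2r// [b * d]mulrC divp_pmul2r.
Qed.

Lemma polypartZ c x : polypart (tofrac c%:P * x) = c *: polypart x.
Proof.
rewrite (fraction_repr x); have d0 := denom_ratioP (repr x).
by rewrite mulrA -tofracM !polypart_div// mul_polyC divpZl.
Qed.

End PolyValuations.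

(** * Bounds at all places of F(u) *)

Section GlobalBound.
Variables (k : finFieldType) (F : fieldType) (iF : {rmorphism k -> F}).
Local Notation q := #|k|.

Definition const_ratfun : F -> ratfun F := @tofrac _ \o polyC.
HB.instance Definition _ := GRing.RMorphism.copy const_ratfun (@tofrac _ \o polyC).

Local Notation iE := (const_ratfun \o iF).
Local Notation growth0 v y := (growth v 0 y).

Lemma common_denominator (s : seq (ratfun F)) :
  exists g : {poly F}, g != 0 /\ forall z, z \in s -> exists a, tofrac g * z = tofrac a.
Proof.
elim: s => [|z s [g [g0 IHs]]]; first by exists 1; split; rewrite ?oner_neq0.
move: (denom_ratioP (repr z)) (fraction_repr z).
move: (\n_(repr z)) (\d_(repr z)) => n d d0 ez.
have df0 : tofrac d != 0 by rewrite tofrac_eq0.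
exists (d * g); split=> [|y]; first by rewrite mulf_neq0.
rewrite inE => /predU1P[->|/IHs[a e]]; rewrite tofracM.
  exists (g * n); rewrite ez tofracM [tofrac d * _]mulrC -mulrA; congr (_ * _).
  by rewrite mulrCA divff ?mulr1.
by exists (d * a); rewrite tofracM -mulrA e.
Qed.

Lemma common_denominator_polys (I : finType) (P : I -> {poly (ratfun F)}) :
  exists g : {poly F}, g != 0 /\
  forall i j, exists a, tofrac g * (P i)`_j = tofrac a.
Proof.
have [g [g0 hg]] := common_denominator (flatten [seq polyseq (P i) | i : I]).
exists g; split=> // i j; have [jP|jP] := ltnP j (size (P i)); last first.
  by exists 0; rewrite nth_default// mulr0 tofrac0.
by apply: hg; apply/flatten_mapP; exists i; rewrite ?mem_enum ?mem_nth.
Qed.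

Lemma pival_integral (g pi : {poly F}) z a : prime_poly pi -> g != 0 -> ~~ (pi %| g) ->
  tofrac g * z = tofrac a -> vge (pival pi) 0 z.
Proof.
move=> ppi g0 pig e; apply/implyP => z0.
have gf0 : tofrac g != 0 by rewrite tofrac_eq0.
have a0 : a != 0.
  by apply: contraNneq (mulf_neq0 gf0 z0) => a0; rewrite e a0 tofrac0.
have := congr1 (pival pi) e.
rewrite (pivalM ppi gf0 z0) (pival_tofrac ppi g0) (pival_tofrac ppi a0).
by move: pig; rewrite -[pi in pi %| _]expr1 poly_multP//; lia.
Qed.

Variables (I : finType) (d : {poly (ratfun F)}) (P : I -> I -> {poly (ratfun F)}).
Variable x : I -> laurent (ratfun F).
Hypothesis d0 : d`_0 = 1.
Hypothesis eqx : forall i,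
  spoly d * lmap (frob iE) (x i) = \sum_j spoly (P i j) * x j.

Let q1 : (1 < q)%N. Proof. exact: finNzRing_gt1. Qed.

Let frobE z : frob iE z = z ^+ q. Proof. by []. Qed.

Let charE : exists2 p, p \in [pchar (ratfun F)] & p.-nat q.
Proof.
have [p p_pr pk] := finPcharP k; exists p; first by rewrite (fmorph_pchar iE).
by rewrite (card_pprimeChar pk) pnatX pnat_id.
Qed.

Let bound_at (v : ratfun F -> int) :
  (forall x y : ratfun F, x != 0 -> y != 0 -> v (x * y) = v x + v y) ->
  (forall (x y : ratfun F) (n : int), x != 0 -> y != 0 -> x + y != 0 ->
    n <= v x -> n <= v y -> n <= v (x + y)) ->
  exists h : {poly (ratfun F)}, h`_0 = 1 /\ forall i, growth0 v (spoly h * x i).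
Proof.
move=> vM vD; have [p pE pq] := charE.
have [h [h0 [c hc]]] := local_bound vM vD q1 frobE d0 eqx pE pq.
by exists h; split=> // i; exists c%:Z => n; rewrite mul0r subr0; apply: hc.
Qed.

(** The multipliers found at the various primes can be multiplied together, as a further polynomial
    factor in s does not destroy boundedness at a place. *)
Lemma bound_at_primes (g : {poly F}) : g != 0 ->
  exists h : {poly (ratfun F)}, h`_0 = 1 /\
  forall pi : {poly F}, prime_poly pi -> pi %| g -> forall i, growth0 (pival pi) (spoly h * x i).
Proof.
move: g; apply: prime_factor_ind => [g sg|pi g ppi g0 [h [h0 hg]]].
  exists 1; split; first by rewrite coefC.
  move=> pi [mpi [spi _]] /dvdp_leq; rewrite -size_poly_gt0 sg => /(_ isT).
  by rewrite leqNgt spi.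
have [h' [h'0 hpi]] := bound_at (pivalM ppi) (@pivalD _ _ ppi).
exists (h * h'); split; first by rewrite coefM big_ord1 h0 h'0 mulr1.
move=> pi' ppi' /(prime_dvdM ppi' ppi)[->|pi'g] i; rewrite rmorphM.
  rewrite -mulrA; apply: growthM (hpi i); first exact: pivalM. exact: (@pivalD _ _ ppi).
rewrite mulrAC mulrC; apply: growthM (hg pi' ppi' pi'g i); first exact: pivalM.
exact: (@pivalD _ _ ppi').
Qed.

(** A pole order bounded by c along the whole series is removed by the constant factor [pi ^+ c],
    and such factors do no harm at the other primes. *)
Lemma clear_primes (y : I -> laurent (ratfun F)) (g : {poly F}) : g != 0 ->
  (forall pi : {poly F}, prime_poly pi -> forall i, growth0 (pival pi) (y i)) ->
  exists2 f : {poly F}, f != 0 &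
  forall pi : {poly F}, prime_poly pi -> pi %| g ->
    forall i (n : int), vge (pival pi) 0 (tofrac f * lcoef (y i) n).
Proof.
move=> g0 hy; move: g g0; apply: prime_factor_ind => [g sg|pi g ppi g0 [f f0 hf]].
  exists 1; first exact: oner_neq0.
  move=> pi [mpi [spi _]] /dvdp_leq; rewrite -size_poly_gt0 sg => /(_ isT).
  by rewrite leqNgt spi.
have [c hc] := growth_fin (hy pi ppi).
exists (pi ^+ c * f); first by rewrite mulf_neq0 ?expf_neq0 ?(monic_neq0 ppi.1).
move=> pi' ppi' /(prime_dvdM ppi' ppi)[epi|pi'g] i n; rewrite tofracM; last first.
  rewrite -mulrA -[0]addr0; apply: vgeM; first exact: pivalM.
    exact: pival_tofrac_ge0.
  exact: hf.
rewrite epi [tofrac (_ ^+ c) * _]mulrC -mulrA -[0]addr0; apply: vgeM; first exact: pivalM.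
  exact: pival_tofrac_ge0.
rewrite -(subrr c%:Z); apply: vgeM; first exact: pivalM.
  have pin : pi ^+ c != 0 by rewrite expf_neq0 ?(monic_neq0 ppi.1).
  by apply/implyP => _; rewrite (pival_tofrac ppi pin) lez_nat -(poly_multP _ ppi pin).
by have := hc i n; rewrite mul0r subr0.
Qed.

Theorem global_bound : exists h : {poly (ratfun F)}, h`_0 = 1 /\
  exists2 g : {poly F}, g != 0 & exists N : nat,
  forall i (n : int), exists2 a : {poly F}, (size a <= N)%N &
    tofrac g * lcoef (spoly h * x i) n = tofrac a.
Proof.
have [gd [gd0 hgd]] := common_denominator_polys (fun _ : unit => d).
have [gP [gP0 hgP]] := common_denominator_polys (fun ij : I * I => P ij.1 ij.2).
pose G := gd * gP; have G0 : G != 0 by rewrite mulf_neq0.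
have [n0 xn0] := laurents_vanish x.
(* At a prime where [d] and [P] are integral, the growth estimate with b = 0 shows that x is
   integral, so only the prime factors of [G] need a multiplier. *)
have good (pi : {poly F}) : prime_poly pi -> ~~ (pi %| G) ->
    forall i n, vge (pival pi) 0 (lcoef (x i) n).
  move=> ppi piG i n.
  have pid : ~~ (pi %| gd) by apply: contra piG => /dvdp_mulr; apply.
  have piP : ~~ (pi %| gP) by apply: contra piG => /dvdp_mull; apply.
  have [nn0|] := boolP (n < n0); first by rewrite xn0 ?vge0.
  case/int_ge_nat => m ->.
  apply: vge_le (initial_growth (b := 0) (pivalM ppi) (@pivalD _ _ ppi) q1 frobE
    d0 eqx _ _ xn0 i m) => //.
    move=> j; have [a e] := hgd tt j; rewrite oppr0; exact: pival_integral e.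
  move=> i' j' j; have [a e] := hgP (i', j') j; rewrite oppr0; exact: pival_integral e.
have [hG [hG0 hGb]] := bound_at_primes G0.
have [hd [hd0 hdb]] := bound_at (@degvalM F) (@degvalD F).
pose h := hG * hd; pose y i := spoly h * x i.
(* The coefficients of [h] may have poles at new primes; there x is integral, so [h * x] is still
   bounded, but these poles have to be cleared too. *)
have [gh [gh0 hgh]] := common_denominator_polys (fun _ : unit => h).
have yE i n : lcoef (y i) n = \sum_(j < size h) h`_j * lcoef (x i) (n - j%:Z).
  by rewrite lcoef_spolyM.
have ypi (pi : {poly F}) : prime_poly pi -> forall i, growth0 (pival pi) (y i).
  move=> ppi i; have [piG|piG] := boolP (pi %| G).
    rewrite /y /h rmorphM mulrAC mulrC; apply: growthM (hGb _ ppi piG i).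
      exact: pivalM.
    exact: (@pivalD _ _ ppi).
  apply: growthM; [exact: pivalM | exact: (@pivalD _ _ ppi) |].
  by exists 0 => n; rewrite mul0r subr0 oppr0; apply: good.
have ydeg i : growth0 (@degval F) (y i).
  by rewrite /y /h rmorphM -mulrA; apply: growthM (hdb i); [exact: degvalM | exact: degvalD].
have ygood (pi : {poly F}) : prime_poly pi -> ~~ (pi %| G * gh) ->
    forall i n, vge (pival pi) 0 (lcoef (y i) n).
  move=> ppi pin i n; rewrite yE; apply: vge_sum => [|j _]; first exact: (@pivalD _ _ ppi).
  rewrite -[0]addr0; apply: vgeM; first exact: pivalM.
    have [a e] := hgh tt j; apply: pival_integral e => //.
    by apply: contra pin => /dvdp_mull; apply.
  by apply: good => //; apply: contra pin => /dvdp_mulr; apply.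
have [|f f0 hf] := @clear_primes y (G * gh) _ ypi; first by rewrite mulf_neq0.
exists h; split; first by rewrite coefM big_ord1 hG0 hd0 mulr1.
exists f => //; have [c hc] := growth_fin ydeg.
have ff0 : tofrac f != 0 by rewrite tofrac_eq0.
(* The valuation at infinity of f y_n = a is at least 1 - size f - c, and it equals 1 - size a. *)
exists (c + size f)%N => i n.
have [|a e] := @integral_ratfun F (tofrac f * lcoef (y i) n).
  move=> pi ppi; have [pin|pin] := boolP (pi %| G * gh); first exact: hf.
  rewrite -[0]addr0; apply: vgeM; first exact: pivalM.
    exact: pival_tofrac_ge0.
  exact: ygood.
exists a => //; have [->|a0] := eqVneq a 0; first by rewrite size_poly0.
have yn0 : lcoef (y i) n != 0.
  by apply: contraNneq a0 => y0; rewrite -tofrac_eq0 -e y0 mulr0.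
have := congr1 (@degval F) e.
rewrite (degvalM ff0 yn0) (degval_tofrac f0) (degval_tofrac a0).
have /implyP/(_ yn0) := hc i n; rewrite mul0r subr0.
by move: (size a) (size f) (degval _) => sa sf dv; lia.
Qed.

End GlobalBound.

(** * Simple extensions, transcendental and algebraic *)

Section TranscendentalStep.
Variables (k : finFieldType) (F : fieldType) (iF : {rmorphism k -> F}).
Local Notation q := #|k|.
Local Notation phi := (@const_ratfun F).

Theorem transcendental_step : finitely_valued_solutions iF ->
  finitely_valued_solutions (phi \o iF).
Proof.
move=> fvF I d P x d0 eqx.
have [h [h0 [g g0 [N hN]]]] := global_bound d0 eqx.
have gf0 : tofrac g != 0 by rewrite tofrac_eq0.
pose y i := spoly h * x i.
have ya i (n : int) : exists a : {poly F},
    (size a <= N)%N /\ tofrac g * lcoef (y i) n = tofrac a.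
  by have [a sa e] := hN i n; exists a.
have /choice[a ha] : forall i, exists a : int -> {poly F}, forall n,
    (size (a n) <= N)%N /\ tofrac g * lcoef (y i) n = tofrac (a n).
  by move=> i; have [a ha] := choice (ya i); exists a.
have bc i (l : 'I_N) : bounded_below (fun n => (a i n)`_l).
  have [b yb] := lcoefP (y i); exists b => n nb; have [_ /esym/eqP] := ha i n.
  by rewrite yb// mulr0 tofrac_eq0 => /eqP->; rewrite coef0.
pose c i l := Laurent (bc i l).
pose e (l : 'I_N) := tofrac 'X^l / tofrac g : ratfun F.
(* Since e_l^q = u^(l q) / g^q, clearing g^q and reading the coefficient of u^(m q) gives the dual
   functionals. *)
pose lambda (m : 'I_N) (z : ratfun F) := (polypart (tofrac g ^+ q * z))`_(m * q).
have lambdaD m z w : lambda m (z + w) = lambda m z + lambda m w.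
  by rewrite /lambda mulrDr polypartD coefD.
have lambdaZ m b z : lambda m (phi b * z) = b * lambda m z.
  by rewrite /lambda mulrCA polypartZ coefZ.
have dual m l : lambda m (e l ^+ q) = (m == l)%:R.
  rewrite /lambda /e expr_div_n mulrCA divff ?expf_neq0// mulr1 -rmorphXn.
  rewrite polypart_tofrac -exprM coefXn eqn_pmul2r ?card_finRing_gt0//.
  by rewrite (ltnW (finNzRing_gt1 _)).
(* As sigma(h x) = sigma(h) sigma(x), the factor [h] joins the denominator and sigma(h) joins the
   matrix. *)
have eqy i : spoly (d * h) * lmap (frob (phi \o iF)) (y i) =
    \sum_j spoly (map_poly (frob (phi \o iF)) h * P i j) * y j.
  rewrite /y lmapM lmap_spoly !rmorphM /=.
  set fh := spoly (map_poly _ _).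
  transitivity (spoly h * fh * (spoly d * lmap (frob (phi \o iF)) (x i))); first by ring.
  rewrite eqx mulr_sumr; apply: eq_bigr => j _; rewrite rmorphM -/fh; ring.
have dh0 : (d * h)`_0 = 1 by rewrite coefM big_ord1 d0 h0 mulr1.
have yc i : y i = \sum_l lconst (e l) * lmap phi (c i l).
  apply: laurentP => n; rewrite lcoef_sum; under eq_bigr do rewrite lcoef_lconstM.
  have [sa ea] := ha i n; apply: (mulfI gf0); rewrite ea mulr_sumr.
  transitivity (\sum_(l < N) tofrac ((a i n)`_l *: 'X^l)).
    rewrite -rmorph_sum; congr tofrac; apply/polyP => r.
    rewrite -[a i n in LHS](coefK _); move: sa; rewrite /=.
    move=> sa; rewrite coefK; rewrite -poly_def coef_poly; case: ltnP => // Nr.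
    by rewrite nth_default// (leq_trans sa Nr).
  apply: eq_bigr => l _ /=; rewrite /e mulrA mulrCA divff// mulr1.
  by rewrite mulrC -mul_polyC tofracM.
have [h' [h'0 [W hW]]] := descend_system lambdaD lambdaZ dual fvF dh0 eqy yc.
exists (h' * h); split; first by rewrite coefM big_ord1 h'0 h0 mulr1.
by exists W => i n; rewrite rmorphM -mulrA; apply: hW.
Qed.

End TranscendentalStep.

(* The minimal polynomials of [b] and [b ^+ q] have the same degree [n], so that
   both families of powers are bases; this replaces separability of [b]. *)
Section AlgebraicStep.
Variables (k : finFieldType) (F L : fieldType).
Variables (iF : {rmorphism k -> F}) (f : {rmorphism F -> L}).
Local Notation q := #|k|.
Variables (b : L) (p : {poly F}) (n : nat).
Hypothesis p0 : p != 0.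
Hypothesis pb : root (map_poly f p) b.
Hypothesis size_p : size p = n.+1.
Hypothesis p_min : forall r : {poly F}, r != 0 -> root (map_poly f r) b -> (n < size r)%N.
Hypothesis pq_min : forall r : {poly F}, r != 0 -> root (map_poly f r) (b ^+ q) ->
  (n < size r)%N.

Local Notation E := (subFExtend f b p).
Local Notation fE := (@subfx_inj _ _ f b p).
Local Notation phi := (@inj_subfx _ _ f b p).

Lemma subfx_inj_phi c : fE (phi c) = f c.
Proof. by rewrite /inj_subfx /= subfx_inj_eval// map_polyC hornerC. Qed.

Let beta : E := subfx_root f b p.

Let fE_beta : fE beta = b. Proof. exact: subfx_inj_root. Qed.

Let fE_sum (r : 'rV[F]_n) y : fE (\sum_l phi (r 0 l) * y ^+ l) =
  (map_poly f (rVpoly r)).[fE y].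
Proof.
rewrite rmorph_sum (horner_coef_wide (n := n)); last first.
  by rewrite size_map_poly size_poly.
apply: eq_bigr => l _; rewrite rmorphM rmorphXn /= subfx_inj_phi coef_map /=.
by rewrite coef_rVpoly_ord.
Qed.

Let indep y (r : 'rV[F]_n) :
  (forall s : {poly F}, s != 0 -> root (map_poly f s) (fE y) -> (n < size s)%N) ->
  \sum_l phi (r 0 l) * y ^+ l = 0 -> r = 0.
Proof.
move=> ymin /(congr1 fE); rewrite fE_sum rmorph0 => /rootP ry.
have [|r0] := eqVneq (rVpoly r) 0.
  by move/(congr1 (@poly_rV F n)); rewrite rVpolyK linear0.
by have := ymin _ r0 ry; rewrite ltnNge size_poly.
Qed.

Let coord_ex (z : E) : exists r : 'rV[F]_n, z = \sum_l phi (r 0 l) * beta ^+ l.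
Proof.
have [u ->] := subfxE z; exists (poly_rV (u %% p)); apply: (fmorph_inj fE).
rewrite [RHS]fE_sum poly_rV_K ?fE_beta; last by rewrite -ltnS -size_p ltn_modp.
rewrite [LHS](subfx_inj_eval pb p0) {1}(divp_eq u p) rmorphD rmorphM hornerD hornerM.
by rewrite (rootP pb) mulr0 add0r.
Qed.

Theorem algebraic_step : finitely_valued_solutions iF ->
  finitely_valued_solutions (phi \o iF).
Proof.
move=> fvF I d P x d0 eqx.
have /choice[C hC] := coord_ex.
have beta_min (s : {poly F}) : s != 0 -> root (map_poly f s) (fE beta) -> (n < size s)%N.
  by rewrite fE_beta; apply: p_min.
have C_uniq (z : E) (r : 'rV[F]_n) : z = \sum_l phi (r 0 l) * beta ^+ l -> C z = r.
  move=> zr; apply/eqP; rewrite -subr_eq0; apply/eqP; apply: (indep beta_min).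
  under eq_bigr do rewrite mxE mxE rmorphD rmorphN mulrDl mulNr.
  by rewrite big_split sumrN /= -hC -zr subrr.
have CD y z : C (y + z) = C y + C z.
  apply: C_uniq; rewrite {1}(hC y) {1}(hC z) -big_split /=.
  by apply: eq_bigr => l _; rewrite mxE rmorphD mulrDl.
have CZ a z : C (phi a * z) = a *: C z.
  apply: C_uniq; rewrite {1}(hC z) mulr_sumr.
  by apply: eq_bigr => l _; rewrite mxE rmorphM mulrA.
have C0 : C 0 = 0 by rewrite -(mulr0 (phi 0)) CZ scale0r.
have Csum (s : seq 'I_n) G : C (\sum_(l <- s) G l) = \sum_(l <- s) C (G l).
  by elim: s => [|l s IHs]; rewrite ?big_nil// !big_cons CD IHs.
(* The matrix of the powers of beta^q in the basis of powers of beta. It is invertible because no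
   nonzero polynomial of degree below n vanishes at beta^q, and its inverse yields the dual
   functionals. *)
pose S : 'M[F]_n := \matrix_l C ((beta ^+ q) ^+ l).
have Sunit : S \in unitmx.
  rewrite -row_free_unit; apply: inj_row_free => r rS.
  have bq_min (s : {poly F}) : s != 0 -> root (map_poly f s) (fE (beta ^+ q)) -> (n < size s)%N.
    by rewrite rmorphXn /= fE_beta; apply: pq_min.
  apply: (indep bq_min); rewrite [LHS]hC.
  have -> : C (\sum_l phi (r 0 l) * (beta ^+ q) ^+ l) = 0.
    rewrite -rS mulmx_sum_row Csum; apply: eq_bigr => l _.
    by rewrite CZ rowK.
  by apply: big1 => l _; rewrite mxE rmorph0 mul0r.
pose lambda (m : 'I_n) (z : E) := (C z *m invmx S) 0 m.
have lambdaD m y z : lambda m (y + z) = lambda m y + lambda m z.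
  by rewrite /lambda CD mulmxDl mxE.
have lambdaZ m a z : lambda m (phi a * z) = a * lambda m z.
  by rewrite /lambda CZ -scalemxAl mxE.
have dual m l : lambda m ((beta ^+ nat_of_ord l) ^+ q) = (m == l)%:R.
  rewrite /lambda exprAC -[C _](rowK (fun l : 'I_n => C ((beta ^+ q) ^+ l)) l) -/S.
  by rewrite -row_mul mulmxV// !mxE eq_sym.
have bc i (l : 'I_n) : bounded_below (fun N => C (lcoef (x i) N) 0 l).
  by have [B xB] := lcoefP (x i); exists B => N NB; rewrite xB// C0 mxE.
pose c i l := Laurent (bc i l).
apply: (descend_system lambdaD lambdaZ dual fvF d0 eqx (c := c)) => i.
apply: laurentP => N; rewrite lcoef_sum [LHS]hC; apply: eq_bigr => l _.
by rewrite lcoef_lconstM mulrC.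
Qed.

End AlgebraicStep.

Lemma finitely_valued_finField (k : finFieldType) :
  finitely_valued_solutions (idfun : {rmorphism k -> k}).
Proof.
move=> I d P x _ _; exists 1; split; first by rewrite coefC.
by exists (enum k) => i n; rewrite mem_enum.
Qed.

Lemma finitely_valued_spolyM (F : fieldType) (p : {poly F}) (I : Type)
    (y : I -> laurent F) (W : seq F) :
  (forall i (n : int), lcoef (y i) n \in W) ->
  exists W' : seq F, forall i (n : int), lcoef (spoly p * y i) n \in W'.
Proof.
move=> hW; exists [seq \sum_(j < size p) p`_j * val (t j) | t : {ffun 'I_(size p) -> seq_sub W}].
move=> i n; rewrite lcoef_spolyM; apply/mapP.
exists [ffun j : 'I_(size p) => SeqSub (hW i (n - j%:Z))]; first by rewrite mem_enum.
by apply: eq_bigr => j _; rewrite ffunE.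
Qed.

(** * Finitely generated fields *)

Section Tower.
Variables (k : finFieldType) (L : fieldType) (iota : {rmorphism k -> L}).
Local Notation q := #|k|.

(* Adjoining a p-power of each generator suffices, because a solution is
   finitely valued as soon as its image under a power of Frobenius is. *)
Let tower_over (s : seq L) := exists (F : fieldType) (iF : {rmorphism k -> F})
  (f : {rmorphism F -> L}) (M : nat),
  [/\ forall c, f (iF c) = iota c, finitely_valued_solutions iF
    & forall a, a \in s -> exists z, f z = a ^+ (q ^ M)].

Let tower_algebraic (a : L) (s : seq L) (F : fieldType) (iF : {rmorphism k -> F})
    (f : {rmorphism F -> L}) (M : nat) :
  (forall c, f (iF c) = iota c) -> finitely_valued_solutions iF ->
  (forall a, a \in s -> exists z, f z = a ^+ (q ^ M)) ->
  algebraicOver f a -> tower_over (a :: s).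
Proof.
move=> fi fvF hs alga.
have algX m : algebraicOver f (a ^+ m).
  by elim: m => [|m IHm]; rewrite ?expr0 ?exprS; [exact: algebraic1 | exact: algebraic_mul].
(* The degree is minimised over all a^(q^m) at once: then neither b = a^(q^m) nor its q-th power is
   a root of a nonzero polynomial of smaller degree. *)
pose D n := `[< exists m (p : {poly F}),
  [/\ p != 0, root (map_poly f p) (a ^+ (q ^ m)) & size p = n.+1] >].
have exD : exists n, D n.
  have [p p0 pa] := algX (q ^ 0)%N; exists (size p).-1; apply/asboolP; exists 0%N, p.
  by split=> //; rewrite prednK// size_poly_gt0.
case: (ex_minnP exD) => n /asboolP[m [p [p0 pb sp]]] nmin.
have min m' (r : {poly F}) : r != 0 -> root (map_poly f r) (a ^+ (q ^ m')) -> (n < size r)%N.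
  move=> r0 rb; rewrite -(prednK (_ : 0 < size r)%N) ?size_poly_gt0// ltnS.
  apply: nmin; apply/asboolP; exists m', r; split=> //.
  by rewrite prednK// size_poly_gt0.
pose b := a ^+ (q ^ m).
exists (subFExtend f b p), (inj_subfx f b p \o iF), (subfx_inj (iota := f) (z := b) (p := p)).
exists (M + m)%N; split.
- by move=> c; rewrite /= subfx_inj_phi// fi.
- apply: (algebraic_step p0 pb sp (min m)) => // r r0.
  by rewrite /b -exprM -expnSr; apply: min.
- move=> c; rewrite inE => /predU1P[->|/hs[z fz]].
    exists (subfx_root f b p ^+ (q ^ M)); rewrite rmorphXn /= subfx_inj_root//.
    by rewrite /b -exprM -expnD addnC.
  exists (inj_subfx f b p z ^+ (q ^ m)); rewrite rmorphXn /= subfx_inj_phi// fz.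
  by rewrite -exprM -expnD.
Qed.

Let tower_transcendental (a : L) (s : seq L) (F : fieldType) (iF : {rmorphism k -> F})
    (f : {rmorphism F -> L}) (M : nat) :
  (forall c, f (iF c) = iota c) -> finitely_valued_solutions iF ->
  (forall a, a \in s -> exists z, f z = a ^+ (q ^ M)) ->
  ~ algebraicOver f a -> tower_over (a :: s).
Proof.
move=> fi fvF hs transa.
pose g : {rmorphism {poly F} -> L} := horner_morph (fun x => mulrC a (f x)).
have g_inj : injective g.
  apply: raddf_inj => p gp; apply/eqP/negPn/negP => p0; apply: transa; exists p => //.
  exact/rootP.
pose fE : {rmorphism ratfun F -> L} := HB.pack (frac_ext g)
  (GRing.isZmodMorphism.Build _ _ (frac_ext g) (frac_ext_zmod_morphism g_inj))
  (GRing.isMonoidMorphism.Build _ _ (frac_ext g) (frac_ext_monoid_morphism g_inj)).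
have fEp p : fE (tofrac p) = (map_poly f p).[a] by apply: frac_ext_tofrac.
exists (ratfun F), (@const_ratfun F \o iF), fE, M; split.
- by move=> c; rewrite -fi; have := fEp (iF c)%:P; rewrite map_polyC hornerC.
- exact: transcendental_step.
- move=> c; rewrite inE => /predU1P[->|/hs[z fz]].
    exists (tofrac 'X ^+ (q ^ M)).
    by rewrite rmorphXn [fE _]fEp map_polyX hornerX.
  by exists (tofrac z%:P); rewrite -fz [LHS]fEp map_polyC hornerC.
Qed.

Lemma tower_exists (s : seq L) : tower_over s.
Proof.
elim: s => [|a s [F [iF [f [M [fi fvF hs]]]]]].
  by exists k, idfun, iota, 0%N; split=> //; apply: finitely_valued_finField.
have [alga|transa] := pselect (algebraicOver f a).
  exact: tower_algebraic fi fvF hs alga.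
exact: tower_transcendental fi fvF hs transa.
Qed.

(** The elements whose q^M-th power comes from F form a subfield containing k and the generators,
    hence all of L. So sigma^M factors as L -> F -> L: the system is transported to F, solved there
    and brought back. *)
Theorem finitely_valued_fg : finitely_generated_field iota ->
  finitely_valued_solutions iota.
Proof.
move=> [s fg]; have [F [iF [f [M [fi fvF hs]]]]] := tower_exists s.
have frobE z : frob iota z = z ^+ q by [].
pose fr := frit (frob iota) M.
have frE z : fr z = z ^+ (q ^ M) by apply: fritE.
pose S : {pred L} := fun y => `[< exists z, f z = fr y >].
have SP y : reflect (exists z, f z = fr y) (y \in S) by apply: asboolP.
have SL y : y \in S.
  apply: (fg S) => [|c|c /hs[z fz]].
  - split=> [|y1 y2 /SP[z1 e1] /SP[z2 e2]|y1 y2 /SP[z1 e1] /SP[z2 e2]]; apply/SP.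
    + by exists 1; rewrite !rmorph1.
    + by exists (z1 - z2); rewrite !rmorphB e1 e2.
    + by exists (z1 / z2); rewrite !fmorph_div /= e1 e2.
  - by apply/SP; exists (iF (c ^+ (q ^ M))); rewrite frE fi rmorphXn.
  - by apply/SP; exists z; rewrite frE.
have /choice[r hr] : forall y, exists z, f z = fr y by move=> y; apply/SP.
have r_zmod : zmod_morphism r.
  by move=> y1 y2; apply: (fmorph_inj f); rewrite rmorphB !hr rmorphB.
have r_mon : monoid_morphism r.
  split; first by apply: (fmorph_inj f); rewrite hr !rmorph1.
  by move=> y1 y2; apply: (fmorph_inj f); rewrite rmorphM !hr rmorphM.
have [rr rrE] : exists rr : {rmorphism L -> F}, forall y, f (rr y) = fr y.
  pose rr : {rmorphism L -> F} := HB.pack r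
    (GRing.isZmodMorphism.Build _ _ r r_zmod) (GRing.isMonoidMorphism.Build _ _ r r_mon).
  by exists rr.
move=> I d P x d0 eqx.
have [||h' [h'0 [W hW]]] := fvF I (map_poly rr d) (fun i j => map_poly rr (P i j))
    (fun i => lmap rr (x i)).
- by rewrite coef_map /= d0 rmorph1.
- move=> i; have := congr1 (lmap rr) (eqx i); rewrite lmapM lmap_spoly lmap_sum.
  under [in RHS]eq_bigr do rewrite lmapM lmap_spoly.
  move=> <-; congr (_ * _); apply: laurentP => n /=.
  by rewrite /frob rmorphXn.
pose H := map_poly f h'.
have H0 : H`_0 = 1 by rewrite coef_map /= h'0 rmorph1.
have frx i : lmap fr (x i) = lmap f (lmap rr (x i)).
  by apply: laurentP => n /=; rewrite rrE.
have [W1 hW1] : exists W1 : seq L, forall i (n : int),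
    lcoef (spoly (H ^+ (q ^ M).-1) * (spoly H * lmap fr (x i))) n \in W1.
  apply: (@finitely_valued_spolyM _ _ I _ (map f W)) => i n.
  by rewrite frx -lmap_spoly -lmapM; apply: map_f; apply: hW.
have qM0 : (0 < q ^ M)%N by rewrite expn_gt0 ltnW// finNzRing_gt1.
(* Chosen so that sigma^M(h) = H^(q^M) is a multiple of [H]; then sigma^M(h x) takes finitely many
   values, and so does h x because sigma^M is injective. *)
pose h := H \Po 'X^(q ^ M).
have h0 : h`_0 = 1.
  by rewrite -horner_coef0 horner_comp hornerXn expr0n gtn_eqF// horner_coef0.
have [p p_pr pk] := finPcharP k.
have pL : p \in [pchar L] by rewrite (fmorph_pchar iota).
have pq : p.-nat q by rewrite (card_pprimeChar pk) pnatX pnat_id.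
have frh i : lmap fr (spoly h * x i) = spoly (H ^+ (q ^ M).-1) * (spoly H * lmap fr (x i)).
  have q0 : (0 < q)%N by apply: ltnW; apply: finNzRing_gt1.
  rewrite lmapM [lmap fr (spoly h)](lmap_frit_comp_polyX frobE M H pL pq q0).
  by rewrite mulrA rmorphXn -exprSr prednK.
(* A q^M-th root where one exists, and 0 elsewhere. *)
have /choice[rt hrt] : forall w : L, exists z, (exists z', fr z' = w) -> fr z = w.
  move=> w; have [[z' e]|ne] := pselect (exists z', fr z' = w); first by exists z'.
  by exists 0 => /ne.
exists h; split=> //; exists (map rt W1) => i n.
have -> : lcoef (spoly h * x i) n = rt (fr (lcoef (spoly h * x i) n)).
  by apply: (fmorph_inj fr); rewrite hrt//; eexists.
apply: map_f; have := hW1 i n; rewrite -frh; exact.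
Qed.

End Tower.

(** * The fixed field of the Galois group *)

Section Subfield.
Variables (E : fieldType) (S : {pred E}).

(** The closure proof is an argument so that the field structure can be attached to the
    predicate. *)
Definition divring_pred of divring_closed S : {pred E} := S.
Variable S_divring : divring_closed S.
HB.instance Definition _ :=
  GRing.isDivringClosed.Build E (divring_pred S_divring) S_divring.

Record subfield := Subfield {subfield_val : E; _ : subfield_val \in divring_pred S_divring}.
HB.instance Definition _ := [isSub for subfield_val].
HB.instance Definition _ := [Choice of subfield by <:].
HB.instance Definition _ := [SubChoice_isSubIntegralDomain of subfield by <:].
HB.instance Definition _ := [SubIntegralDomain_isSubField of subfield by <:].
HB.instance Definition _ := GRing.RMorphism.copy subfield_val (val : subfield -> E).

End Subfield.

Section GaloisFixed.
Variables (L E : fieldType) (j : {rmorphism L -> E}).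
Hypothesis sepE : separable_closure j.
Local Open Scope classical_set_scope.
Implicit Types G H : set (E * E).

(* [G] is the graph of a ring morphism over [L] from a subring of [E] to [E]. *)
Definition partial_aut G :=
  [/\ forall a, G (j a, j a), forall x y, G x -> G y -> G (x.1 - y.1, x.2 - y.2),
      forall x y, G x -> G y -> G (x.1 * y.1, x.2 * y.2) & forall y, G (0, y) -> y = 0].

(** The graph of the map from F[w] that sends w to y. It is well defined because a polynomial that
    vanishes at w also vanishes, after transport by [f], at y. *)
Lemma adjoin_partial_aut (F : fieldType) (l : {rmorphism L -> F})
    (i f : {rmorphism F -> E}) (w y : E) :
  (forall a, i (l a) = j a) -> (forall a, f (l a) = j a) ->
  (forall p, root (map_poly i p) w -> root (map_poly f p) y) ->
  partial_aut [set z | exists p, z = ((map_poly i p).[w], (map_poly f p).[y])].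
Proof.
move=> il fl wy; split=> [a|_ _ [p ->] [r ->]|_ _ [p ->] [r ->]|z [p [e ->]]].
- by exists (l a)%:P; rewrite !map_polyC !hornerC /= il fl.
- by exists (p - r); rewrite !rmorphB !hornerD !hornerN.
- by exists (p * r); rewrite !rmorphM !hornerM.
- by apply/rootP/wy/rootP.
Qed.

Lemma partial_aut_fun G x y z : partial_aut G -> G (x, y) -> G (x, z) -> y = z.
Proof.
move=> [_ GB _ G0] xy xz; apply/eqP; rewrite -subr_eq0; apply/eqP/G0.
by have := GB _ _ xy xz; rewrite /= subrr.
Qed.

(** Since x is algebraic over L, its inverse is a polynomial in x and lies in the domain, which is
    therefore a field. *)
Lemma partial_aut_inv G x y : partial_aut G -> G (x, y) -> x != 0 -> G (x^-1, y^-1).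
Proof.
move=> pG xy x0; have [GL GB GM G0] := pG.
have GD u v : G u -> G v -> G (u.1 + v.1, u.2 + v.2).
  move=> Gu Gv; have /= := GB _ _ Gu (GB _ _ (GL 0) Gv).
  by rewrite rmorph0 !sub0r !opprK.
have Gp (p : {poly L}) : G ((map_poly j p).[x], (map_poly j p).[y]).
  elim/poly_ind: p => [|p c IHp]; first by rewrite !rmorph0 !horner0 -(rmorph0 j).
  rewrite !rmorphD !rmorphM /= !map_polyX !map_polyC !hornerMXaddC.
  exact: GD (GM _ _ IHp xy) (GL c).
have [x' xx'] : exists x', G (x^-1, x').
  have [_ /(_ x) [p [irr _ px]]] := sepE.
  have p0 : p != 0 by apply: irredp_neq0.
  (* Powers of 'X are stripped from [p] so that the remaining factor s 'X + c has c nonzero; then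
     x^-1 = - s(x) / c. *)
  have [m [r /implyP/(_ p0) r0 ep]] := multiplicity_XsubC p 0.
  have rx : root (map_poly j r) x.
    move: px; rewrite ep rmorphM rmorphXn rmorphB /= map_polyX map_polyC /= rmorph0.
    by rewrite subr0 !rootE hornerM hornerXn mulf_eq0 expf_eq0 (negPf x0) andbF orbF.
  have [c [s es]] : exists c s, r = s * 'X + c%:P.
    by elim/poly_ind: (r) => [|s c _]; [exists 0, 0; rewrite mul0r addr0 | exists c, s].
  have c0 : c != 0.
    by move: r0; rewrite rootE es hornerMXaddC mulr0 add0r.
  have jc0 : j c != 0 by rewrite fmorph_eq0.
  exists ((map_poly j s).[y] * j (- c^-1)).
  have -> : x^-1 = (map_poly j s).[x] * j (- c^-1).
    apply: (mulIf x0); rewrite mulVf// mulrAC rmorphN fmorphV mulrN.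
    move: rx; rewrite es rmorphD rmorphM /= map_polyX map_polyC rootE hornerMXaddC.
    by rewrite addr_eq0 => /eqP->; rewrite mulNr opprK divff.
  exact: GM (Gp s) (GL _).
suff -> : y^-1 = x' by [].
have xx1 := GM _ _ xy xx'; rewrite /= divff// in xx1.
have G1 : G (1, 1) by have := GL 1; rewrite rmorph1.
have yx' := partial_aut_fun pG xx1 G1.
have y0 : y != 0 by apply: contra_eq_neq yx' => ->; rewrite mul0r eq_sym oner_neq0.
by apply: (mulfI y0); rewrite yx' divff.
Qed.

Lemma partial_aut_field G : partial_aut G ->
  exists (F : fieldType) (l : {rmorphism L -> F}) (i f : {rmorphism F -> E}),
  [/\ forall a, i (l a) = j a, forall a, f (l a) = j a
    & forall x y, G (x, y) <-> exists c, x = i c /\ y = f c].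
Proof.
move=> pG; have [GL GB GM G0] := pG.
pose S : {pred E} := fun x => `[< exists y, G (x, y) >].
have SP x : reflect (exists y, G (x, y)) (x \in S) by apply: asboolP.
have SD : divring_closed S.
  split=> [|x y /SP[x' xx'] /SP[y' yy']|x y /SP[x' xx'] /SP[y' yy']]; apply/SP.
  - by exists (j 1); have := GL 1; rewrite {1}rmorph1.
  - by exists (x' - y'); apply: (GB _ _ xx' yy').
  - have [->|y0] := eqVneq y 0.
      by rewrite invr0 mulr0 -(rmorph0 j); exists (j 0).
    by exists (x' / y'); apply: GM _ _ xx' (partial_aut_inv pG yy' y0).
have /choice[g hg] : forall x, exists y, x \in S -> G (x, y).
  by move=> x; have [/SP[y xy]|] := boolP (x \in S); [exists y | exists 0].
pose F : fieldType := subfield SD.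
pose i : {rmorphism F -> E} := @subfield_val E S SD.
have iS (c : F) : i c \in S by case: c.
have ig c : G (i c, g (i c)) by apply: hg.
pose f0 (c : F) := g (i c).
have f_zmod : zmod_morphism f0.
  move=> c d; apply: (partial_aut_fun pG (ig _)).
  by rewrite rmorphB; apply: (GB _ _ (ig c) (ig d)).
have f_mon : monoid_morphism f0.
  split=> [|c d]; apply: (partial_aut_fun pG (ig _)).
    by rewrite rmorph1; have := GL 1; rewrite rmorph1.
  by rewrite rmorphM; apply: (GM _ _ (ig c) (ig d)).
pose f : {rmorphism F -> E} := HB.pack f0
  (GRing.isZmodMorphism.Build _ _ f0 f_zmod) (GRing.isMonoidMorphism.Build _ _ f0 f_mon).
have jS a : j a \in S by apply/SP; exists (j a).
pose l0 a : F := Subfield (jS a : j a \in divring_pred SD).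
have l_zmod : zmod_morphism l0.
  by move=> a b; apply: (fmorph_inj i); rewrite rmorphB /= rmorphB.
have l_mon : monoid_morphism l0.
  split=> [|a b]; apply: (fmorph_inj i); first by rewrite rmorph1 /= rmorph1.
  by rewrite rmorphM /= rmorphM.
pose l : {rmorphism L -> F} := HB.pack l0
  (GRing.isZmodMorphism.Build _ _ l0 l_zmod) (GRing.isMonoidMorphism.Build _ _ l0 l_mon).
exists F, l, i, f; split=> // [a|x y].
  exact: (partial_aut_fun pG (ig (l a)) (GL a)).
split=> [xy|[c [-> ->]]]; last exact: ig.
have xS : x \in S by apply/SP; exists y.
exists (Subfield (xS : x \in divring_pred SD)); split=> //.
exact: (partial_aut_fun pG xy (hg x xS)).
Qed.

(** The minimal polynomial of w over the domain divides one over L that is separable, so its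
    transport by [f] is separable and has a root in E; sending w to that root extends the graph. *)
Lemma partial_aut_total G : partial_aut G ->
  (forall H, partial_aut H -> G `<=` H -> H `<=` G) -> forall w, exists y, G (w, y).
Proof.
move=> pG maxG w; have [F [l [i [f [il fl Gif]]]]] := partial_aut_field pG.
have [Esep /(_ w) [p [irr sp pw]]] := sepE.
have p0 : p != 0 by apply: irredp_neq0.
have ilp (r : {poly L}) : map_poly i (map_poly l r) = map_poly j r.
  by rewrite -map_poly_comp; apply: eq_map_poly.
have flp (r : {poly L}) : map_poly f (map_poly l r) = map_poly j r.
  by rewrite -map_poly_comp; apply: eq_map_poly.
pose P n := `[< exists r : {poly F}, [/\ r != 0, root (map_poly i r) w & size r = n] >].
have exP : exists n, P n.
  exists (size (map_poly l p)); apply/asboolP; exists (map_poly l p).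
  by rewrite map_poly_eq0 ilp.
case: (ex_minnP exP) => n /asboolP[mu [mu0 muw smu]] nmin.
have mu_dvd r : root (map_poly i r) w -> mu %| r.
  move=> rw; rewrite /dvdp; apply/negPn/negP => r0.
  have : (n <= size (r %% mu)%R)%N.
    apply: nmin; apply/asboolP; exists (r %% mu); split=> //.
    move: rw; rewrite {1}(divp_eq r mu) rmorphD rmorphM !rootE hornerD hornerM.
    by rewrite (rootP muw) mulr0 add0r.
  by rewrite leqNgt -smu ltn_modp mu0.
have [||y muy] := Esep (map_poly f mu).
- have : map_poly f mu %| map_poly j p by rewrite -flp dvdp_map mu_dvd ?ilp.
  by move/dvdp_separable; apply; rewrite separable_map.
- rewrite size_map_poly -(size_map_poly i).
  by apply: root_size_gt1 muw; rewrite map_poly_eq0.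
have pH := @adjoin_partial_aut F l i f w y il fl.
exists y; apply: (maxG _ (pH _)).
- by move=> r /mu_dvd /dvdpP[s ->]; rewrite rmorphM rootM muy orbT.
- move=> [a b] /Gif[c [-> ->]]; exists c%:P.
  by rewrite !map_polyC !hornerC.
- by exists 'X; rewrite !map_polyX !hornerX.
Qed.

Lemma maximal_partial_aut G : partial_aut G ->
  exists M, [/\ partial_aut M, G `<=` M &
    forall H, partial_aut H -> M `<=` H -> H `<=` M].
Proof.
(* Taking the union with [G] lets the empty chain satisfy the condition and keeps [G] inside the
   maximal element. *)
move=> pG; have [|A [pA Amax]] := @Zorn_bigcup (E * E) (fun H => partial_aut (G `|` H)).
  move=> C Cp totC; set U := \bigcup_(X in C) X.
  have two x y : (G `|` U) x -> (G `|` U) y ->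
      exists H, [/\ partial_aut H, H x, H y & H `<=` G `|` U].
    have GX X : C X -> G `|` X `<=` G `|` U.
      by move=> CX; apply: setUS; apply: bigcup_sup.
    move=> [Gx|[X CX Xx]] [Gy|[Y CY Yy]].
    - by exists G; split=> //; apply: subsetUl.
    - by exists (G `|` Y); split; [exact: Cp | left | right | exact: GX].
    - by exists (G `|` X); split; [exact: Cp | right | left | exact: GX].
    - have [XY|YX] := totC _ _ CX CY.
        by exists (G `|` Y); split; [exact: Cp | right; exact: XY | right | exact: GX].
      by exists (G `|` X); split; [exact: Cp | right | right; exact: YX | exact: GX].
  split=> [a|x y Ux Uy|x y Ux Uy|y Uy].
  - by left; case: pG.
  - by have [H [[_ HB _ _] Hx Hy HU]] := two _ _ Ux Uy; apply/HU/HB.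
  - by have [H [[_ _ HM _] Hx Hy HU]] := two _ _ Ux Uy; apply/HU/HM.
  - by have [H [[_ _ _ H0] Hx _ _]] := two _ _ Uy Uy; apply: H0.
exists (G `|` A); split; [exact: pA | exact: subsetUl |].
move=> H pH MH x Hx; apply: contrapT => nMx.
apply: (Amax H); last by rewrite setUidr//; apply: subset_trans MH; apply: subsetUl.
split; last by move=> HA; apply: nMx; right; apply: HA.
by apply: subset_trans MH; apply: subsetUr.
Qed.

Lemma partial_aut_extend (G : set (E * E)) x y : partial_aut G -> G (x, y) ->
  exists g : galois_aut j, g x = y.
Proof.
move=> /maximal_partial_aut[M [pM GM Mmax]] xy.
have /choice[g hg] := partial_aut_total pM Mmax.
have [ML MB MM M0] := pM.
have gE u v : M (u, v) -> g u = v by apply: partial_aut_fun (hg u).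
have g_zmod : zmod_morphism g by move=> u v; apply/gE/(MB _ _ (hg u) (hg v)).
have g_mon : monoid_morphism g.
  split=> [|u v]; apply/gE; last exact: (MM _ _ (hg u) (hg v)).
  by have := ML 1; rewrite rmorph1.
pose gg : {rmorphism E -> E} := HB.pack g
  (GRing.isZmodMorphism.Build _ _ g g_zmod) (GRing.isMonoidMorphism.Build _ _ g g_mon).
have gj a : gg (j a) = j a by apply: gE.
(* The injective map [gg] permutes the finite set of roots of a polynomial over L vanishing at v. *)
have gsurj v : exists u, gg u = v.
  have [_ /(_ v) [p [irr _ pv]]] := sepE.
  have jp0 : map_poly j p != 0 by rewrite map_poly_eq0 irredp_neq0.
  pose P n := `[< exists rs : seq E, [/\ all (root (map_poly j p)) rs, uniq rs & size rs = n] >].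
  have exP : exists n, P n by exists 0%N; apply/asboolP; exists [::].
  have leP n : P n -> (n <= size (map_poly j p))%N.
    by move=> /asboolP[rs [ars urs <-]]; apply/ltnW/max_poly_roots.
  case: (ex_maxnP exP leP) => n /asboolP[rs [ars urs srs]] nmax.
  have rsP u : root (map_poly j p) u -> u \in rs.
    move=> pu; apply: contraT => urs'.
    have := nmax n.+1; rewrite ltnn => H; apply: H; apply/asboolP; exists (u :: rs).
    by rewrite /= pu urs' ars urs srs.
  have groot u : root (map_poly j p) u -> root (map_poly j p) (gg u).
    rewrite !rootE => /eqP pu.
    have -> : (map_poly j p).[gg u] = gg (map_poly j p).[u].
      rewrite -horner_map; congr _.[_]; rewrite -map_poly_comp.
      by apply: eq_map_poly => a; apply: esym; exact: gj.
    by rewrite pu rmorph0.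
  have gsub : {subset map gg rs <= rs}.
    by move=> _ /mapP[u urs' ->]; apply/rsP/groot/(allP ars).
  have ugrs : uniq (map gg rs) by rewrite map_inj_uniq//; apply: fmorph_inj.
  have szg : (size rs <= size (map gg rs))%N by rewrite size_map.
  have [_ gi] := uniq_min_size ugrs gsub szg.
  have := rsP v pv; rewrite -gi => /mapP[u _ ->]; by exists u.
have /choice[g' hg'] := gsurj.
have gbij : bijective gg.
  by exists g' => u; rewrite ?hg'//; apply: (fmorph_inj gg); rewrite hg'.
by exists (GaloisAut gbij gj); apply/gE/GM.
Qed.

(** If the irreducible [p] had degree above 1, the cofactor [r] of X - z would have a root z', a
    conjugate to which some automorphism sends z. Then z = z' would be a double root, against
    separability. *)
Theorem galois_fixed z : (forall g : galois_aut j, g z = z) -> exists a, z = j a.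
Proof.
move=> zfix; have [Esep /(_ z) [p [irr sp pz]]] := sepE.
have p0 : p != 0 by apply: irredp_neq0.
have /factor_theorem[r er] := pz.
have sjp : separable_poly (map_poly j p) by rewrite separable_map.
have r0 : r != 0 by apply: contraNneq p0 => r0; rewrite -(map_poly_eq0 j) er r0 mul0r.
have sr : size p = (size r).+1.
  by rewrite -(size_map_poly j) er size_Mmonic ?monicXsubC// size_XsubC addn2.
have [s1|s1] := leqP (size r) 1.
  have e : p = p`_1 *: 'X + (p`_0)%:P.
    apply/polyP => n; rewrite coefD coefZ coefX coefC.
    case: n => [|[|n]] /=; rewrite ?mulr0 ?mulr1 ?add0r ?addr0//.
    by rewrite nth_default// sr; apply: leq_trans s1 _.
  have p10 : p`_1 != 0.
    have : lead_coef p != 0 by rewrite lead_coef_eq0.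
    by rewrite lead_coefE sr /=; move: s1 r0; rewrite -size_poly_gt0; case: (size r) => [|[]].
  have jz : j p`_1 * z = - j p`_0.
    apply/eqP; rewrite -addr_eq0; move: pz.
    by rewrite {1}e rmorphD /= map_polyZ map_polyX map_polyC rootE !hornerE.
  exists (- p`_0 / p`_1); rewrite fmorph_div rmorphN -jz mulrAC divff ?mul1r//.
  by rewrite fmorph_eq0.
have [||z' rz'] := Esep r; first by apply: dvdp_separable sjp; rewrite er dvdp_mulr.
  exact: s1.
have zz' a : root (map_poly j a) z -> root (map_poly j a) z'.
  move=> az; have [/dvdpP[b ->]|npa] := boolP (p %| a).
    by rewrite rmorphM /= rootM er [root (r * _) _]rootM rz' orbT.
  have : coprimep (map_poly j p) (map_poly j a).
    by rewrite coprimep_map irreducible_poly_coprime.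
  by move=> /coprimep_root/(_ pz); rewrite (rootP az) eqxx.
have pG := @adjoin_partial_aut L idfun j j z z' (fun=> erefl) (fun=> erefl) zz'.
have [|g gz] := @partial_aut_extend _ z z' pG.
  by exists 'X; rewrite !map_polyX !hornerX.
move: rz'; rewrite -gz zfix => rz.
move: sjp; rewrite er separable_mul => /and3P[_ _ /coprimep_root/(_ rz)].
by rewrite hornerXsubC subrr eqxx.
Qed.

End GaloisFixed.

(** * Order in 1/t and integral models *)

Section LaurentOrder.
Variable K : fieldType.
Implicit Types x y : laurent K.

Let order_ex x : exists b : int, x != 0 -> vanish b (lcoef x) /\ lcoef x b != 0.
Proof.
have [->|x0] := eqVneq x 0; first by exists 0.
by have [a xa] := lcoefP x; have [b xb xb0] := vanish_first xa x0; exists b.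
Qed.

Definition lval x : int := projT1 (cid (order_ex x)).

Lemma lvalP x : x != 0 -> vanish (lval x) (lcoef x) /\ lcoef x (lval x) != 0.
Proof. exact: (projT2 (cid (order_ex x))). Qed.

Lemma lval_eq x (b : int) : vanish b (lcoef x) -> lcoef x b != 0 -> lval x = b.
Proof.
move=> xb xb0; have x0 : x != 0 by apply: contraNneq xb0 => ->.
have [xl xl0] := lvalP x0; apply/eqP; rewrite eq_le !leNgt; apply/andP; split.
  by apply/negP => /xl /eqP; apply/negP.
by apply/negP => /xb /eqP; apply/negP.
Qed.

Lemma vge_lvalP (n : int) x : reflect (vanish n (lcoef x)) (vge (@lval) n x).
Proof.
apply: (iffP (vgeP _ _ _)) => [nx i i_n|xn x0].
  have [->//|x0] := eqVneq x 0; have [xl _] := lvalP x0.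
  by apply: xl; apply: lt_le_trans i_n (nx x0).
by have [_ xl0] := lvalP x0; rewrite leNgt; apply: contra xl0 => /xn->.
Qed.

Lemma lvalM x y : x != 0 -> y != 0 -> lval (x * y) = lval x + lval y.
Proof.
move=> /lvalP[xa xa0] /lvalP[yb yb0]; apply: lval_eq; first exact: conv_lt.
rewrite -[lval x + lval y]addr0 /= (conv_nat xa yb (ltnSn 0)) coefM big_ord1.
by rewrite !coef_trunc// !addr0 mulf_neq0.
Qed.

Lemma lvalD x y (n : int) : x != 0 -> y != 0 -> x + y != 0 ->
  n <= lval x -> n <= lval y -> n <= lval (x + y).
Proof.
move=> x0 y0 xy0 nx ny; have /vgeP : vge (@lval) n (x + y); last exact.
apply/vge_lvalP => i i_n /=.
have /vge_lvalP-> // : vge (@lval) n x by apply/vgeP.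
have /vge_lvalP-> // : vge (@lval) n y by apply/vgeP.
exact: addr0.
Qed.

Lemma vge_prod I (r : seq I) (F : I -> laurent K) :
  (forall i, vge (@lval) 0 (F i)) -> vge (@lval) 0 (\prod_(i <- r) F i).
Proof.
move=> F0; apply: (big_ind (fun x => vge (@lval) 0 x)) => //.
  by apply/vge_lvalP => i i0 /=; case: eqP => // e; rewrite e ltxx in i0.
by move=> x y x0 y0; rewrite -[0]addr0; apply: vgeM => //; apply: lvalM.
Qed.

Lemma vge_det n (U : 'M[laurent K]_n) :
  (forall i l, vge (@lval) 0 (U i l)) -> vge (@lval) 0 (\det U).
Proof.
move=> U0; apply: vge_sum => [|s _]; first exact: lvalD.
rewrite -signr_odd; case: (odd _); rewrite ?expr0 ?expr1 ?mulN1r ?mul1r.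
  by rewrite (vgeN lvalM); apply: vge_prod.
exact: vge_prod.
Qed.

Lemma lval_laurent_t : lval (laurent_t K) = -1.
Proof.
by apply: lval_eq => [i i1|] /=; [case: eqP i1 => // ->; rewrite ltxx | exact: oner_neq0].
Qed.

End LaurentOrder.

Lemma lval_lmap (K K' : fieldType) (f : {rmorphism K -> K'}) (x : laurent K) :
  x != 0 -> lval (lmap f x) = lval x.
Proof.
move=> /lvalP[xa xa0]; apply: lval_eq; last by rewrite /= fmorph_eq0.
by move=> i /xa /= ->; rewrite rmorph0.
Qed.

Lemma vge_lmap (K K' : fieldType) (f : {rmorphism K -> K'}) (n : int) (x : laurent K) :
  vge (@lval K') n (lmap f x) = vge (@lval K) n x.
Proof.
by apply/vge_lvalP/vge_lvalP => xn i /xn /= => [/eqP|->]; rewrite ?fmorph_eq0 ?rmorph0// => /eqP.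
Qed.

(** Cramer's rule without division: \det U * a is \adj U * V, whose entries are expansions along the
    replaced column. *)
Lemma cramer_col (R : comNzRingType) n (U V a : 'M[R]_n) i l : V = U *m a ->
  \det (\matrix_(k, m) if m == i then V k l else U k m) = \det U * a i l.
Proof.
move=> VU; have -> : \det U * a i l = (\adj U *m V) i l.
  by rewrite VU mulmxA mul_adj_mx mul_scalar_mx mxE.
rewrite (expand_det_col _ i) mxE; apply: eq_bigr => k _; rewrite !mxE eqxx mulrC.
congr (_ * _); rewrite /cofactor; congr (_ * \det _); apply/matrixP => r s.
by rewrite !mxE eq_sym (negPf (neq_lift _ _)).
Qed.

Section RationalIntegral.
Variable L : fieldType.

Lemma laurent_tE : rat_laurent (tofrac 'X) = laurent_t L.
Proof. by rewrite rat_laurent_tofrac /poly_laurent map_polyX hornerX. Qed.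

Lemma laurent_st : laurent_s L * laurent_t L = 1.
Proof.
by apply: laurentP => i; rewrite (lcoef_monoM 1 1) mul1r /= subr_eq addNr.
Qed.

Lemma sM_poly_laurent (D : nat) (p : {poly L}) (r : {poly L}) :
  (forall n, r`_n = if (n <= D)%N then p`_(D - n) else 0) ->
  (size p <= D.+1)%N -> laurent_s L ^+ D * poly_laurent p = spoly r.
Proof.
move=> hr sp; have -> : poly_laurent p = \sum_(j < D.+1) lconst p`_j * laurent_t L ^+ j.
  rewrite /poly_laurent (horner_coef_wide (n := D.+1)); last by rewrite size_map_poly.
  by apply: eq_bigr => j _; rewrite coef_map.
have sr : (size r <= D.+1)%N by apply/leq_sizeP => n nD; rewrite hr leqNgt nD.
rewrite /spoly (horner_coef_wide (n := D.+1)) ?size_map_poly// mulr_sumr.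
rewrite (reindex_inj rev_ord_inj) /=; apply: eq_bigr => j _.
rewrite coef_map /= hr -ltnS ltn_ord subSS mulrCA; congr (_ * _).
have jD : (j <= D)%N by rewrite -ltnS.
by rewrite -{1}(subnKC jD) exprD -mulrA -exprMn laurent_st expr1n mulr1.
Qed.

(** Reversing the coefficients of the denominator turns it into a polynomial in s with constant term
    its leading coefficient, which can be normalised to 1. *)
Lemma integral_rat_laurent (r : ratfun L) : vge (@lval L) 0 (rat_laurent r) ->
  exists d p : {poly L}, d`_0 = 1 /\ spoly d * rat_laurent r = spoly p.
Proof.
move=> /vge_lvalP r_int; rewrite (fraction_repr r) in r_int *.
move: (denom_ratioP (repr r)) r_int.
move: (\n_(repr r)) (\d_(repr r)) => f g g0; rewrite rat_laurent_div => r_int.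
set R := _ / _ in r_int *.
have pg0 : poly_laurent g != 0 by rewrite raddf_eq0//; apply: poly_laurent_inj.
pose D := (size g).-1; pose M := maxn (size f) D.
have sg : size g = D.+1 by rewrite prednK// size_poly_gt0.
pose gr : {poly L} := \poly_(n < D.+1) g`_(D - n).
pose fr : {poly L} := \poly_(n < M.+1) f`_(M - n).
have grE : laurent_s L ^+ D * poly_laurent g = spoly gr.
  by apply: sM_poly_laurent => [n|]; rewrite ?coef_poly ?ltnS ?sg.
have frE : laurent_s L ^+ M * poly_laurent f = spoly fr.
  apply: sM_poly_laurent => [n|]; first by rewrite coef_poly ltnS.
  by rewrite leqW ?leq_maxl.
have gr0 : gr`_0 = lead_coef g by rewrite coef_poly subn0.
have lg0 : lead_coef g != 0 by rewrite lead_coef_eq0.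
(* [Z] has no negative powers of s, and s^(M - D) Z is a polynomial, so Z is a polynomial as well:
   that of [fr] with its coefficients shifted. *)
pose Z := spoly gr * R.
have frZ : laurent_s L ^+ (M - D) * Z = spoly fr.
  rewrite -frE /Z -grE /R mulrA mulrA -exprD subnK ?leq_maxr//.
  by rewrite -mulrA [poly_laurent g * _]mulrC divfK.
have Z_int : vanish 0 (lcoef Z).
  by rewrite -[0]addr0; apply: conv_lt => //; apply: spoly_vanish.
pose fz : {poly L} := \poly_(n < M.+1) fr`_(n + (M - D)).
have Zfz : Z = spoly fz.
  apply: laurentP => -[n|n]; last by rewrite Z_int// spoly_vanish.
  rewrite lcoef_spoly coef_poly.
  have -> : lcoef Z n = fr`_(n + (M - D)).
    by rewrite -lcoef_spoly -frZ lcoef_sXM PoszD addrK.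
  by case: ltnP => // Mn; rewrite coef_poly ltnNge (leq_trans Mn (leq_addr _ _)).
exists ((lead_coef g)^-1 *: gr), ((lead_coef g)^-1 *: fz); split.
  by rewrite coefZ gr0 mulVf.
by rewrite -!mul_polyC !rmorphM -mulrA -[spoly gr * R]/Z Zfz.
Qed.

Lemma integral_common_denominator (I : finType) (r : I -> ratfun L) :
  (forall i, vge (@lval L) 0 (rat_laurent (r i))) ->
  exists (d : {poly L}) (p : I -> {poly L}), d`_0 = 1 /\
    forall i, spoly d * rat_laurent (r i) = spoly (p i).
Proof.
move=> r_int.
have /choice[d hd] : forall i, exists d : {poly L}, exists p : {poly L},
    d`_0 = 1 /\ spoly d * rat_laurent (r i) = spoly p.
  by move=> i; apply: integral_rat_laurent.
have /choice[p hp] := hd.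
exists (\prod_i d i), (fun i => p i * \prod_(l | l != i) d l); split=> [|i].
  rewrite -horner_coef0 horner_prod big1// => i _.
  by rewrite horner_coef0; case: (hp i).
by rewrite (bigD1 i)//= !rmorphM mulrAC; case: (hp i) => _ ->.
Qed.

End RationalIntegral.

Section IntegralModel.
Variables (k : finFieldType) (L : fieldType) (iota : {rmorphism k -> L}).
Variables (K : fieldType) (j : {rmorphism L -> K}).
Local Notation rho := (rat_to_laurent j).
Local Notation sigK := (sigma_laurent (j \o iota)).
Local Notation sigL := (sigma_laurent iota).
Local Notation sigR := (sigma_rat iota).
Local Notation int0 x := (vge (@lval _) 0 x).
Variables (n : nat) (A : 'M[ratfun L]_n) (C : 'M[laurent K]_n).
Hypothesis C_unit : C \in unitmx.
Hypothesis C_fixed : map_mx rho A *m map_mx sigK C = C.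

Let lattice_basis (G : 'M[ratfun L]_n) (U : 'M[laurent K]_n) :=
  [/\ map_mx rho G = C *m U, forall i l, int0 (U i l) & \det U != 0].

Let lattice_ex : exists G U, lattice_basis G U.
Proof.
(* Large enough for t^(-m) C^-1 to be integral, so that the scalar matrix t^(-m) serves as first
   basis. *)
pose m := (\sum_i \sum_l `|lval (invmx C i l)|)%N.
have t0 : laurent_t K != 0.
  by apply/eqP => t0; have := laurent_st K; rewrite t0 mulr0 => /eqP; rewrite eq_sym oner_eq0.
pose u := (laurent_t K)^-1.
have u0 : u != 0 by rewrite invr_eq0.
have lu : lval u = 1.
  have := lvalM t0 u0; rewrite divff// lval_laurent_t.
  by rewrite (v1 (@lvalM K)); lia.
exists ((tofrac 'X)^-1 ^+ m)%:M, (u ^+ m *: invmx C); split.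
- rewrite -scalemxAr mulmxV// -scalemx1 map_mxZ map_mx1; congr (_ *: _).
  rewrite rmorphXn fmorphV; congr (_^-1 ^+ _).
  rewrite /= laurent_tE; apply: laurentP => i /=.
  by case: eqP; rewrite ?rmorph0 ?rmorph1.
- move=> i l; rewrite mxE; apply/vgeP; rewrite mulf_eq0 negb_or => /andP[um0 C0].
  rewrite lvalM// (vX (@lvalM K))// lu mulr1.
  suff : (`|lval (invmx C i l)| <= m)%N by lia.
  rewrite /m (bigD1 i)//= (bigD1 l)//= -addnA; exact: leq_addr.
- rewrite detZ mulf_neq0 ?expf_neq0//.
  by rewrite -unitfE -unitmxE unitmx_inv.
Qed.

(* Among the bases [G] of rational lattices contained in C K[[1/t]]^n, one for
   which the order of \det (C^-1 G) is minimal spans a tau-stable lattice: by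
   Cramer's rule, replacing a column of [G] by the image of a basis vector would
   otherwise lower the order. *)
Lemma stable_lattice : exists G : 'M[ratfun L]_n, [/\ G \in unitmx,
  forall i l, int0 (rho ((invmx G *m A *m map_mx sigR G) i l)) &
  forall i l, int0 (rho (invmx (invmx G *m A *m map_mx sigR G) i l))].
Proof.
have det_int G U : lattice_basis G U -> exists N : nat, lval (\det U) = N%:Z.
  move=> [_ U_int detU]; have /vgeP/(_ detU) := vge_det U_int.
  by case: (lval _) => // N _; exists N.
pose P N := `[< exists G U, lattice_basis G U /\ lval (\det U) = N%:Z >].
have exP : exists N, P N.
  have [G [U GU]] := lattice_ex; have [N e] := det_int _ _ GU.
  by exists N; apply/asboolP; exists G, U.
case: (ex_minnP exP) => N /asboolP[G [U [[GU U_int detU] UN]]] Nmin.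
have C0 : \det C != 0 by rewrite -unitfE -unitmxE.
have G_unit : G \in unitmx.
  by rewrite -(map_unitmx rho) GU unitmxE unitfE det_mulmx mulf_neq0.
pose Y := A *m map_mx sigR G; pose A' := invmx G *m A *m map_mx sigR G.
have YA : Y = G *m A' by rewrite /Y /A' !mulmxA mulmxV// mul1mx.
have sU : map_mx rho Y = C *m map_mx sigK U.
  rewrite map_mxM -map_mx_comp.
  have -> : map_mx (rho \o sigR) G = map_mx sigK (map_mx rho G).
    by rewrite -map_mx_comp; apply: eq_map_mx => r; apply: esym; apply: sigma_rat_to_laurent.
  by rewrite GU map_mxM mulmxA C_fixed.
have UA : map_mx sigK U = U *m map_mx rho A'.
  apply: (can_inj (mulKmx C_unit)); rewrite -sU YA map_mxM GU mulmxA //.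
have sU_int i l : int0 (map_mx sigK U i l) by rewrite mxE vge_lmap.
have A'_int i l : int0 (rho (A' i l)).
  pose a := map_mx rho A'; have aE : rho (A' i l) = a i l by rewrite [RHS]mxE.
  rewrite aE; apply/vgeP => a0; rewrite leNgt; apply/negP => low.
  pose G2 := \matrix_(r, m) if m == i then Y r l else G r m.
  pose U2 := \matrix_(r, m) if m == i then map_mx sigK U r l else U r m.
  have detU2 : \det U2 = \det U * a i l by exact: (@cramer_col _ n U _ a i l UA).
  have GU2 : lattice_basis G2 U2.
    split; last by rewrite detU2 mulf_neq0.
      apply/matrixP => r m; rewrite !mxE; case: ifP => mi.
        have /matrixP/(_ r l) := sU; rewrite !mxE => ->.
        by apply: eq_bigr => t _; rewrite !mxE mi.
      have /matrixP/(_ r m) := GU; rewrite !mxE => ->.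
      by apply: eq_bigr => t _; rewrite !mxE mi.
    by move=> r m; rewrite mxE; case: ifP.
  have [N2 e2] := det_int _ _ GU2.
  have : (N <= N2)%N by apply: Nmin; apply/asboolP; exists G2, U2.
  by move: e2; rewrite detU2 lvalM// UN; lia.
(* In sigma(U) = U A' Frobenius preserves the order of the determinant, so \det A' has order 0 and
   the inverse of A' is integral too. *)
have detA' : lval (\det (map_mx rho A')) = 0 /\ \det (map_mx rho A') != 0.
  have := congr1 determinant UA; rewrite det_mulmx det_map_mx => e.
  have a0 : \det (map_mx rho A') != 0.
    apply: contraNneq detU => a0; move/eqP: e; rewrite a0 mulr0.
    by rewrite fmorph_eq0.
  split=> //; have := congr1 (@lval K) e; rewrite lvalM// lval_lmap//.
  by rewrite -[X in X = _]addr0 => /addrI.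
have A'_unit : A' \in unitmx by rewrite -(map_unitmx rho) unitmxE unitfE; case: detA'.
exists G; split=> [|i l|i l]; [exact: G_unit | exact: A'_int |].
rewrite -/A'.
have -> : rho (invmx A' i l) = invmx (map_mx rho A') i l by rewrite -map_invmx [RHS]mxE.
rewrite /invmx map_unitmx A'_unit mxE.
have [la a0] := detA'; rewrite -[0]addr0; apply: vgeM; first exact: lvalM.
  apply/vgeP => _; have := lvalM a0 (_ : (\det (map_mx rho A'))^-1 != 0).
  by rewrite invr_eq0 a0 divff// (v1 (@lvalM K)) la add0r => /(_ isT) <-.
rewrite mxE /cofactor; set s := (-1) ^+ _.
have -> : s = (-1) ^+ odd (l + i) by rewrite signr_odd.
have m_int : int0 (\det (row' l (col' i (map_mx rho A')))).
  by apply: vge_det => r m; rewrite 3!mxE; apply: A'_int.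
by case: odd; rewrite ?expr0 ?expr1 ?mulN1r ?mul1r ?(vgeN (@lvalM K)).
Qed.

(** In the basis [G] the fixed equation reads sigma(x') = A'^-1 x'. Integrality of A'^-1 allows its
    denominators to be cleared by a [d] with constant term 1. *)
Theorem integral_model : exists (G : 'M[ratfun L]_n) (d : {poly L})
    (P : 'I_n -> 'I_n -> {poly L}), [/\ G \in unitmx, d`_0 = 1 &
  forall x : 'cV[laurent L]_n,
    map_mx (@rat_laurent L) A *m map_mx sigL x = x ->
    forall i, let x' := map_mx (@rat_laurent L) (invmx G) *m x in
    spoly d * sigL (x' i 0) = \sum_l spoly (P i l) * x' l 0].
Proof.
have [G [G_unit A'_int B_int]] := stable_lattice.
set A' := invmx G *m A *m map_mx sigR G in A'_int B_int.
have sG_unit : map_mx sigR G \in unitmx by rewrite map_unitmx.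
have A_unit : A \in unitmx.
  rewrite -(map_unitmx rho); have := C_unit; rewrite -{1}C_fixed.
  by rewrite unitmx_mul => /andP[].
have A'_unit : A' \in unitmx by rewrite !unitmx_mul unitmx_inv G_unit A_unit sG_unit.
have B_int' (il : 'I_n * 'I_n) : int0 (rat_laurent (invmx A' il.1 il.2)).
  by have := B_int il.1 il.2; rewrite vge_lmap.
have [d [p [d0 hp]]] := integral_common_denominator B_int'.
exists G, d, (fun i l => p (i, l)).
split; [exact: G_unit | exact: d0 | move=> x xA i x'].
have s_rat (X : 'M[ratfun L]_n) :
    map_mx sigL (map_mx (@rat_laurent L) X) = map_mx (@rat_laurent L) (map_mx sigR X).
  by rewrite -!map_mx_comp; apply: eq_map_mx => r; apply: sigma_rat_laurent.
have e : map_mx sigL x' = map_mx (@rat_laurent L) (invmx A') *m x'.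
  apply: (can_inj (mulKmx (_ : map_mx (@rat_laurent L) A' \in unitmx))).
    by rewrite map_unitmx.
  rewrite [RHS]mulmxA -map_mxM mulmxV// map_mx1 mul1mx.
  have -> : map_mx sigL x' = map_mx (@rat_laurent L) (map_mx sigR (invmx G)) *m map_mx sigL x.
    by rewrite /x' map_mxM s_rat.
  have AG : A' *m map_mx sigR (invmx G) = invmx G *m A.
    by rewrite /A' map_invmx (mulmxK sG_unit).
  by rewrite mulmxA -map_mxM AG map_mxM -mulmxA xA.
have -> : sigL (x' i 0) = \sum_l rat_laurent (invmx A' i l) * x' l 0.
  by have /matrixP/(_ i 0) := e; rewrite !mxE => ->; apply: eq_bigr => l _; rewrite mxE.
rewrite mulr_sumr; apply: eq_bigr => l _.
by rewrite mulrA -(hp (i, l)).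
Qed.

End IntegralModel.

(** * Bases, coordinates and linear relations *)

Section Bases.

Definition is_basis (R : comNzRingType) (M : lmodType R) n (e : 'I_n -> M)
    (co : M -> 'rV[R]_n) : Prop :=
  (forall m, m = \sum_i co m 0 i *: e i) /\
  (forall c : 'rV[R]_n, co (\sum_i c 0 i *: e i) = c).

Lemma free_basis (R : comNzRingType) (M : lmodType R) : free_of_finite_rank M ->
  exists n (e : 'I_n -> M) co, is_basis e co.
Proof.
move=> [n [e he]]; exists n, e.
have /choice[co hco] : forall m, exists c : 'rV[R]_n, m = \sum_i c 0 i *: e i.
  by move=> m; have [c [mc _]] := he m; exists c.
exists co; split=> // c; set m := \sum_i _.
by have [c' [_ c'P]] := he m; rewrite -(c'P c erefl) -(c'P _ (hco m)).
Qed.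

Lemma basis_free (R : comNzRingType) (M : lmodType R) n (e : 'I_n -> M) co :
  is_basis e co -> free_of_finite_rank M.
Proof.
move=> [eP coP]; exists n, e => m; exists (co m); split; first exact: eP.
by move=> c ->; rewrite coP.
Qed.

Lemma free_iso (R : comNzRingType) (M N : lmodType R) (f : {linear M -> N}) :
  bijective f -> free_of_finite_rank M -> free_of_finite_rank N.
Proof.
move=> [g fK gK] /free_basis[n [e [co [eP coP]]]].
apply: (@basis_free _ _ n (f \o e) (co \o g)); split=> [m|c] /=.
  rewrite -[LHS]gK {1}(eP (g m)) linear_sum; apply: eq_bigr => i _.
  by rewrite linearZ.
rewrite -[RHS]coP; congr co; apply: (can_inj fK); rewrite gK linear_sum.
by apply: eq_bigr => i _; rewrite linearZ.
Qed.

Section Coordinates.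
Variables (R : comNzRingType) (M : lmodType R) (n : nat) (e : 'I_n -> M).
Variable co : M -> 'rV[R]_n.
Hypothesis e_basis : is_basis e co.

Lemma coD x y : co (x + y) = co x + co y.
Proof.
have [eP coP] := e_basis; rewrite {1}(eP x) {1}(eP y) -big_split -[RHS]coP; congr co.
by apply: eq_bigr => i _; rewrite mxE scalerDl.
Qed.

Lemma coZ a x : co (a *: x) = a *: co x.
Proof.
have [eP coP] := e_basis; rewrite {1}(eP x) scaler_sumr -[RHS]coP; congr co.
by apply: eq_bigr => i _; rewrite mxE scalerA.
Qed.

Lemma co0 : co 0 = 0.
Proof. by rewrite -(scale0r 0) coZ scale0r. Qed.

Lemma co_sum I (r : seq I) (F : I -> M) : co (\sum_(i <- r) F i) = \sum_(i <- r) co (F i).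
Proof. by elim: r => [|i r IHr]; rewrite ?big_nil ?co0// !big_cons coD IHr. Qed.

Lemma co_inj : injective co.
Proof. by move=> x y xy; have [eP _] := e_basis; rewrite (eP x) xy -eP. Qed.

Variables (R' : comNzRingType) (phi : {rmorphism R -> R'}).

Lemma tens_sumr (a : R') I (r : seq I) (F : I -> M) :
  tens phi a (\sum_(i <- r) F i) = \sum_(i <- r) tens phi a (F i).
Proof.
elim: r => [|i r IHr]; last by rewrite !big_cons tensDr IHr.
by rewrite !big_nil -(scale0r (0 : M)) -tens_balanced rmorph0 mulr0 tens0l.
Qed.

Lemma tens1 a (m : M) : tens phi a m = a *: tens phi 1 m.
Proof. by rewrite scale_tens mulr1. Qed.

Definition tensor_co (x : tensor phi M) : 'rV[R']_n :=
  tensor_lift (fun a m => a *: map_mx phi (co m)) x.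

Lemma tensor_co_tens a m : tensor_co (tens phi a m) = a *: map_mx phi (co m).
Proof.
apply: tensor_lift_tens => [b c y|b y z|b r y].
- by rewrite scalerDl.
- by rewrite coD map_mxD scalerDr.
- by rewrite coZ map_mxZ scalerA.
Qed.

Lemma tensor_coD x y : tensor_co (x + y) = tensor_co x + tensor_co y.
Proof.
apply: tensor_liftD => [b c z|b z w|b r z].
- by rewrite scalerDl.
- by rewrite coD map_mxD scalerDr.
- by rewrite coZ map_mxZ scalerA.
Qed.

Lemma tensor_basis : is_basis (fun i => tens phi 1 (e i)) tensor_co.
Proof.
have [eP coP] := e_basis; split=> [x|c].
  elim/tensor_ind: x => [|x y IHx IHy|a m].
  - rewrite big1// => i _; have -> : tensor_co 0 = 0.
      by apply: (addrI (tensor_co 0)); rewrite -tensor_coD !addr0.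
    by rewrite mxE scale0r.
  - rewrite {1}IHx {1}IHy -big_split; apply: eq_bigr => i _.
    by rewrite tensor_coD mxE scalerDl.
  - rewrite {1}(eP m) tens_sumr tensor_co_tens; apply: eq_bigr => i _.
    by rewrite -tens_balanced tens1 !mxE.
have -> : tensor_co (\sum_i c 0 i *: tens phi 1 (e i)) =
    \sum_i c 0 i *: map_mx phi (co (e i)).
  rewrite -(big_map (fun i => c 0 i *: tens phi 1 (e i)) xpredT id) /=.
  have -> (s : seq 'I_n) : tensor_co (\sum_(j <- [seq c 0 i *: tens phi 1 (e i) | i <- s]) j) =
      \sum_(i <- s) c 0 i *: map_mx phi (co (e i)).
    elim: s => [|i s IHs] /=.
      by rewrite !big_nil; apply: (addrI (tensor_co 0)); rewrite -tensor_coD !addr0.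
    by rewrite !big_cons tensor_coD IHs scale_tens mulr1 tensor_co_tens.
  by [].
have coe i : co (e i) = delta_mx 0 i.
  rewrite -[RHS]coP; congr co; rewrite (bigD1 i)//= mxE !eqxx scale1r big1 ?addr0//.
  by move=> l li; rewrite mxE (negPf li) andbF scale0r.
rewrite [RHS](matrix_sum_delta c) big_ord1; apply: eq_bigr => i _.
by rewrite coe map_delta_mx.
Qed.

End Coordinates.

Section BaseChangeCoordinates.
Variables (R R' : comNzRingType).
Variables (sigma : {rmorphism R -> R}) (sigma' : {rmorphism R' -> R'}).
Variables (phi : {rmorphism R -> R'}).
Hypothesis phi_sigma : forall r, sigma' (phi r) = phi (sigma r).
Variable M : tauModule sigma.
Variables (n : nat) (e : 'I_n -> M) (co : M -> 'rV[R]_n).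
Hypothesis e_basis : is_basis e co.

Definition tau_mx : 'M[R]_n := \matrix_(l, i) co (tau M (e i)) 0 l.

Lemma base_change_co (x : base_change phi_sigma M) :
  (tensor_co co (tau (base_change phi_sigma M) x))^T =
  map_mx phi tau_mx *m map_mx sigma' (tensor_co co x)^T.
Proof.
elim/tensor_ind: x => [|x y IHx IHy|a m].
- have co00 : tensor_co co (0 : tensor phi M) = 0 by apply: (co0 (tensor_basis e_basis phi)).
  by rewrite raddf0 co00 trmx0 map_mx0 mulmx0.
- rewrite raddfD /= (tensor_coD e_basis) (tensor_coD e_basis) !linearD /= IHx IHy.
  by rewrite map_mxD mulmxDr.
- rewrite base_change_tens (tensor_co_tens e_basis) (tensor_co_tens e_basis).
  have [eP _] := e_basis.
  rewrite {1}(eP m) linear_sum (co_sum e_basis).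
  apply/colP => l; rewrite !mxE summxE rmorph_sum mulr_sumr; apply: eq_bigr => i _.
  rewrite !mxE linearZ /= (coZ e_basis) mxE rmorphM rmorphM phi_sigma.
  by rewrite mulrA [RHS]mulrC.
Qed.

Lemma base_change_fixed (x : base_change phi_sigma M) :
  tau (base_change phi_sigma M) x = x <->
  map_mx phi tau_mx *m map_mx sigma' (tensor_co co x)^T = (tensor_co co x)^T.
Proof.
rewrite -base_change_co; split=> [->//|/trmx_inj].
exact: (co_inj (tensor_basis e_basis phi)).
Qed.

End BaseChangeCoordinates.

Section LinearRelations.
Variables (R0 R : fieldType) (sigma : {rmorphism R -> R}) (phi : {rmorphism R0 -> R}).
Hypothesis fixedP : forall r, sigma r = r -> exists r0, r = phi r0.
Variables (n : nat) (rel : 'rV[R]_n -> Prop).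
Hypothesis relZ : forall a c, rel c -> rel (a *: c).
Hypothesis relB : forall c d, rel c -> rel d -> rel (c - d).
Hypothesis rel_sigma : forall c, rel c -> rel (map_mx sigma c).

(* Artin's argument: [sigma c - c] is a shorter relation when some entry of [c] is 1. *)
Lemma relation_descent : (forall c : 'rV[R0]_n, rel (map_mx phi c) -> c = 0) ->
  forall c, rel c -> c = 0.
Proof.
move=> indep c; have [N] := ubnP #|[set i | c 0 i != 0]|.
elim: N c => // N IHN c sc rc; apply/eqP; apply: contraT => /rV0Pn[i0 ci0].
pose b := (c 0 i0)^-1 *: c; have rb : rel b by apply: relZ.
have bi0 : b 0 i0 = 1 by rewrite mxE mulVf.
have : map_mx sigma b - b = 0.
  apply: IHN; last by apply: relB => //; apply: rel_sigma.
  rewrite -ltnS; apply: leq_trans sc; apply: proper_card; apply/properP; split.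
    apply/fintype.subsetP => i; rewrite !inE !mxE; apply: contraNneq => ->.
    by rewrite !mulr0 rmorph0 subrr.
  by exists i0; rewrite inE ?ci0// !mxE mulVf// rmorph1 subrr eqxx.
move=> /eqP; rewrite subr_eq0 => /eqP/matrixP sb.
have /choice[r0 hr0] : forall i, exists r0, b 0 i = phi r0.
  by move=> i; apply: fixedP; have := sb 0 i; rewrite mxE.
have := indep (\row_i r0 i); rewrite [map_mx _ _](_ : _ = b); last first.
  by apply/rowP => i; rewrite !mxE -hr0 mxE.
move=> /(_ rb)/rowP/(_ i0); rewrite !mxE => r00.
by move: bi0; rewrite hr0 r00 rmorph0 => /eqP; rewrite eq_sym oner_eq0.
Qed.

End LinearRelations.

(** Meant for M^tau, whose finite dimension has to be deduced from a bound on independent families;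
    a family of maximal length spans. *)
Lemma bounded_independent_free (R : fieldType) (V : lmodType R) (N : nat) :
  (forall n (v : 'I_n -> V),
     (forall c : 'rV[R]_n, \sum_i c 0 i *: v i = 0 -> c = 0) -> (n <= N)%N) ->
  exists n (v : 'I_n -> V), (forall c : 'rV[R]_n, \sum_i c 0 i *: v i = 0 -> c = 0) /\
    exists co, is_basis v co.
Proof.
move=> bound; pose P n := `[< exists v : 'I_n -> V,
  forall c : 'rV[R]_n, \sum_i c 0 i *: v i = 0 -> c = 0 >].
have exP : exists n, P n.
  by exists 0%N; apply/asboolP; exists (fun=> 0) => c _; rewrite thinmx0.
have leP n : P n -> (n <= N)%N by move=> /asboolP[v]; apply: bound.
case: (ex_maxnP exP leP) => n /asboolP[v indep] nmax; exists n, v; split=> //.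
have /choice[co hco] : forall m, exists c : 'rV[R]_n, m = \sum_i c 0 i *: v i.
  move=> m; apply: contrapT => nspan.
  have : (n.+1 <= n)%N; last by rewrite ltnn.
  apply: nmax; apply/asboolP; exists (fun i => if unlift ord0 i is Some l then v l else m) => c.
  rewrite big_ord_recl unlift_none; under eq_bigr do rewrite liftK.
  have [c0|c0] := eqVneq (c 0 ord0) 0.
    rewrite c0 scale0r add0r => cv.
    have /rowP c'0 : \row_i c 0 (lift ord0 i) = 0.
      by apply: indep; rewrite -[RHS]cv; apply: eq_bigr => r _; rewrite mxE.
    apply/rowP => i; rewrite mxE; case: (unliftP ord0 i) => [l ->|->//].
    by have := c'0 l; rewrite !mxE.
  move=> /eqP; rewrite addr_eq0 => /eqP cm; case: nspan.
  exists (- (c 0 ord0)^-1 *: \row_i c 0 (lift ord0 i)).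
  apply: (scalerI c0); rewrite cm scaler_sumr -sumrN; apply: eq_bigr => l _.
  by rewrite !mxE scalerA mulrA mulrN mulfV// mulN1r scaleNr.
exists co; split=> // c; apply/eqP; rewrite -subr_eq0; apply/eqP/indep.
under eq_bigr do rewrite mxE mxE scalerDl scaleNr.
by rewrite big_split sumrN /= -hco subrr.
Qed.

End Bases.

(** * Weight 0 and fixed vectors *)

Section FixedSpanned.
Variables (R : comNzRingType) (sigma : {rmorphism R -> R}).
Implicit Types N : tauModule sigma.

(** The form in which weight 0 is used: being spanned by fixed vectors passes through direct sums
    and isomorphisms without any choice of bases. *)
Definition fixed_spanned N : Prop := forall x : N, exists s : seq (R * N),
  (forall p, p \in s -> tau N p.2 = p.2) /\ x = \sum_(p <- s) p.1 *: p.2.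

Lemma fixed_spanned_zero : fixed_spanned (tau_zero sigma).
Proof. by move=> x; exists [::]; split=> //; rewrite big_nil; apply: thinmx0. Qed.

Lemma fixed_spanned_sum N1 N2 :
  fixed_spanned N1 -> fixed_spanned N2 -> fixed_spanned (tau_sum N1 N2).
Proof.
move=> sp1 sp2 [x1 x2]; have [s1 [f1 e1]] := sp1 x1; have [s2 [f2 e2]] := sp2 x2.
exists ([seq (p.1, (p.2, 0 : N2)) | p <- s1] ++ [seq (p.1, (0 : N1, p.2)) | p <- s2]).
split=> [p|].
  rewrite mem_cat => /orP[] /mapP[r rs ->] /=; rewrite /tau_sum_fun /= raddf0.
    by rewrite f1.
  by rewrite f2.
rewrite big_cat !big_map /= e1 e2; apply: injective_projections => /=.
  rewrite (raddf_sum fst) (raddf_sum fst) /=.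
  by rewrite [X in _ + X]big1 ?addr0// => p _; rewrite scaler0.
rewrite (raddf_sum snd) (raddf_sum snd) /=.
by rewrite [X in X + _]big1 ?add0r// => p _; rewrite scaler0.
Qed.

Lemma fixed_spanned_iso N1 N2 : tau_iso N1 N2 -> fixed_spanned N2 -> fixed_spanned N1.
Proof.
move=> [f [[g fK gK] ft]] sp x; have [s [sf e]] := sp (f x).
exists [seq (p.1, g p.2) | p <- s]; split=> [p /mapP[r rs ->] /=|].
  by apply: (can_inj fK); rewrite ft !gK sf.
apply: (can_inj fK); rewrite e big_map linear_sum; apply: eq_bigr => p _.
by rewrite linearZ /= gK.
Qed.

End FixedSpanned.

Section Weights.
Variables (k : finFieldType) (K : fieldType) (iota : {rmorphism k -> K}).

Lemma fixed_spanned_weight0 : fixed_spanned (weight_module iota 0).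
Proof.
rewrite /weight_module; have : numq 0 = 0 by []; have : `|denq 0|%N = 1%N by [].
move: (numq 0) (`|denq 0|%N) => s r -> -> x.
exists [:: (x 0 0, const_mx 1)]; split=> [p|].
  rewrite inE => /eqP->; apply/rowP => i; rewrite !mxE big_ord1 !mxE /= ord1 expr0z.
  by rewrite mulr1; apply: rmorph1.
by rewrite big_seq1; apply/rowP => i; rewrite !mxE ord1 mulr1.
Qed.

Lemma fixed_spanned_has_weights N w : has_weights N w ->
  (forall mu, mu \in w -> mu = 0) -> @fixed_spanned _ (sigma_laurent iota) N.
Proof.
move=> Nw w0; apply: fixed_spanned_iso Nw _; elim: w w0 => [|mu w IHw] w0 /=.
  exact: fixed_spanned_zero.
apply: fixed_spanned_sum; last by apply: IHw => nu nuw; apply: w0; rewrite inE nuw orbT.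
by rewrite (w0 mu) ?mem_head//; apply: fixed_spanned_weight0.
Qed.

End Weights.

(** Finitely many fixed vectors suffice to span the vectors 1 (x) e_i; n independent ones among them
    are the columns of [C]. *)
Lemma fixed_basis_mx (R : comNzRingType) (F : fieldType) (sigma : {rmorphism R -> R})
    (sigma' : {rmorphism F -> F}) (phi : {rmorphism R -> F})
    (phi_sigma : forall r, sigma' (phi r) = phi (sigma r)) (M : tauModule sigma)
    n (e : 'I_n -> M) co :
  is_basis e co -> fixed_spanned (base_change phi_sigma M) ->
  exists C : 'M[F]_n, C \in unitmx /\
    map_mx phi (tau_mx e co) *m map_mx sigma' C = C.
Proof.
move=> eco sp; have [_ coP'] := tensor_basis eco phi.
have /choice[s hs] := fun i => sp (tens phi 1 (e i)).
pose S := flatten [seq s i | i : 'I_n].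
have Sfixed p : p \in S -> tau (base_change phi_sigma M) p.2 = p.2.
  by move=> /flatten_mapP[i _]; case: (hs i) => + _; apply.
pose y (r : 'I_(size S)) : base_change phi_sigma M := (tnth (in_tuple S) r).2.
pose Y : 'M[F]_(size S, n) := \matrix_r tensor_co co (y r).
have Yfull : row_full Y.
  rewrite -sub1mx; apply/row_subP => i.
  have -> : row i 1%:M = tensor_co co (tens phi 1 (e i)).
    rewrite (tensor_co_tens eco) scale1r row1.
    have [_ coP] := eco; rewrite -[e i](_ : \sum_l (delta_mx 0 i : 'rV_n) 0 l *: e l = _).
      by rewrite coP map_delta_mx.
    rewrite (bigD1 i)//= mxE !eqxx scale1r big1 ?addr0//.
    by move=> l li; rewrite mxE (negPf li) andbF scale0r.
  have [_ ->] := hs i; rewrite (co_sum (tensor_basis eco phi)).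
  rewrite big_seq; apply: summx_sub => p ps.
  rewrite (coZ (tensor_basis eco phi)); apply: scalemx_sub.
  have pS : p \in S by apply/flatten_mapP; exists i; rewrite ?mem_enum.
  have pn : (index p S < size S)%N by rewrite index_mem.
  have -> : tensor_co co p.2 = row (Ordinal pn) Y.
    by rewrite rowK /y (tnth_nth p) /= nth_index.
  exact: row_sub.
pose f := fullrankfun Yfull.
have ffull : row_full (rowsub f Y) by apply: fullrowsub_full.
exists (rowsub f Y)^T; split; first by rewrite unitmx_tr -row_full_unit.
apply/matrixP => a b.
have yb : tau (base_change phi_sigma M) (y (f b)) = y (f b).
  by apply: Sfixed; apply: mem_tnth.
have /(base_change_fixed eco)/matrixP/(_ a 0) := yb; rewrite mxE [RHS]mxE => e1.
transitivity (tensor_co co (y (f b)) 0 a); last by rewrite !mxE.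
rewrite -e1 mxE; apply: eq_bigr => l _; congr (_ * _).
by rewrite !mxE.
Qed.

(** * Fixed rational functions and finitely valued series *)

Section FixedRationalFunctions.
Variables (k : finFieldType) (L : fieldType) (iota : {rmorphism k -> L}).

Lemma frob_fixedP z : frob iota z = z -> exists a, z = iota a.
Proof.
move=> fz; have := congr1 (fun p => (map_poly iota p).[z]) (finField_genPoly k).
rewrite rmorphB /= map_polyXn map_polyX !hornerE -[_ ^+ _]/(frob iota z) fz subrr.
rewrite rmorph_prod horner_prod => /esym/eqP/prodf_eq0[a _].
rewrite rmorphB /= map_polyX map_polyC hornerXsubC subr_eq0 => /eqP->.
by exists a.
Qed.

Lemma poly_fixedP (p : {poly L}) : map_poly (frob iota) p = p ->
  exists r, p = map_poly iota r.
Proof.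
move=> pf; have /choice[a ha] : forall n, exists a, p`_n = iota a.
  by move=> n; apply: frob_fixedP; have := congr1 (fun p : {poly L} => p`_n) pf; rewrite coef_map.
exists (\poly_(n < size p) a n); apply/polyP => n; rewrite coef_map /= coef_poly.
case: ltnP => [_|np]; first exact: ha.
by rewrite rmorph0 nth_default.
Qed.

(** The fraction in lowest terms with monic denominator is unique, so sigma fixes its numerator and
    denominator separately. *)
Lemma rat_fixedP r : sigma_rat iota r = r -> exists r0, r = rat_base iota r0.
Proof.
have [->|r0] := eqVneq r 0; first by exists 0; rewrite rmorph0.
have [n [d [n0 d0 e]]] := fraction_div r0.
pose c := gcdp n d; have c0 : c != 0 by rewrite gcdp_eq0 negb_and n0.
have [/dvdpP[n' en] /dvdpP[d' ed]] : c %| n /\ c %| d by rewrite dvdp_gcdl dvdp_gcdr.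
have d'0 : d' != 0 by apply: contraNneq d0 => d'0; rewrite ed d'0 mul0r.
have co : coprimep n' d'.
  have := @coprimep_div_gcd _ n d; rewrite -/c n0 => /(_ isT).
  by rewrite {1}en {1}ed !mulpK.
pose l := (lead_coef d')^-1; have l0 : l != 0 by rewrite invr_eq0 lead_coef_eq0.
pose n1 := l *: n'; pose d1 := l *: d'.
have d1m : d1 \is monic by rewrite monicE lead_coefZ mulVf ?lead_coef_eq0.
have d10 : d1 != 0 by rewrite monic_neq0.
have {}co : coprimep d1 n1 by rewrite coprimepZl// coprimepZr// coprimep_sym.
have {}e : r = tofrac n1 / tofrac d1.
  have lf0 : tofrac l%:P != 0 by rewrite tofrac_eq0 polyC_eq0.
  have cf0 : tofrac c != 0 by rewrite tofrac_eq0.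
  rewrite e en ed !tofracM -(mulf_div _ (tofrac d')) (divff cf0) mulr1.
  by rewrite /n1 /d1 -!mul_polyC !tofracM -(mulf_div (tofrac l%:P)) (divff lf0) mul1r.
rewrite e [sigma_rat _ _]ratmap_div => /eqP.
set nf := map_poly _ n1; set df := map_poly _ d1.
have df0 : df != 0 by rewrite map_poly_eq0.
rewrite eqr_div ?tofrac_eq0// -!tofracM tofrac_eq => /eqP enf.
have dd : df = d1.
  apply/esym/eqP; rewrite -eqp_monic ?map_monic// -dvdp_size_eqp ?size_map_poly//.
  by rewrite -(Gauss_dvdpr _ co) -enf dvdp_mull.
have nn : nf = n1 by apply: (mulIf d10); rewrite enf dd.
have [n2 en2] := poly_fixedP nn; have [d2 ed2] := poly_fixedP dd.
exists (tofrac n2 / tofrac d2); rewrite [rat_base _ _]ratmap_div.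
by rewrite -en2 -ed2.
Qed.

End FixedRationalFunctions.

Section FinitelyValuedSeries.
Variables (k L : fieldType) (iota : {rmorphism k -> L}).

Lemma spoly_rat (h : {poly L}) : exists r : ratfun L, rat_laurent r = spoly h.
Proof.
exists (\sum_(j < size h) tofrac (h`_j)%:P * (tofrac 'X)^-1 ^+ j).
rewrite rmorph_sum spolyE; apply: eq_bigr => j _.
rewrite rmorphM rmorphXn fmorphV /= laurent_tE rat_laurent_tofrac.
rewrite /poly_laurent map_polyC hornerC; congr (_ * _ ^+ _).
have t0 : laurent_t L != 0.
  by apply/eqP => t0; have := laurent_st L; rewrite t0 mulr0 => /eqP; rewrite eq_sym oner_eq0.
by apply: (mulIf t0); rewrite mulVf// laurent_st.
Qed.

(** The series is sorted by the values of its coefficients: each value w multiplies the 0-1 series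
    marking where w is taken. *)
Lemma finitely_valued_combination (z : laurent L) (W : seq L) :
  (forall n : int, lcoef z n \in W) ->
  exists (c : seq_sub W -> laurent k),
    z = \sum_w lconst (val w) * lmap iota (c w).
Proof.
move=> zW.
(* The value 0 must be left out, since it is taken at all sufficiently negative indices. *)
have bc (w : seq_sub W) : bounded_below (fun n : int =>
    if (val w != 0) && (lcoef z n == val w) then (1 : k) else 0).
  have [b zb] := lcoefP z; exists b => n nb; rewrite zb//.
  by case: (eqVneq (val w) 0) => //= w0; rewrite eq_sym (negPf w0).
exists (fun w => Laurent (bc w)); apply: laurentP => n; rewrite lcoef_sum.
under eq_bigr do rewrite lcoef_lconstM /=.
rewrite (bigD1 (SeqSub (zW n)))//= eqxx andbT big1 ?addr0 => [|w wn].
  by case: eqVneq => [->|_] /=; rewrite ?rmorph0 ?rmorph1 ?mul0r ?mulr1.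
case: ifP => [/andP[_ /eqP e]|_]; last by rewrite rmorph0 mulr0.
by case/eqP: wn; apply: val_inj => /=.
Qed.

End FinitelyValuedSeries.

(** * The comparison map *)

Section Comparison.
Variables (k : finFieldType) (L : fieldType) (iota : {rmorphism k -> L}).
Variables (Lsep : fieldType) (j : {rmorphism L -> Lsep}).
Variable M : tauModule (sigma_rat iota).
Local Notation ME := (laurent_base_change M j).
Local Notation base := (laurent_base (j \o iota)).
Local Notation rho := (rat_to_laurent j).
Local Notation tens1 := (tens rho 1).
Variables (n : nat) (e : 'I_n -> M) (co : M -> 'rV[ratfun L]_n).
Hypothesis e_basis : is_basis e co.

Let rho_basis := tensor_basis e_basis rho.

Lemma tensor_co_gal (g : galois_aut j) (X : ME) :
  tensor_co co (gal_act g X) = map_mx (lmap g) (tensor_co co X).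
Proof.
have grho x : lmap g (rho x) = rho x by apply: gal_rat_to_laurent.
elim/tensor_ind: X => [|X Y IHX IHY|a m].
- have co00 : tensor_co co (0 : ME) = 0 by apply: (co0 rho_basis).
  by rewrite gal_act0 co00 map_mx0.
- by rewrite gal_actD !(tensor_coD e_basis) map_mxD IHX IHY.
- rewrite gal_act_tens !(tensor_co_tens e_basis) map_mxZ; congr (_ *: _).
  by apply/rowP => i; rewrite !mxE; apply: esym; apply: grho.
Qed.

Lemma gal_invariant_coord (X : ME) : separable_closure j ->
  (forall g : galois_aut j, gal_act g X = X) ->
  exists x : 'rV[laurent L]_n, tensor_co co X = map_mx (lmap j) x.
Proof.
move=> sepE Xg.
have fixc i N (g : galois_aut j) : g (lcoef (tensor_co co X 0 i) N) = lcoef (tensor_co co X 0 i) N.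
  by rewrite -[in RHS](Xg g) tensor_co_gal mxE.
have /choice[a ha] : forall i, exists a : int -> L, forall N,
    lcoef (tensor_co co X 0 i) N = j (a N).
  move=> i; have [|a ha] := @choice _ _ (fun N aN => lcoef (tensor_co co X 0 i) N = j aN).
    by move=> N; apply: (galois_fixed sepE) => g; apply: fixc.
  by exists a.
have ba i : bounded_below (a i).
  have [b Xb] := lcoefP (tensor_co co X 0 i); exists b => N Nb; apply: (fmorph_inj j).
  by rewrite rmorph0 -ha Xb.
exists (\row_i Laurent (ba i)); apply/rowP => i; rewrite !mxE.
by apply: laurentP => N /=; apply: ha.
Qed.

Lemma baseE (c : laurent k) : base c = lmap j (lmap iota c).
Proof. exact: laurentP. Qed.

Lemma tens1Z r (m : M) : tens1 (r *: m) = rho r *: tens1 m.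
Proof. by rewrite -tens_balanced mul1r scale_tens mulr1. Qed.

Lemma tens1_sum I (s : seq I) (F : I -> M) :
  tens1 (\sum_(i <- s) F i) = \sum_(i <- s) tens1 (F i).
Proof. exact: tens_sumr. Qed.

(** Series over k are fixed by sigma, so sigma maps relations between them to relations, and Artin's
    argument lifts independence from k(t) to L(t). *)
Lemma relation_closed (r : nat) (c : 'I_r -> laurent k) :
  (forall d : 'rV[ratfun k]_r, \sum_i rat_laurent (d 0 i) * c i = 0 -> d = 0) ->
  forall d : 'rV[ratfun L]_r, \sum_i rat_laurent (d 0 i) * lmap iota (c i) = 0 -> d = 0.
Proof.
move=> indep.
apply: (@relation_descent _ _ (sigma_rat iota) (rat_base iota) (@rat_fixedP _ _ iota) r
  (fun d => \sum_i rat_laurent (d 0 i) * lmap iota (c i) = 0)).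
- move=> a d dc; transitivity (rat_laurent a * \sum_i rat_laurent (d 0 i) * lmap iota (c i)).
    by rewrite mulr_sumr; apply: eq_bigr => i _; rewrite mxE rmorphM mulrA.
  by rewrite dc mulr0.
- move=> d d' dc d'c.
  transitivity (\sum_i rat_laurent (d 0 i) * lmap iota (c i) -
                \sum_i rat_laurent (d' 0 i) * lmap iota (c i)); last by rewrite dc d'c subrr.
  by rewrite -sumrB; apply: eq_bigr => i _; rewrite !mxE rmorphB mulrBl.
- move=> d dc.
  transitivity (sigma_laurent iota (\sum_i rat_laurent (d 0 i) * lmap iota (c i))).
    rewrite [RHS]lmap_sum; apply: eq_bigr => i _; rewrite lmapM mxE.
    by rewrite -sigma_rat_laurent [lmap _ (lmap iota _)]sigma_laurent_base.
  by rewrite dc rmorph0.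
- move=> d dc; apply: indep; apply: (fmorph_inj (lmap iota)).
  rewrite rmorph0 -[RHS]dc [LHS]lmap_sum; apply: eq_bigr => i _.
  by rewrite lmapM mxE lmap_rat.
Qed.

(** In an expression with the fewest terms the coefficients are independent: a k(t)-relation would
    eliminate one of them, its term being distributed over the other vectors of M. *)
Lemma minimal_combination (X : ME) (I : finType) (c0 : I -> laurent k) (m0 : I -> M) :
  X = \sum_i base (c0 i) *: tens1 (m0 i) ->
  exists (r : nat) (c : 'I_r -> laurent k) (m : 'I_r -> M),
  X = \sum_i base (c i) *: tens1 (m i) /\
  forall d : 'rV[ratfun k]_r, \sum_i rat_laurent (d 0 i) * c i = 0 -> d = 0.
Proof.
move=> X0; pose P r := `[< exists (c : 'I_r -> laurent k) (m : 'I_r -> M),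
  X = \sum_i base (c i) *: tens1 (m i) >].
have exP : exists r, P r.
  exists #|I|; apply/asboolP; exists (c0 \o enum_val), (m0 \o enum_val).
  by rewrite X0 (reindex _ (onW_bij _ (@enum_val_bij I))).
case: (ex_minnP exP) => r /asboolP[c [m Xcm]] rmin; exists r, c, m; split=> // d dc.
apply/eqP; apply: contraT => /rV0Pn[b db].
case: r c m Xcm rmin d dc b db => [|r] c m Xcm rmin d dc b db; first by case: b {db}.
suff : (r.+1 <= r)%N by rewrite ltnn.
pose u l := - (d 0 (lift b l) / d 0 b).
apply: rmin; apply/asboolP; exists (c \o lift b).
exists (fun l => m (lift b l) + rat_base iota (u l) *: m b).
have cb : c b = \sum_l rat_laurent (u l) * c (lift b l).
  have rdb : rat_laurent (d 0 b) != 0 by rewrite fmorph_eq0.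
  apply: (mulfI rdb); move: dc; rewrite (bigD1_ord b)//= => /eqP.
  rewrite addr_eq0 => /eqP->; rewrite mulr_sumr -sumrN; apply: eq_bigr => l _.
  rewrite /u rmorphN mulNr mulrN fmorph_div; congr (- _).
  by rewrite mulrA mulrCA divff// mulr1.
rewrite Xcm (bigD1_ord b)//= {1}cb rmorph_sum scaler_suml -big_split /=.
apply: eq_bigr => l _; rewrite [tens1 (_ + _)]tensDr tens1Z scalerDr scalerA addrC; congr (_ + _).
rewrite -base_rat_laurent; congr (_ *: _).
by rewrite [LHS](rmorphM base) mulrC.
Qed.

(** Subtracting X from tau X gives a relation between the [c i] whose coefficients are the
    coordinates of tau(m_i) - m_i in L(t); they vanish by independence. *)
Lemma coefficients_fixed (X : ME) (r : nat) (c : 'I_r -> laurent k) (m : 'I_r -> M) :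
  tau ME X = X -> X = \sum_i base (c i) *: tens1 (m i) ->
  (forall d : 'rV[ratfun k]_r, \sum_i rat_laurent (d 0 i) * c i = 0 -> d = 0) ->
  forall i, tau M (m i) = m i.
Proof.
move=> tX Xcm indep i; apply/eqP; rewrite -subr_eq0; apply/eqP.
pose delta i := tau M (m i) - m i.
have rel : \sum_i base (c i) *: tens1 (delta i) = 0.
  transitivity (tau ME X - X); last by rewrite tX subrr.
  rewrite Xcm linear_sum -sumrB; apply: eq_bigr => l _.
  rewrite [tau ME _]tauZ sigma_laurent_base.
  rewrite -scalerBr; congr (_ *: _).
  rewrite [tau ME (tens1 _)]base_change_tens rmorph1 /delta.
  by rewrite [tens1 (_ - _)]tensDr -[- m l]scaleN1r tens1Z rmorphN rmorph1 scaleN1r.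
apply: (co_inj e_basis); rewrite (co0 e_basis); apply/rowP => l; rewrite [RHS]mxE.
suff : \row_i co (delta i) 0 l = 0 by move=> /rowP/(_ i); rewrite !mxE.
apply: (relation_closed indep); apply: (fmorph_inj (lmap j)); rewrite rmorph0.
have := congr1 (fun x => tensor_co co x 0 l) rel.
rewrite (co_sum rho_basis) summxE (co0 rho_basis) mxE => <-.
rewrite [LHS]lmap_sum; apply: eq_bigr => a _.
rewrite (coZ rho_basis) mxE (tensor_co_tens e_basis) scale1r mxE lmapM mxE baseE mulrC.
by [].
Qed.

Lemma natural_map_val_sum r (c : 'I_r -> laurent k) (m : 'I_r -> rat_tau_inv M) :
  natural_map_val j (\sum_i c i *: tens (@rat_laurent k) 1 (m i)) =
  \sum_i base (c i) *: tens1 (tau_inv_val (m i)).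
Proof.
elim/big_rec2: _ => [|i x y _ IH]; first exact: natural_map_val0.
rewrite natural_map_valD -IH; congr (_ + _).
by rewrite natural_map_val_scale natural_map_val_tens rmorph1.
Qed.

(** Artin's argument for relations between fixed vectors. It bounds the dimension of M^tau by the
    rank of M. *)
Lemma tau_inv_independent r (v : 'I_r -> rat_tau_inv M) :
  (forall d : 'rV[ratfun k]_r, \sum_i d 0 i *: v i = 0 -> d = 0) ->
  row_free (\matrix_i co (tau_inv_val (v i))).
Proof.
move=> indep.
have indepL : forall d : 'rV[ratfun L]_r, \sum_i d 0 i *: tau_inv_val (v i) = 0 -> d = 0.
  apply: (@relation_descent _ _ (sigma_rat iota) (rat_base iota) (@rat_fixedP _ _ iota) r
    (fun d => \sum_i d 0 i *: tau_inv_val (v i) = 0)).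
  - move=> a d dv; transitivity (a *: \sum_i d 0 i *: tau_inv_val (v i)).
      by rewrite scaler_sumr; apply: eq_bigr => i _; rewrite mxE scalerA.
    by rewrite dv scaler0.
  - move=> d d' dv d'v.
    transitivity (\sum_i d 0 i *: tau_inv_val (v i) - \sum_i d' 0 i *: tau_inv_val (v i)).
      by rewrite -sumrB; apply: eq_bigr => i _; rewrite !mxE scalerBl.
    by rewrite dv d'v subrr.
  - move=> d dv; transitivity (tau M (\sum_i d 0 i *: tau_inv_val (v i))).
      rewrite linear_sum; apply: eq_bigr => i _.
      by rewrite linearZ /= tau_inv_valP mxE.
    by rewrite dv linear0.
  - move=> d dv; apply: indep; apply: tau_inv_val_inj; rewrite [RHS]raddf0 -[RHS]dv.
    rewrite [LHS]raddf_sum; apply: eq_bigr => i _.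
    by rewrite [LHS]tau_inv_valZ mxE.
apply: inj_row_free => d dB; apply: indepL; apply: (co_inj e_basis).
rewrite (co0 e_basis) -[RHS]dB mulmx_sum_row (co_sum e_basis).
by apply: eq_bigr => i _; rewrite (coZ e_basis) rowK.
Qed.

End Comparison.

(** A basis of M^tau has a coordinate matrix of full row rank over L(t), and rank is unchanged by
    extension to Lsep((1/t)). *)
Lemma natural_map_injective (k : finFieldType) (L : fieldType) (iota : {rmorphism k -> L})
    (Lsep : fieldType) (j : {rmorphism L -> Lsep}) (M : tauModule (sigma_rat iota))
    n (e : 'I_n -> M) co r (v : 'I_r -> rat_tau_inv M) vco :
  is_basis e co -> is_basis v vco ->
  (forall c : 'rV[ratfun k]_r, \sum_i c 0 i *: v i = 0 -> c = 0) ->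
  injective (natural_map j M).
Proof.
move=> eco vbasis vindep; apply: raddf_inj => y ny.
have [yE _] := tensor_basis vbasis (@rat_laurent k).
pose c := tensor_co vco y : 'rV[laurent k]_r.
have yc : y = \sum_i c 0 i *: tens (@rat_laurent k) 1 (v i) := yE y.
have : natural_map_val j y = 0.
  exact: (congr1 (fun z : laurent_gal_inv j M => tau_inv_val (fixed_val z)) ny).
rewrite {1}yc natural_map_val_sum => rel.
have free_rho : row_free (map_mx (rat_to_laurent j) (\matrix_i co (tau_inv_val (v i)))).
  by have := tau_inv_independent eco vindep; rewrite /row_free mxrank_map.
have bc0 : map_mx (laurent_base (j \o iota)) c = 0.
  apply: (row_free_inj free_rho); rewrite mul0mx; apply/rowP => l; rewrite [RHS]mxE.
  have := congr1 (fun x => tensor_co co x 0 l) rel.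
  rewrite (co_sum (tensor_basis eco _)) summxE (co0 (tensor_basis eco _)) [RHS]mxE => <-.
  rewrite mxE; apply: eq_bigr => i _.
  rewrite (coZ (tensor_basis eco _)) (tensor_co_tens eco) scale1r.
  by rewrite !mxE.
rewrite yc big1// => i _; have /rowP/(_ i) := bc0; rewrite !mxE => /eqP.
by rewrite fmorph_eq0 => /eqP->; rewrite scale0r.
Qed.

(** The field K of the purity hypothesis only supplies the rational basis [G] and its system, and
    Lsep only supplies coordinates in L((1/t)). Both are left behind before the finiteness theorem
    is applied over L, so they need not be compared. *)
Lemma natural_map_surjective (k : finFieldType) (L : fieldType) (iota : {rmorphism k -> L})
    (Lsep : fieldType) (j : {rmorphism L -> Lsep}) (M : tauModule (sigma_rat iota))
    n (e : 'I_n -> M) co :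
  finitely_generated_field iota -> separable_closure j -> is_basis e co ->
  pure_of_weight M 0 ->
  forall z : laurent_gal_inv j M, exists y, natural_map j M y = z.
Proof.
move=> fg sepE eco [K [jK [w [_ Mw w0]]]] z.
have [C [C_unit CA]] := fixed_basis_mx eco (fixed_spanned_has_weights Mw w0).
have [G [d [P [G_unit d0 Gsys]]]] := integral_model C_unit CA.
pose X : laurent_base_change M j := tau_inv_val (fixed_val z).
have tX : tau (laurent_base_change M j) X = X by apply: tau_inv_valP.
have gX (g : galois_aut j) : gal_act g X = X.
  exact: (congr1 (@tau_inv_val _ _ _ _ _ _) (fixedP z g)).
have [x0 Xx0] := gal_invariant_coord eco sepE gX.
pose x := x0^T.
have xA : map_mx (@rat_laurent L) (tau_mx e co) *m map_mx (sigma_laurent iota) x = x.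
  have xT : (map_mx (lmap j) x0)^T = map_mx (lmap j) x by apply/colP => i; rewrite !mxE.
  have /(base_change_fixed eco) := tX; rewrite Xx0 xT => xj.
  apply: (map_mx_inj (f := lmap j)); rewrite -[RHS]xj map_mxM; congr (_ *m _).
    by rewrite -map_mx_comp.
  rewrite -!map_mx_comp; apply: eq_map_mx => s; apply: laurentP => N /=.
  by rewrite /frob rmorphXn.
pose x' := map_mx (@rat_laurent L) (invmx G) *m x.
have [h [h0 [W hW]]] := finitely_valued_fg fg d0 (Gsys x xA).
have hn0 : h != 0 by apply: contra_eq_neq h0 => ->; rewrite coef0 eq_sym oner_neq0.
have [rh hrh] := spoly_rat h.
have sh0 : spoly h != 0 by rewrite raddf_eq0//; apply: spoly_inj.
have /choice[c hc] : forall i : 'I_n, exists c : seq_sub W -> laurent k,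
    spoly h * x' i 0 = \sum_s lconst (val s) * lmap iota (c s).
  by move=> i; apply: finitely_valued_combination; apply: hW.
pose rw (s : seq_sub W) : ratfun L := tofrac (val s)%:P / rh.
have x'E i : x' i 0 = \sum_s rat_laurent (rw s) * lmap iota (c i s).
  apply: (mulfI sh0); rewrite hc mulr_sumr; apply: eq_bigr => s _.
  have -> : rat_laurent (rw s) = lconst (val s) / spoly h.
    rewrite [LHS](fmorph_div (@rat_laurent L)) /= hrh rat_laurent_tofrac.
    by rewrite /poly_laurent map_polyC hornerC.
  by rewrite mulrA mulrCA divff// mulr1.
have xE l : x l 0 = \sum_(p : 'I_n * seq_sub W)
    rat_laurent (G l p.1 * rw p.2) * lmap iota (c p.1 p.2).
  have -> : x = map_mx (@rat_laurent L) G *m x'.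
    by rewrite mulmxA -map_mxM mulmxV// map_mx1 mul1mx.
  rewrite mxE -(pair_bigA _ (fun i s => rat_laurent (G l i * rw s) * lmap iota (c i s))) /=.
  apply: eq_bigr => i _; rewrite x'E mulr_sumr; apply: eq_bigr => s _.
  rewrite [map_mx _ _ _ _]mxE mulrA; congr (_ * _).
  by apply: esym; apply: (rmorphM (@rat_laurent L)).
(* The values of the coefficients, the division by [h] and the base change [G] are all rational and
   go into vectors of M; only series over k remain as scalars. *)
pose m0 (p : 'I_n * seq_sub W) : M := \sum_l (G l p.1 * rw p.2) *: e l.
have Xm0 : X = \sum_p laurent_base (j \o iota) (c p.1 p.2) *:
    tens (rat_to_laurent j) 1 (m0 p).
  have [XE _] := tensor_basis eco (rat_to_laurent j).
  rewrite {1}(XE X) Xx0.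
  under [RHS]eq_bigr do rewrite tens1_sum scaler_sumr.
  rewrite exchange_big /=; apply: eq_bigr => l _.
  have -> : map_mx (lmap j) x0 0 l = lmap j (x l 0) by rewrite !mxE.
  rewrite xE lmap_sum scaler_suml; apply: eq_bigr => p _.
  by rewrite tens1Z scalerA lmapM -baseE mulrC.
have [r [cr [mr [Xr indep]]]] := minimal_combination Xm0.
have mfix := coefficients_fixed eco tX Xr indep.
exists (\sum_i cr i *: tens (@rat_laurent k) 1 (to_tau_inv (@sigma_rat_base _ _ iota) (mfix i))).
apply: val_inj; apply: tau_inv_val_inj.
by apply: etrans (natural_map_val_sum j _ _) _; rewrite -/X Xr.
Qed.

Theorem theorem4p8
    (k : finFieldType) (L : fieldType) (iota : {rmorphism k -> L})
    (Lsep : fieldType) (j : {rmorphism L -> Lsep})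
    (M : tauModule (sigma_rat iota)) :
  finitely_generated_field iota ->
  separable_closure j ->
  etale M ->
  pure_of_weight M 0 ->
  [/\ free_of_finite_rank (tensor_tau_inv M),
      free_of_finite_rank (laurent_gal_inv j M)
    & bijective (natural_map j M)].
Proof.
move=> fg sepE [freeM _] pureM.
have [n [e [co eco]]] := free_basis freeM.
have bound r (v : 'I_r -> rat_tau_inv M) :
    (forall c : 'rV_r, \sum_i c 0 i *: v i = 0 -> c = 0) -> (r <= n)%N.
  by move=> /(tau_inv_independent eco)/eqP <-; apply: rank_leq_col.
have [r [v [vindep [vco vbasis]]]] := bounded_independent_free bound.
have free_tensor := basis_free (tensor_basis vbasis (@rat_laurent k)).
have /choice[g hg] := natural_map_surjective fg sepE eco pureM.
have nat_bij : bijective (natural_map j M).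
  exists g => y; last exact: hg.
  by apply: (natural_map_injective eco vbasis vindep); apply: hg.
by split=> //; apply: free_iso nat_bij free_tensor.
Qed.
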